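(* Let $\rho$ be a real-valued invariant of rooted trees satisfying $\rho([T_1,\dots,T_k])=f_\rho(\rho(T_1),\dots,\rho(T_k))$ for all $k\ge 1$ and all rooted trees $T_1,\dots,T_k$, where $f_\rho$ is symmetric. Suppose that a tree $T$ with degree sequence $D$ is $\rho$-exchange-extremal. (1) If $f_\rho$ is strictly increasing (strictly increasing in each single variable and strictly increasing under addition of further variables) and $\rho(\bullet)<\rho(B)$ for every rooted tree $B$ with more than one vertex, then $T$ is isomorphic to the greedy tree $\mathcal G(D)$. (2) If $f_\rho$ is strictly decreasing (strictly decreasing in each single variable and strictly decreasing under addition of further variables) and $\rho(\bullet)>\rho(B)$ for every rooted tree $B$ with more than one vertex, then $T$ is isomorphic to the $\mathcal M$-tree $\mathcal M(D)$.
   Context: All trees are finite. $\bullet$ denotes the rooted tree with a single vertex. For rooted trees $T_1,\dots,T_k$, $[T_1,\dots,T_k]$ is the rooted tree whose root is adjacent to exactly the roots of $T_1,\dots,T_k$ (which are the components after deleting the root). The function $f_\rho$ is defined on finite tuples (of any length) of values of $\rho$ and is symmetric (invariant under permutation of its arguments); ''increasing under addition of further variables'' means that appending additional arguments increases its value (similarly for decreasing). Decomposition: let $H$ be a tree and $v\neq w$ two leaves of $H$. $[L_1,\dots,L_k]vHw[R_1,\dots,R_\ell]$ is the tree obtained by identifying the root of $[L_1,\dots,L_k]$ with $v$ and the root of $[R_1,\dots,R_\ell]$ with $w$ ($k,\ell\ge1$). A tree $T$ is $\rho$-exchange-extremal if, whenever $T=[L_1,\dots,L_k]vHw[R_1,\dots,R_\ell]$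 for some tree $H$ with leaves $v\ne w$, then either $k\ge\ell$ and $\min_i\rho(L_i)\ge\max_j\rho(R_j)$, or $k\le\ell$ and $\max_i\rho(L_i)\le\min_j\rho(R_j)$. Degree sequences are written in non-increasing order. Greedy tree $\mathcal G(D)$: start with a root $v$ that is assigned the largest degree in $D$. Give $v$ its neighbours $v_1,\dots,v_{d(v)}$ and assign to them the largest available degrees with $d(v_1)\ge d(v_2)\ge\cdots$. Then give $v_1$ its remaining neighbours $v_{1,1},\dots,v_{1,d(v_1)-1}$ and assign to them the largest available degrees in non-increasing order; then do the same for $v_2$, $v_3$, etc. Continue in this way, always continuing with the labelled vertex of largest degree whose neighbours are not yet labelled (equivalently, process vertices in breadth-first order, in the order in which they were labelled, always assigning the largest remaining degrees). $\mathcal M$-tree $\mathcal M(D)$: the reduced degree sequence of a tree is the sequence $(d_1,\dots,d_t)$, $d_1\ge\cdots\ge d_t\ge2$, of degrees of non-leaf vertices; it determines the degree sequence (when $t\ge 1$), and one writes $\mathcal M(d_1,\dots,d_t)=\mathcal M(D)$. Write $[d]$ for the rooted star with $d$ vertices: a root with $d-1$ leaf children ($[1]=\bullet$). - If $t\le d_t+1$: $\mathcal M(d_1,\dots,d_t)$ is obtained from a star with centre of degree $d_t$ by identifying $t-1$ of its leaves with the roots of $[d_1],\dots,[d_{t-1}]$ respectively, i.e. $[[d_1],\dots,[d_{t-1}],[1],\dots,[1]]$ with root of degree $d_t$. Label the centre $v_1$ and the other non-leaf vertices $v_2,\dots,v_t$ such that $d(v_i)\le d(v_j)$ whenever $i<j$.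 - If $t\ge d_t+2$: construct first $\mathcal M(d_{d_t},d_{d_t+1},\dots,d_{t-1})$ with its labelling. Let $\ell$ be the largest integer such that $v_\ell$ is a label in it, and $s$ the smallest integer such that $v_s$ is adjacent to a leaf in it. Let $R_{d_t}=[[d_1],\dots,[d_{d_t-1}]]$, and label the roots of $[d_1],\dots,[d_{d_t-1}]$ as $v_{\ell+1},\dots,v_{\ell+d_t-1}$ so that still $d(v_i)\le d(v_j)$ for $i<j$ (the root of $R_{d_t}$ gets no label). $\mathcal M(d_1,\dots,d_t)$ is obtained by identifying the root of $R_{d_t}$ with a leaf adjacent to $v_s$. If there are no non-leaf vertices of degree at least $2$ ($t=0$, at most two vertices), $\mathcal M(D)$ is the unique tree with degree sequence $D$. *)

(* Defs.v *)
From HB Require Import structures.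
From mathcomp Require Import all_boot all_order all_algebra.
From mathcomp Require Import reals.
Set Implicit Arguments.
Unset Strict Implicit.
Unset Printing Implicit Defensive.
Import Order.TTheory GRing.Theory Num.Theory.
Local Open Scope ring_scope.

(* Graphs are bundled relations on a finite type; symmetry and irreflexivity
   are part of [is_tree]. *)
Record graph := Graph { vert :> finType; edge : rel vert }.
Arguments edge {g}.

Record rooted_graph := RootedGraph { unrooted :> graph; rootv : unrooted }.
Arguments rootv : clear implicits.

Definition is_tree (G : graph) : Prop :=
  [/\ symmetric (@edge G), irreflexive (@edge G), (0 < #|G|)%N,
      forall x y : G, connect edge x y
    & forall c : seq G, ucycle edge c -> (size c <= 2)%N].

Definition deg (G : graph) (x : G) : nat := #|[pred y | edge x y]|.

Definition leaf (G : graph) (x : G) : bool := deg x == 1%N.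

Definition degree_sequence (G : graph) (D : seq nat) : Prop :=
  sorted geq D /\ perm_eq D [seq deg x | x : G].

Definition giso (G H : graph) : Prop :=
  exists2 g : G -> H,
    bijective g & forall x y : G, edge (g x) (g y) = edge x y.

Definition riso (A B : rooted_graph) : Prop :=
  exists2 g : A -> B,
    bijective g
    & (forall x y : A, edge (g x) (g y) = edge x y) /\ g (rootv A) = rootv B.

Definition bullet : rooted_graph :=
  @RootedGraph (@Graph unit (fun _ _ => false)) tt.

(* [T_1, ..., T_k]: the new root is [None], and [Some (i, x)] is the vertex x
   of T_i. *)
Section Join.
Variables (k : nat) (F : 'I_k -> rooted_graph).

Definition root_join_edge : rel (option {i : 'I_k & F i}) := fun p q =>
  match p, q with
  | None, None => false
  | None, Some x | Some x, None => tagged x == rootv (F (tag x))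
  | Some x, Some y => (tag x == tag y) && edge (tagged x) (tagged_as x y)
  end.

Definition root_join : rooted_graph :=
  @RootedGraph (@Graph (option {i : 'I_k & F i}) root_join_edge) None.

Definition root_join_child (i : 'I_k) : root_join :=
  Some (Tagged (fun i => F i : Type) (rootv (F i))).

End Join.

(* Identification of the root of A with the vertex x of G. The merged vertex
   is [inl x]. *)
Section Attach.
Variables (G : graph) (x : G) (A : rooted_graph).

Definition attach_edge : rel (G + {a : A | a != rootv A}) := fun p q =>
  match p, q with
  | inl u, inl v => edge u v
  | inr a, inr b => edge (val a) (val b)
  | inl u, inr a => (u == x) && edge (rootv A) (val a)
  | inr a, inl u => (u == x) && edge (val a) (rootv A)
  end.

Definition attach : graph :=
  @Graph (G + {a : A | a != rootv A})%type attach_edge.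

Definition attach_inl (u : G) : attach := inl u.

Definition attach_inr (a : A) : attach :=
  if insub a is Some a' then inr a' else inl x.

End Attach.

(* [L_1, ..., L_k] v H w [R_1, ..., R_l] *)
Definition exchange_tree (k l : nat) (Ls : 'I_k -> rooted_graph) (H : graph)
    (v w : H) (Rs : 'I_l -> rooted_graph) : graph :=
  attach (attach_inl v (root_join Ls) w) (root_join Rs).

Section Invariants.
Variables (R : realType) (rho : rooted_graph -> R) (f : seq R -> R).

(* rho is a function on all rooted graphs, but only its values at rooted trees
   are ever constrained or used. *)
Definition rooted_tree_invariant : Prop :=
  forall A B : rooted_graph,
    is_tree A -> is_tree B -> riso A B -> rho A = rho B.

Definition recursive_via : Prop :=
  forall (k : nat) (F : 'I_k -> rooted_graph),
    (0 < k)%N -> (forall i, is_tree (F i)) ->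
    rho (root_join F) = f [seq rho (F i) | i : 'I_k].

(* The conditions on f only concern nonempty tuples of values of rho. *)
Definition rho_values (s : seq R) : Prop :=
  forall x, x \in s -> exists2 A : rooted_graph, is_tree A & rho A = x.

Definition symmetric_fun : Prop :=
  forall s t : seq R, s != [::] -> rho_values s -> perm_eq s t -> f s = f t.

Definition strictly_increasing : Prop :=
  (forall (s t : seq R) (x y : R),
     rho_values (s ++ x :: t) -> rho_values (s ++ y :: t) -> x < y ->
     f (s ++ x :: t) < f (s ++ y :: t)) /\
  (forall s t : seq R,
     s != [::] -> t != [::] -> rho_values (s ++ t) -> f s < f (s ++ t)).

Definition strictly_decreasing : Prop :=
  (forall (s t : seq R) (x y : R),
     rho_values (s ++ x :: t) -> rho_values (s ++ y :: t) -> x < y ->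
     f (s ++ y :: t) < f (s ++ x :: t)) /\
  (forall s t : seq R,
     s != [::] -> t != [::] -> rho_values (s ++ t) -> f (s ++ t) < f s).

Definition min_rho (k : nat) (F : 'I_k.+1 -> rooted_graph) : R :=
  \big[Num.min/rho (F ord0)]_(i < k.+1) rho (F i).

Definition max_rho (k : nat) (F : 'I_k.+1 -> rooted_graph) : R :=
  \big[Num.max/rho (F ord0)]_(i < k.+1) rho (F i).

Definition exchange_extremal (T : graph) : Prop :=
  forall (k l : nat) (Ls : 'I_k.+1 -> rooted_graph) (H : graph) (v w : H)
         (Rs : 'I_l.+1 -> rooted_graph),
    (forall i, is_tree (Ls i)) -> (forall j, is_tree (Rs j)) ->
    is_tree H -> leaf v -> leaf w -> v != w ->
    giso T (exchange_tree Ls v w Rs) ->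
    ((l.+1 <= k.+1)%N /\ max_rho Rs <= min_rho Ls) \/
    ((k.+1 <= l.+1)%N /\ max_rho Ls <= min_rho Rs).

End Invariants.

(* The vertices of the greedy tree are numbered from 0 in the order in which
   they are labelled, so that vertex j is assigned the degree D_j.  Vertices
   are processed in this order too: vertex j receives as children the next
   [greedy_nchildren D j] unused numbers. *)
Definition greedy_nchildren (D : seq nat) (j : nat) : nat :=
  if j is 0%N then nth 0%N D 0 else (nth 0%N D j).-1.

Definition greedy_first_child (D : seq nat) (j : nat) : nat :=
  (1 + \sum_(m < j) greedy_nchildren D m)%N.

Definition greedy_child (D : seq nat) (j i : nat) : bool :=
  (greedy_first_child D j <= i < greedy_first_child D j.+1)%N.

Definition greedy_tree (D : seq nat) : graph :=
  @Graph 'I_(size D) (fun x y => greedy_child D x y || greedy_child D y x).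

(* [d]: the rooted star with d vertices (d >= 1). *)
Definition star (d : nat) : rooted_graph :=
  root_join (fun _ : 'I_d.-1 => bullet).

(* The label v_i is the i-th entry (counted from 1) of [labels]. *)
Record lgraph := LGraph { lgraph_graph :> graph; labels : seq lgraph_graph }.
Arguments labels : clear implicits.

(* Case t <= d_t + 1.  Sequences are indexed from 0, so the branches are
   [d_1], ..., [d_{t-1}] followed by copies of [1], the default of [nth].
   The reversal makes the degrees of the labelled vertices nondecreasing. *)
Definition M_base (ds : seq nat) : lgraph :=
  let t := size ds in
  let dt := last 0%N ds in
  let F (i : 'I_dt) := star (nth 1%N (take t.-1 ds) i) in
  @LGraph (root_join F)
    (rootv (root_join F) ::
       [seq root_join_child F i | i <- rev (take t.-1 (enum 'I_dt))]).

(* A leaf adjacent to v_s, where s is the smallest index for which there is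
   one. *)
Definition M_leaf (G : lgraph) : option G :=
  if [seq v <- labels G | [exists u : G, edge v u && leaf u]] is vs :: _
  then [pick u : G | edge vs u && leaf u] else None.

(* Case t >= d_t + 2, where G is M(d_{d_t}, ..., d_{t-1}).  Such a G always
   has a leaf adjacent to a labelled vertex, so the last branch of the match is
   irrelevant. *)
Definition M_step (ds : seq nat) (G : lgraph) : lgraph :=
  let dt := last 0%N ds in
  let F (i : 'I_dt.-1) := star (nth 1%N ds i) in
  match M_leaf G with
  | Some u =>
      @LGraph (attach u (root_join F))
        ([seq attach_inl u (root_join F) v | v <- labels G] ++
         [seq attach_inr u (root_join_child F i) | i <- rev (enum 'I_dt.-1)])
  | None => G
  end.

(* The argument n only bounds the depth of the recursion; n = size ds is
   enough. *)
Fixpoint M_rec (n : nat) (ds : seq nat) : lgraph :=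
  let t := size ds in
  let dt := last 0%N ds in
  if n is n'.+1 then
    if (t <= dt.+1)%N then M_base ds
    else M_step ds (M_rec n' (drop dt.-1 (take t.-1 ds)))
  else M_base ds.

Definition reduced_degree_sequence (D : seq nat) : seq nat :=
  [seq d <- D | (2 <= d)%N].

(* If the reduced sequence is empty, the tree has one or two vertices and is
   the star on that many vertices. *)
Definition M_tree (D : seq nat) : graph :=
  let ds := reduced_degree_sequence D in
  if ds is [::] then star (size D) else M_rec (size ds) ds.

(* Main.v *)
Require Import Defs.
From HB Require Import structures.
From mathcomp Require Import all_boot all_order all_algebra.
From mathcomp Require Import reals zify.
Set Implicit Arguments.
Unset Strict Implicit.
Unset Printing Implicit Defensive.
Import Order.TTheory GRing.Theory Num.Theory.

(**
The exchange property makes any two non-leaf vertices comparable: at one of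
them the degree and all the branches away from the other one are at least those
at the other.  With the monotonicity of [f], this becomes a comparison of the
values of the branches themselves.

If [f] is increasing, a minimality argument on branches yields a root that
dominates every vertex; domination then decreases along a breadth-first order in
which the parent of a vertex is a monotone function of it, and the degrees
determine such an order.

If [f] is decreasing, the comparison reverses each time one passes to the
parents.  The values of two disjoint branches compare their leaf depths, up to
parity; hence two paths along which the comparison fails to reverse cannot run in
opposite directions, and there is a root from which no such path leads away.
Ranking the vertices by domination, the parent is antitone in the rank.
Two rooted trees on the same ranked degrees with antitone parents have the same
edges, up to moving the root by one rank, and the recursive construction of the
M-tree produces one of them.
*)

(** * Branches of a tree *)

(** Extremality makes domination total, but nothing makes it transitive. In the decreasing case
    transitivity, the choice of the root and the treatment of ties all go through leaf depths: a
    leaf has the largest value and the comparison reverses at each level, so branch values compare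
    like words in an alternating lexicographic order.

    Neither root is found by maximising a quantity. If no vertex serves, each non-leaf vertex points
    to a neighbour beyond which it fails; by finiteness two neighbours point at each other, and it
    remains to refute two opposite failures.

    In the decreasing case a strict comparison of two vertices must give a strict one of their
    parents, so the danger is a tie between nested parents. Away from the root there is none, but
    the root itself may be tied; it has to be placed before or after its ties, and the parity of a
    leaf depth makes this choice consistent.

    Antitone parents do not determine the root. Counting children shows that two possible roots are
    consecutive in rank and adjacent, so that reversing one edge passes from one rooting to the
    other. *)

Definition avoid (G : graph) (u : G) : rel G :=
  fun a b => [&& edge a b, a != u & b != u].

(** For [u != v] this is the component of [v] after deletion of [u]; when [u] and [v] are adjacent,
    it is the branch hanging at [v] as seen from [u]. *)
Definition br (G : graph) (u v : G) : pred G := connect (avoid u) v.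

(* For [y != u], the neighbour of [u] on the path to [y]; [nx u u = u]. *)
Definition nx (G : graph) (u y : G) : G :=
  odflt u [pick x | edge u x && br u x y].

Section Tree.
Variables (G : graph) (Gt : is_tree G).
Implicit Types (u v w x y z s t a b : G).

Lemma edge_sym : symmetric (@edge G). Proof. by case: Gt. Qed.
Lemma edge_irr : irreflexive (@edge G). Proof. by case: Gt. Qed.

Lemma edge_neq u v : edge u v -> u != v.
Proof. by apply: contraTneq => ->; rewrite edge_irr. Qed.

Lemma avoid_sym u : symmetric (avoid u).
Proof. by move=> a b; rewrite /avoid edge_sym andbA andbAC -andbA. Qed.

Lemma br_sym u : connect_sym (avoid u).
Proof. by apply: sym_connect_sym; exact: avoid_sym. Qed.

Lemma br_refl u v : br u v v. Proof. exact: connect0. Qed.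

Lemma br_trans u v w x : br u v w -> br u w x -> br u v x.
Proof. exact: connect_trans. Qed.

Lemma br_neq u v y : u != v -> br u v y -> u != y.
Proof.
move=> uv /connectP[p]; elim: p v uv => [|x p IH] v uv /=; first by move=> _ ->.
by case/andP=> /and3P[_ _ xu] /IH; apply; rewrite eq_sym.
Qed.

Lemma br_edge u y z : edge y z -> y != u -> z != u -> br u y z.
Proof. by move=> e1 e2 e3; apply: connect1; apply/and3P. Qed.

Lemma br_step u v y z : br u v y -> edge y z -> y != u -> z != u -> br u v z.
Proof. by move=> h e1 e2 e3; apply: br_trans h (br_edge e1 e2 e3). Qed.

Lemma path_avoid u v p :
  path edge v p -> u \notin v :: p -> path (avoid u) v p.
Proof.
elim: p v => [//|x p IH] v /= /andP[e1 e2]; rewrite !inE !negb_or.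
case/and3P=> uv ux up; rewrite /avoid e1 eq_sym uv eq_sym ux IH //.
by rewrite inE negb_or ux.
Qed.

Lemma avoid_path u v p :
  u != v -> path (avoid u) v p -> path edge v p && (u \notin v :: p).
Proof.
elim: p v => [|x p IH] v uv /=; first by rewrite inE uv.
case/andP=> /and3P[e1 _ xu] /IH; rewrite eq_sym in xu.
by rewrite e1 !inE !negb_or uv xu /= => /(_ isT).
Qed.

Lemma br_ex u y : y != u -> exists x, edge u x && br u x y.
Proof.
move=> yu; case: Gt => _ _ _ conn _.
case/connectP: (conn u y) => p0 p0P yE; move: yu.
rewrite yE; case: (shortenP p0P) => -[|x p] //=; first by rewrite eqxx.
case/andP=> e1 e2 /andP[un _] _ _; exists x; rewrite e1.
by apply/connectP; exists p => //; apply: path_avoid.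
Qed.

(* Two neighbours of [u] joined by a path avoiding [u] would close a cycle. *)
Lemma br_nbr u x x' : edge u x -> edge u x' -> br u x x' -> x = x'.
Proof.
move=> e1 e2 /connectP[p0 p0P xE].
case: Gt => _ _ _ _ /(_ (u :: x :: shorten x p0)); move: e2; rewrite xE.
case: (shortenP p0P) => p pP up _ e2.
have [//|xn] := eqVneq x (last x p).
case/andP: (avoid_path (edge_neq e1) pP) => pP' un.
case: p up pP' un pP e2 xn => [|z p] up pP' un pP e2 xn; first by rewrite eqxx in xn.
move=> H; suff: (size [:: u, x, z & p] <= 2)%N by [].
apply: H; rewrite /ucycle; apply/andP; split; last by rewrite cons_uniq un up.
by rewrite (cycle_path u) /= edge_sym e2 e1.
Qed.

Lemma br_uniq u x x' y :
  edge u x -> edge u x' -> br u x y -> br u x' y -> x = x'.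
Proof.
move=> e1 e2 h1; rewrite /br br_sym => h2.
exact: br_nbr e1 e2 (br_trans h1 h2).
Qed.

Lemma nxP u y : y != u -> edge u (nx u y) /\ br u (nx u y) y.
Proof.
move=> yu; rewrite /nx; case: pickP => [x /andP[]//|H].
by case: (br_ex yu) => x; rewrite H.
Qed.

Lemma nx_edge u y : y != u -> edge u (nx u y). Proof. by case/nxP. Qed.
Lemma nx_br u y : y != u -> br u (nx u y) y. Proof. by case/nxP. Qed.

Lemma br_nxE u x y : edge u x -> br u x y = (y != u) && (nx u y == x).
Proof.
move=> ux; apply/idP/andP => [h|[yu /eqP <-]]; last exact: nx_br.
have yu : y != u by rewrite eq_sym; apply: br_neq h; apply: edge_neq.
split=> //; case: (nxP yu) => e1 e2; apply/eqP; exact: br_uniq e1 ux e2 h.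
Qed.

Lemma br_nx u x y : edge u x -> br u x y -> nx u y = x.
Proof. by move=> ux; rewrite br_nxE // => /andP[_ /eqP]. Qed.

Lemma nx_nbr u x : edge u x -> nx u x = x.
Proof. by move=> ux; apply: br_nx => //; apply: br_refl. Qed.

Lemma br_self u v : edge u v -> ~~ br u v u.
Proof. by move=> uv; rewrite br_nxE // eqxx. Qed.

Lemma nx_edge_eq u y z : edge y z -> y != u -> z != u -> nx u y = nx u z.
Proof.
move=> e1 yu zu; symmetry; apply: br_nx; first exact: nx_edge.
exact: br_step (nx_br yu) e1 yu zu.
Qed.

(* A branch is connected, so it lies in one branch of any vertex outside it. *)
Lemma nx_const u v z y : edge u v -> ~~ br u v z -> br u v y -> nx z y = nx z v.
Proof.
move=> uv zn /connectP[p]; rewrite /br in zn.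
elim/last_ind: p y => [|p x IH] y; first by move=> _ ->.
rewrite rcons_path last_rcons => /andP[pP /and3P[e1 e2 e3]] ->.
have h1 : connect (avoid u) v (last v p) by apply/connectP; exists p.
have h2 : connect (avoid u) v x by exact: br_step h1 e1 e2 e3.
rewrite -(IH _ pP erefl); symmetry; apply: nx_edge_eq => //.
- by apply: contraNneq zn => <-.
- by apply: contraNneq zn => <-.
Qed.

Lemma br_sub u v x y : edge u v -> edge v x -> x != u -> br v x y -> br u v y.
Proof.
move=> uv vx xu h.
have un : ~~ br v x u.
  rewrite br_nxE //; apply/negP => /andP[_]; rewrite nx_nbr ?[edge v u]edge_sym //.
  by rewrite eq_sym (negbTE xu).
have vu : v != u by rewrite eq_sym; apply: edge_neq.
have yu : y != u by apply: contraNneq un => <-.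
rewrite br_nxE // yu (nx_const vx un h).
by rewrite -(@nx_edge_eq u v x) // nx_nbr //=.
Qed.

Lemma br_dec u v y :
  edge u v -> br u v y -> y != v -> exists2 z, edge v z && (z != u) & br v z y.
Proof.
move=> uv /connectP[p0 p0P yE]; rewrite yE.
case: (shortenP p0P) => -[|z p] /=; first by rewrite eqxx.
case/andP=> /and3P[f1 f2 f3] f4 /andP[f5 _] _ _.
exists z; first by rewrite f1.
apply/connectP; exists p => //.
have uz : u != z by rewrite eq_sym.
by case/andP: (avoid_path uz f4) => g1 _; apply: path_avoid.
Qed.

Lemma br_nx_neq u v y : edge u v -> br u v y -> y != v -> nx v y != u.
Proof.
move=> uv h yv; case: (br_dec uv h yv) => z /andP[vz zu] /(br_nx vz) ->.
exact: zu.
Qed.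

(** The edge is a bridge. This trades non-membership in a branch for membership in the opposite
    one. *)
Lemma br_cut u v y : edge u v -> br u v y = ~~ br v u y.
Proof.
move=> uv; have vu : edge v u by rewrite edge_sym.
have [->|yv] := eqVneq y v; first by rewrite br_refl br_self.
have [->|yu] := eqVneq y u; first by rewrite br_refl (negbTE (br_self uv)).
rewrite (br_nxE _ vu) yv /=.
apply/idP/idP => [h|nv]; first exact: br_nx_neq.
case: (nxP yv) => e1 e2; exact: br_sub uv e1 nv e2.
Qed.

Lemma br_cross u v y z :
  edge u v -> br u v y -> edge y z -> ~~ br u v z -> y = v /\ z = u.
Proof.
move=> uv h yz zn.
have yu : y != u by apply: contraTneq h => ->; rewrite br_self.
have [zE|zu] := eqVneq z u; last by rewrite (br_step h yz yu zu) in zn.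
split=> //; apply: esym; apply: (br_nbr uv _ h); by rewrite edge_sym -zE.
Qed.

Lemma nx_away v x w y :
  edge v x -> w != v -> ~~ br v x w -> br v x y -> nx w y = nx w v.
Proof.
move=> vx wv wn h; rewrite (nx_const vx wn h).
apply: nx_edge_eq => //; first by rewrite edge_sym.
- by apply: contraNneq wn => <-; rewrite br_refl.
- by rewrite eq_sym.
Qed.

(** Seen from [w], the whole branch at [x] lies in the direction of [v], whereas [y] is another
    direction. *)
Lemma br_disj v x w y u :
  v != w -> edge v x -> edge w y -> ~~ br v x w -> ~~ br w y v ->
  br v x u -> br w y u -> False.
Proof.
move=> vw vx wy wn vn h1 h2; case/negP: vn.
rewrite br_nxE // vw -(nx_away vx _ wn h1) 1?eq_sym //.
by rewrite (br_nx wy h2) eqxx.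
Qed.

Definition bsize u v := #|[pred y | br u v y]|.

Lemma bsize_lt u v x : edge u v -> edge v x -> x != u -> (bsize v x < bsize u v)%N.
Proof.
move=> uv vx xu; apply: proper_card; apply/properP; split.
  by apply/subsetP => y; rewrite !inE; apply: br_sub.
by exists v; rewrite !inE ?br_refl ?br_self.
Qed.

Lemma deg_gt1P v u : edge v u -> reflect (exists2 x, edge v x & x != u) (1 < deg v)%N.
Proof.
move=> vu; rewrite /deg (cardD1 u) inE vu.
apply: (iffP idP) => [|[x h1 h2]].
  rewrite add1n ltnS => /card_gt0P[x]; rewrite !inE => /andP[h1 h2].
  by exists x.
by rewrite add1n ltnS; apply/card_gt0P; exists x; rewrite !inE h1 h2.
Qed.

Lemma deg_gt0 u v : edge u v -> (0 < deg u)%N.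
Proof. by move=> uv; apply/card_gt0P; exists v. Qed.

(** Induction on the size of the branch: the branches hanging at [v] away from [u] are strictly
    smaller. *)
Lemma br_ind (P : G -> G -> Prop) :
  (forall u v, edge u v -> (forall x, edge v x -> x != u -> P v x) -> P u v) ->
  forall u v, edge u v -> P u v.
Proof.
move=> IH u v; have [n] := ubnP (bsize u v); elim: n u v => [//|n IHn] u v.
rewrite ltnS => h uv; apply: IH => // x vx xu; apply: IHn => //.
exact: leq_trans (bsize_lt uv vx xu) h.
Qed.

(* Following [Bd] outwards, the branches shrink unless one turns back. *)
Lemma turning_edge (P : pred G) (Bd : G -> G -> Prop) v0 :
  P v0 -> (forall v, P v -> exists w, [/\ edge v w, P w & Bd v w]) ->
  exists v w, [/\ edge v w, Bd v w & Bd w v].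
Proof.
move=> P0 H; case: (H _ P0) => w0 [e0 Pw0 B0].
suff : forall u v, edge u v -> P v -> Bd u v -> 
   exists v w, [/\ edge v w, Bd v w & Bd w v] by apply; eassumption.
apply: br_ind => u v uv IH Pv Buv; case: (H _ Pv) => x [vx Px Bvx].
have [xE|xu] := eqVneq x u; last exact: IH vx xu Px Bvx.
by rewrite xE in Bvx; exists u, v.
Qed.

End Tree.

(** * Exchange decompositions *)

Definition ind (G : graph) (A : pred G) : graph :=
  @Graph {y : G | A y} (fun a b => edge (val a) (val b)).

Definition branch (G : graph) (u v : G) : rooted_graph :=
  @RootedGraph (ind (br u v)) (exist _ v (br_refl u v)).

Definition embedding (G H : graph) (g : G -> H) :=
  injective g /\ forall x y, edge (g x) (g y) = edge x y.

Lemma emb_bij (G H : graph) (g : G -> H) :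
  injective g -> (forall y, exists x, g x = y) -> bijective g.
Proof.
move=> gi gs; apply: inj_card_bij => //.
rewrite -(card_codom gi); apply: subset_leq_card; apply/subsetP => y _.
by case: (gs y) => x <-; apply: codom_f.
Qed.

Lemma giso_sym (G H : graph) : giso G H -> giso H G.
Proof.
case=> g [h gK hK] ge; exists h; first by exists g.
by move=> x y; rewrite -ge !hK.
Qed.

Lemma emb_cycle (G H : graph) (g : G -> H) (c : seq G) :
  embedding g -> ucycle edge c -> ucycle edge [seq g x | x <- c].
Proof.
case=> gi ge /andP[c1 c2]; rewrite /ucycle map_inj_uniq // c2 andbT.
case: c c1 c2 => [//|x p] /=; rewrite -map_rcons path_map => h _.
by rewrite (@eq_path _ _ edge).
Qed.

Lemma giso_tree (G H : graph) : giso G H -> is_tree G -> is_tree H.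
Proof.
case/giso_sym=> g gb ge [Gs Gi G0 Gc Ga]; split.
- by move=> x y; rewrite -!ge Gs.
- by move=> x; rewrite -ge Gi.
- by rewrite (bij_eq_card gb).
- move=> x y; case/connectP: (Gc (g x) (g y)) => p pP yE.
  case: gb => h gK hK; apply/connectP; exists (map h p).
    by rewrite -(gK x) path_map (@eq_path _ _ edge) // => a b /=; rewrite -ge !hK.
  by rewrite -(gK x) last_map -yE gK.
- move=> c cP; rewrite -(size_map g); apply: Ga; apply: emb_cycle cP.
  by split=> //; apply: bij_inj.
Qed.

Lemma riso_giso (A B : rooted_graph) : riso A B -> giso A B.
Proof. by case=> g gb [ge _]; exists g. Qed.

Section Retract.
Variables (G : graph) (Gt : is_tree G) (A : pred G) (pi : G -> G).
Hypothesis (piA : forall y, A (pi y)) (pi_id : forall y, A y -> pi y = y).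
Hypothesis pi_edge : forall y z, edge y z -> pi y = pi z \/ edge (pi y) (pi z).

(** The retraction maps a path of [G] to a path inside [A], possibly with repetitions, which gives
    connectedness; cycles are inherited through the inclusion. *)
Lemma ind_tree : is_tree (ind A).
Proof.
case: (Gt) => Gs Gi G0 Gc Ga; split.
- by move=> a b; apply: Gs.
- by move=> a; apply: Gi.
- by case/card_gt0P: G0 => x _; apply/card_gt0P; exists (exist _ (pi x) (piA x)).
- have mkE a : exist A (pi (val a)) (piA (val a)) = a.
    by apply: val_inj; rewrite /= pi_id //; apply: (valP a).
  move=> a b; rewrite -(mkE a) -(mkE b).
  case/connectP: (Gc (val a) (val b)) => p pP ->.
  elim: p (val a) pP => [|y p IH] x /=; first by move=> _; apply: connect0.
  case/andP=> /pi_edge e1 /IH; apply: connect_trans.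
  case: e1 => e1; last exact: connect1.
  rewrite (_ : exist _ (pi x) _ = exist _ (pi y) (piA y)); first exact: connect0.
  exact: val_inj.
- move=> c cP; rewrite -(size_map val); apply: Ga.
  by apply: (@emb_cycle (ind A) G val c _ cP); split=> //; apply: val_inj.
Qed.
End Retract.

Section Branches.
Variables (G : graph) (Gt : is_tree G).
Implicit Types (u v w x y z : G).

(** The retraction collapses everything outside the branch to [v]: the only edge leaving the branch
    is [uv]. *)
Lemma branch_tree u v : edge u v -> is_tree (branch u v).
Proof.
move=> uv; apply: (@ind_tree _ Gt _ (fun y => if br u v y then y else v)).
- by move=> y; case: ifP => // _; apply: br_refl.
- by move=> y ->.
- move=> y z yz; case: ifP => hy; case: ifP => hz; [by right| | |by left].
    by left; case: (br_cross Gt uv hy yz (negbT hz)).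
  left; apply: esym; rewrite edge_sym // in yz.
  by case: (br_cross Gt uv hz yz (negbT hy)).
Qed.

Section JoinMap.
Variables (v : G) (k : nat) (n : 'I_k -> G).
Hypothesis (n_inj : injective n) (n_edge : forall i, edge v (n i)).

Definition join_map (p : root_join (fun i => branch v (n i))) : G :=
  if p is Some q then val (tagged q) else v.

Lemma join_map_emb : embedding join_map.
Proof.
have nv i y : br v (n i) y -> v != y by apply: br_neq; apply: edge_neq.
split=> [[[i [x hx]]|] [[j [y hy]]|]|[[i [x hx]]|] [[j [y hy]]|]] /=.
- move=> E; move: hx; rewrite E => hx.
  have nij : n i = n j := br_uniq Gt (n_edge i) (n_edge j) hx hy.
  move/n_inj: nij => ij; subst j; congr (Some (Tagged _ _)); exact: val_inj.
- by move/esym/eqP; rewrite (negbTE (nv _ _ hx)).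
- by move/eqP; rewrite (negbTE (nv _ _ hy)).
- by [].
- rewrite /root_join_edge /=; have [ij|ij] := eqVneq i j.
    by subst j; rewrite tagged_asE.
  apply: contraNF ij => xy; apply/eqP/n_inj.
  apply: (br_uniq Gt (n_edge i) (n_edge j) (y := y)) => //.
  by apply: (br_step hx xy); rewrite eq_sym; [apply: (nv i)|apply: (nv j)].
- rewrite edge_sym //; apply/idP/eqP => [e1|/(congr1 val)/= ->]; last exact: n_edge.
  by apply: val_inj => /=; apply: (br_uniq Gt e1 (n_edge i) _ hx); apply: br_refl.
- apply/idP/eqP => [e1|/(congr1 val)/= ->]; last exact: n_edge.
  by apply: val_inj => /=; apply: (br_uniq Gt e1 (n_edge j) _ hy); apply: br_refl.
- exact: edge_irr.
Qed.

Lemma join_mapP y : y = v \/ (exists i, br v (n i) y) -> exists p, join_map p = y.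
Proof.
case=> [->|[i h]]; first by exists None.
by exists (Some (Tagged (fun i => branch v (n i) : Type) (exist _ y h))).
Qed.
End JoinMap.

(** Makes [recursive_via] applicable to a branch of [G]: its value becomes [f] of the values of its
    child branches. *)
Lemma branch_join u v k (n : 'I_k -> G) :
  edge u v -> injective n -> (forall x, (exists i, n i = x) <-> edge v x && (x != u)) ->
  riso (root_join (fun i => branch v (n i))) (branch u v).
Proof.
move=> uv ni nP.
have ne i : edge v (n i) by case/andP: ((nP (n i)).1 (ex_intro _ i erefl)).
have nu i : n i != u by case/andP: ((nP (n i)).1 (ex_intro _ i erefl)).
case: (join_map_emb ni ne) => ji je.
have jb p : br u v (join_map (v := v) (n := n) p).
  case: p => [[i [x hx]]|] /=; last exact: br_refl.
  exact: (br_sub Gt uv (ne i) (nu i) hx).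
exists (fun p => exist _ (join_map (v := v) (n := n) p) (jb p) : branch u v).
  apply: emb_bij => [p q /(congr1 val)/= /ji //|[y hy]].
  have [p pE] : exists p, join_map (v := v) (n := n) p = y.
    apply: join_mapP; have [|yv] := eqVneq y v; [by left|right].
    case: (br_dec uv hy yv) => z /nP[i <-] h; by exists i.
  by exists p; apply: val_inj.
split; last exact: val_inj.
by move=> x y; rewrite -je.
Qed.

End Branches.

(** Applied once for each end of an exchange decomposition, where the pieces are parts of one tree
    meeting in a single vertex. *)
Lemma attach_emb (T G : graph) (x : G) (A : rooted_graph) (phi : G -> T) (psi : A -> T) :
  embedding phi -> embedding psi -> symmetric (@edge T) -> phi x = psi (rootv A) ->
  (forall u a, a != rootv A -> phi u <> psi a) ->
  (forall u a, a != rootv A -> edge (phi u) (psi a) -> u = x) ->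
  embedding (fun p : attach x A =>
    match p with inl u => phi u | inr a => psi (val a) end).
Proof.
move=> [fi fe] [pi pe] Ts xE dj ej.
have ex u (a : {a : A | a != rootv A}) :
   edge (phi u) (psi (val a)) = (u == x) && edge (rootv A) (val a).
  have [->|ux] /= := eqVneq u x; first by rewrite xE pe.
  by apply: contraNF ux => /ej -> //; apply: (valP a).
split=> [[u|a] [v|b]|[u|a] [v|b]] //=.
- by move/fi->.
- by move/dj => /(_ (valP b)).
- by move/esym/dj => /(_ (valP a)).
- by move/pi/val_inj->.
- exact: ex.
- by rewrite Ts -[sval a]/(val a) ex -[in LHS]pe -[in RHS]pe Ts.
Qed.

(** One step from [v] towards [w] either reaches [w] or remains in the direction of [v] as seen from
    [w]. *)
Lemma nx_not_br (G : graph) (Gt : is_tree G) (v w y : G) :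
  v != w -> edge w y -> y != nx w v -> ~~ br w y (nx v w).
Proof.
move=> vw wy yn; have wv : w != v by rewrite eq_sym.
have e1 := nx_edge Gt wv; apply/negP => h; have := br_nx Gt wy h.
have [E|nE] := eqVneq (nx v w) w.
  by move: h; rewrite E (negbTE (br_self Gt wy)).
by rewrite -(nx_edge_eq Gt e1 vw nE) => E; rewrite E eqxx in yn.
Qed.

Section Exchange.
Variables (G : graph) (Gt : is_tree G).
Variables (v w : G) (vw : v != w).
Variables (k l : nat) (n : 'I_k -> G) (m : 'I_l -> G).
Hypothesis (n_inj : injective n) (m_inj : injective m).
Hypothesis nP : forall x, (exists i, n i = x) <-> edge v x && (x != nx v w).
Hypothesis mP : forall x, (exists i, m i = x) <-> edge w x && (x != nx w v).

(** The middle tree [H] of the decomposition. Of the neighbours of [v] and of [w] it retains only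
    the one towards the other end, so both are leaves of it. *)
Definition core : pred G := fun y =>
  ~~ [exists i, br v (n i) y] && ~~ [exists j, br w (m j) y].

Let wv : w != v. Proof. by rewrite eq_sym. Qed.
Let ne i : edge v (n i). Proof. by case/andP: ((nP (n i)).1 (ex_intro _ i erefl)). Qed.
Let me i : edge w (m i). Proof. by case/andP: ((mP (m i)).1 (ex_intro _ i erefl)). Qed.
Let nn i : n i != nx v w. Proof. by case/andP: ((nP (n i)).1 (ex_intro _ i erefl)). Qed.
Let mn i : m i != nx w v. Proof. by case/andP: ((mP (m i)).1 (ex_intro _ i erefl)). Qed.
Let nw i : ~~ br v (n i) w.
Proof. by rewrite br_nxE // wv eq_sym nn. Qed.
Let mv i : ~~ br w (m i) v.
Proof. by rewrite br_nxE // vw eq_sym mn. Qed.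

Lemma core_v : core v.
Proof.
apply/andP; split; apply/existsPn => i //; exact: br_self.
Qed.

Lemma core_w : core w.
Proof.
apply/andP; split; apply/existsPn => i //; exact: br_self.
Qed.

(** Contracts each removed branch to the vertex at which it hangs, as the retraction for
    [ind_tree]. *)
Definition core_pi (y : G) : G :=
  if [exists i, br v (n i) y] then v else if [exists j, br w (m j) y] then w else y.

Lemma core_tree : is_tree (ind core).
Proof.
apply: (@ind_tree _ Gt _ core_pi).
- move=> y; rewrite /core_pi; case: ifPn => [_|h1]; first exact: core_v.
  by case: ifPn => [_|h2]; [exact: core_w|apply/andP].
- by move=> y /andP[h1 h2]; rewrite /core_pi (negbTE h1) (negbTE h2).
have piv i y : br v (n i) y -> core_pi y = v.
  by move=> h; rewrite /core_pi ifT //; apply/existsP; exists i.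
have piw j y : br w (m j) y -> core_pi y = w.
  move=> h; have h1 : [exists j, br w (m j) y] by apply/existsP; exists j.
  rewrite /core_pi h1 ifF //; apply/negbTE/existsPn => i; apply/negP => h'.
  exact: (br_disj Gt vw (ne i) (me j) (nw i) (mv j) h' h).
have pi_id y : core y -> core_pi y = y.
  by case/andP=> h1 h2; rewrite /core_pi (negbTE h1) (negbTE h2).
have half y z : edge y z -> ~~ core y -> core_pi y = core_pi z \/ edge (core_pi y) (core_pi z).
  move=> yz; rewrite negb_and !negbK => /orP[/existsP[i h]|/existsP[j h]]; left.
    rewrite (piv _ _ h); have [h'|h'] := boolP (br v (n i) z); first by rewrite (piv _ _ h').
    by case: (br_cross Gt (ne i) h yz h') => _ ->; rewrite pi_id ?core_v.
  rewrite (piw _ _ h); have [h'|h'] := boolP (br w (m j) z); first by rewrite (piw _ _ h').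
  by case: (br_cross Gt (me j) h yz h') => _ ->; rewrite pi_id ?core_w.
move=> y z yz; have [cy|cy] := boolP (core y); last exact: half.
have [cz|cz] := boolP (core z); first by right; rewrite !pi_id.
rewrite edge_sym // in yz; case: (half _ _ yz cz) => [->|h]; first by left.
by right; rewrite edge_sym.
Qed.

Definition cv : ind core := exist _ v core_v.
Definition cw : ind core := exist _ w core_w.

Lemma core_leaf u z (cu : core u) :
  core z -> edge u z -> (forall y, core y -> edge u y -> y = z) ->
  leaf (exist _ u cu : ind core).
Proof.
move=> cz uz H.
apply/eqP; rewrite /deg (eq_card (B := pred1 (exist _ z cz : ind core))) ?card1 //.
move=> [y cy]; rewrite !inE -val_eqE /=.
by apply/idP/eqP => [/(H _ cy)|->].
Qed.

Lemma core_leaf_v : leaf cv.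
Proof.
have e1 := nx_edge Gt wv.
apply: (@core_leaf v (nx v w)) => // [|y /andP[/existsPn h _] vy].
  apply/andP; split; apply/existsPn => i; last exact: nx_not_br.
  apply/negP => h; case/negP: (nn i); apply/eqP.
  exact: (br_nbr Gt (ne i) e1 h).
apply/eqP; apply: contraT => yn.
have [i E] : exists i, n i = y by apply/nP; rewrite vy.
by case/negP: (h i); rewrite E br_refl.
Qed.

Lemma core_leaf_w : leaf cw.
Proof.
have e1 := nx_edge Gt vw.
apply: (@core_leaf w (nx w v)) => // [|y /andP[_ /existsPn h] wy].
  apply/andP; split; apply/existsPn => i; first exact: nx_not_br.
  apply/negP => h; case/negP: (mn i); apply/eqP.
  exact: (br_nbr Gt (me i) e1 h).
apply/eqP; apply: contraT => yn.
have [i E] : exists i, m i = y by apply/mP; rewrite wy.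
by case/negP: (h i); rewrite E br_refl.
Qed.

(** The map goes out of the exchange tree: the inclusion on the core and [join_map] on the two
    joins. It is onto because a vertex outside the core lies in one of the removed branches. *)
Lemma exchange_iso :
  giso G (exchange_tree (fun i => branch v (n i)) cv cw (fun j => branch w (m j))).
Proof.
apply: giso_sym.
have [Gs Gi _ _ _] := Gt.
have [jvi jve] := join_map_emb Gt n_inj ne.
have [jwi jwe] := join_map_emb Gt m_inj me.
have jvP a : a != rootv (root_join (fun i => branch v (n i))) ->
    exists i, br v (n i) (join_map (v := v) (n := n) a).
  by case: a => [[i [x hx]]|//] _; exists i.
have jwP a : a != rootv (root_join (fun i => branch w (m i))) ->
    exists i, br w (m i) (join_map (v := w) (n := m) a).
  by case: a => [[i [x hx]]|//] _; exists i.
have E1 := @attach_emb G (ind core) cv (root_join (fun i => branch v (n i)))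
  val (join_map (v := v) (n := n)).
have {}E1 := E1 (conj val_inj (fun _ _ => erefl)) (conj jvi jve) Gs erefl.
case: E1 => [[u cu] a /jvP[i hi] /= E|[u cu] a /jvP[i hi] /= e|E1i E1e].
- by case/andP: (cu) => /existsPn h _; case/negP: (h i); rewrite E.
- apply: val_inj => /=; rewrite edge_sym // in e.
  case: (br_cross Gt (ne i) hi e _) => //.
  by case/andP: (cu) => /existsPn h _; apply: h.
have E2 := @attach_emb G _ (attach_inl cv (root_join (fun i => branch v (n i))) cw)
  (root_join (fun j => branch w (m j))) _ (join_map (v := w) (n := m))
  (conj E1i E1e) (conj jwi jwe) Gs erefl.
case: E2 => [u a /jwP[j hj]|u a /jwP[j hj]|E2i E2e].
- case: u => [[u cu] /= E|[a' ha] /= E].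
    by case/andP: (cu) => _ /existsPn h; case/negP: (h j); rewrite E.
  case: (jvP _ ha) => i hi.
  by apply: (br_disj Gt vw (ne i) (me j) (nw i) (mv j) hi); rewrite E.
- rewrite edge_sym // => e.
  have [h|h] := boolP (br w (m j) (match u with inl u => val u | inr a => join_map (val a) end)).
    case: u e h => [[u cu] /= e h'|[a' ha] /= e h'].
      by case/andP: (cu) => _ /existsPn h; case/negP: (h j).
    case: (jvP _ ha) => i hi; by case: (br_disj Gt vw (ne i) (me j) (nw i) (mv j) hi h').
  case: (br_cross Gt (me j) hj e h) => _.
  case: u e h => [[u cu] /= _ _ E|[a' ha] /= _ _ E].
    by congr inl; apply: val_inj.
  case: (jvP _ ha) => i hi; by case/negP: (nw i); rewrite -E.
eexists; last exact: E2e.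
apply: emb_bij => // y.
have [cy|] := boolP (core y); first by exists (inl (inl (exist _ y cy))).
rewrite negb_and !negbK => /orP[/existsP[i h]|/existsP[j h]].
  have yv : v != y by apply: br_neq h; exact: edge_neq.
  have [p pE] := join_mapP (n := n) (or_intror (ex_intro _ i h)).
  have pn : p != rootv (root_join (fun i => branch v (n i))).
    by apply: contraNneq yv => E; rewrite -pE E.
  by exists (inl (inr (exist _ p pn))).
have yw : w != y by apply: br_neq h; exact: edge_neq.
have [p pE] := join_mapP (n := m) (or_intror (ex_intro _ j h)).
have pn : p != rootv (root_join (fun i => branch w (m i))).
  by apply: contraNneq yw => E; rewrite -pE E.
by exists (inr (exist _ p pn)).
Qed.

End Exchange.

(** * Branch values *)

(** One alternative of the exchange condition, expressed inside [G]: [~~ br v x w] selects the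
    neighbours of [v] that do not lie towards [w]. *)
Definition xge (R : realType) (G : graph) (r : G -> G -> R) (v w : G) : bool :=
  (deg w <= deg v)%N && [forall x, forall y,
    [&& edge v x, ~~ br v x w, edge w y & ~~ br w y v] ==> (r w y <= r v x)%R].

Lemma xgeP (R : realType) (G : graph) (r : G -> G -> R) (v w : G) :
  reflect ((deg w <= deg v)%N /\ forall x y, edge v x -> ~~ br v x w ->
            edge w y -> ~~ br w y v -> (r w y <= r v x)%R)
          (xge r v w).
Proof.
apply: (iffP andP) => -[h1 h2]; split => //.
  by move=> x y a b c d; apply: (implyP (forallP (forallP h2 x) y)); apply/and4P.
apply/forallP => x; apply/forallP => y; apply/implyP => /and4P[a b c d].
exact: h2.
Qed.

Section Dominance.
Variables (R : realType) (rho : rooted_graph -> R) (F : seq R -> R).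
Hypothesis F_inc : strictly_increasing rho F.
Local Open Scope ring_scope.

Lemma rho_values_sub (s t : seq R) :
  {subset s <= t} -> rho_values rho t -> rho_values rho s.
Proof. by move=> st tv x /st /tv. Qed.

(** Entries are replaced one at a time, with [p] collecting those already replaced. The intermediate
    tuples still consist of values of [rho], and one strict replacement would make the whole
    comparison strict. *)
Lemma F_pointwise (p X Y : seq R) :
  size X = size Y -> rho_values rho (p ++ X) -> rho_values rho (p ++ Y) ->
  (forall x y, x \in X -> y \in Y -> y <= x) ->
  F (p ++ Y) <= F (p ++ X) /\ (F (p ++ X) <= F (p ++ Y) -> X = Y).
Proof.
elim: X Y p => [|x X IH] [|y Y] p //= [sXY] vX vY le.
have vXY : rho_values rho (p ++ x :: Y).
  move=> z; rewrite mem_cat inE => /or3P[h|h|h].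
  - by apply: vX; rewrite mem_cat h.
  - by apply: vX; rewrite mem_cat inE h orbT.
  - by apply: vY; rewrite mem_cat inE h !orbT.
have h1 : F (p ++ y :: Y) <= F (p ++ x :: Y) ?= iff (y == x).
  have := le x y (mem_head _ _) (mem_head _ _); rewrite le_eqVlt.
  case/predU1P => [->|yx]; first by apply/leifP; rewrite eqxx.
  by apply/leifP; rewrite lt_eqF //; case: F_inc => h _; apply: h.
have {IH} := IH Y (rcons p x) sXY; rewrite !cat_rcons => /(_ vX vXY).
case=> [x' y' h h'|h2 h3]; first by apply: le; rewrite inE ?h ?h' orbT.
split; first exact: le_trans h1 h2.
move=> h4; have -> : X = Y by apply: h3; apply: le_trans h4 h1.
congr cons; apply/esym/eqP; rewrite -h1 eq_le h1; exact: le_trans h2 h4.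
Qed.

(** [X] is cut to the length of [Y], compared entrywise and extended again. Equality leaves nothing
    to append and gives [X = Y], so that the assumed comparison of all pairs can also be read
    backwards. *)
Lemma F_dominance (X Y : seq R) :
  Y != [::] -> (size Y <= size X)%N -> rho_values rho X -> rho_values rho Y ->
  (forall x y, x \in X -> y \in Y -> y <= x) ->
  F Y <= F X /\
  (F X <= F Y -> size X = size Y /\ forall x y, x \in X -> y \in Y -> x <= y).
Proof.
move=> Y0 sYX vX vY le; pose X1 := take (size Y) X.
have s1 : size X1 = size Y by rewrite size_take_min (minn_idPl sYX).
have sub1 : {subset X1 <= X} by move=> z; apply: mem_take.
have [h1 h2] : F ([::] ++ Y) <= F ([::] ++ X1) /\
    (F ([::] ++ X1) <= F ([::] ++ Y) -> X1 = Y).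
  apply: F_pointwise => //; first exact: rho_values_sub vX.
  by move=> x y /sub1; apply: le.
have [X2|X2] := eqVneq (drop (size Y) X) [::].
  have XE : X = X1 by rewrite -(cat_take_drop (size Y) X) X2 cats0.
  move: h1 h2; rewrite /= -XE => h1 h2; split=> // /h2 E.
  by split=> [|x y xX yY]; [rewrite E|apply: le; rewrite ?E // -E].
have h3 : F X1 < F X.
  rewrite -[in ltRHS](cat_take_drop (size Y) X); case: F_inc => _; apply => //.
  - by rewrite -size_eq0 s1 size_eq0.
  - by rewrite cat_take_drop.
split; first exact: le_trans h1 (ltW h3).
by move=> h4; move: (le_lt_trans (le_trans h4 h1) h3); rewrite ltxx.
Qed.
End Dominance.

(** Prepares the families of an exchange decomposition, indexed by ['I_k.+1]; the neighbour [z]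
    towards the other end brings the degree to [k.+2]. *)
Lemma enum_other_nbrs (G : graph) (v z : G) :
  edge v z -> (1 < deg v)%N -> exists k (n : 'I_k.+1 -> G),
  [/\ deg v = k.+2, injective n
    & forall x, (exists i, n i = x) <-> edge v x && (x != z)].
Proof.
move=> vz dv; pose s := enum [pred x | edge v x && (x != z)].
have ss : deg v = (size s).+1.
  rewrite /deg (cardD1 z) inE vz add1n /s -cardE; congr S.
  by apply: eq_card => x; rewrite !inE andbC.
case dE: (deg v) ss dv => [|[|k]] // [sE] _.
have ltS (i : 'I_k.+1) : (i < size s)%N by rewrite -sE.
exists k, (fun i => nth v s i); split=> // [i j /eqP|x].
  by rewrite nth_uniq ?enum_uniq ?ltS // => /eqP/val_inj.
have -> : edge v x && (x != z) = (x \in s) by rewrite mem_enum.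
split=> [[i <-]|xs]; first exact: mem_nth.
have xi : (index x s < k.+1)%N by rewrite sE index_mem.
by exists (Ordinal xi); rewrite /= nth_index.
Qed.

Section Rho.
Variables (R : realType) (rho : rooted_graph -> R) (f : seq R -> R).
Hypotheses (rho_inv : rooted_tree_invariant rho) (rho_rec : recursive_via rho f).
Variables (G : graph) (Gt : is_tree G).
Local Open Scope ring_scope.
Implicit Types (u v w x y s t : G).

Definition brho u v : R := rho (branch u v).

(** The one place where extremality enters. It is applied to the decomposition whose [Ls] and [Rs]
    are all the branches at [v] and [w] facing away from each other; the degrees are then [k.+2] and
    [l.+2], so comparing [k] with [l] compares degrees. *)
Lemma xge_total v w :
  exchange_extremal rho G -> v != w -> (1 < deg v)%N -> (1 < deg w)%N ->
  xge brho v w || xge brho w v.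
Proof.
move=> ext vw dv dw; have wv : w != v by rewrite eq_sym.
have [k [n [dvE ni nP]]] := enum_other_nbrs (nx_edge Gt wv) dv.
have [l [m [dwE mi mP]]] := enum_other_nbrs (nx_edge Gt vw) dw.
have nE x : edge v x -> ~~ br v x w -> exists i, n i = x.
  by move=> vx; rewrite br_nxE // wv /= eq_sym => h; apply/nP; rewrite vx.
have mE x : edge w x -> ~~ br w x v -> exists i, m i = x.
  by move=> wx; rewrite br_nxE // vw /= eq_sym => h; apply/mP; rewrite wx.
have bmin (K : nat) (FF : 'I_K.+1 -> rooted_graph) i : min_rho rho FF <= rho (FF i).
  exact: bigmin_le.
have bmax (K : nat) (FF : 'I_K.+1 -> rooted_graph) i : rho (FF i) <= max_rho rho FF.
  exact: le_bigmax.
have := ext k l (fun i => branch v (n i)) _ _ _ (fun j => branch w (m j)) _ _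
  (core_tree Gt vw nP mP) (core_leaf_v Gt vw nP mP) (core_leaf_w Gt vw nP mP).
case.
- by move=> i; apply: branch_tree => //; case/andP: ((nP (n i)).1 (ex_intro _ i erefl)).
- by move=> i; apply: branch_tree => //; case/andP: ((mP (m i)).1 (ex_intro _ i erefl)).
- by rewrite -val_eqE.
- exact: exchange_iso.
- case=> lk h; apply/orP; left; apply/xgeP; split; first by rewrite dvE dwE.
  move=> x y vx /(nE _ vx)[i <-] wy /(mE _ wy)[j <-].
  exact: le_trans (bmax _ _ j) (le_trans h (bmin _ _ i)).
- case=> lk h; apply/orP; right; apply/xgeP; split; first by rewrite dvE dwE.
  move=> y x wy /(mE _ wy)[j <-] vx /(nE _ vx)[i <-].
  exact: le_trans (bmax _ _ i) (le_trans h (bmin _ _ j)).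
Qed.

Lemma brho_rec u v :
  edge u v -> (1 < deg v)%N -> exists X : seq R,
  [/\ size X = (deg v).-1, brho u v = f X, rho_values rho X
    & forall a, a \in X <-> exists2 x, edge v x && (x != u) & a = brho v x].
Proof.
move=> uv dv; have vu : edge v u by rewrite edge_sym.
have [k [n [dvE ni nP]]] := enum_other_nbrs vu dv.
have nb i : edge v (n i) && (n i != u) by apply/nP; exists i.
exists [seq brho v (n i) | i : 'I_k.+1]; split.
- by rewrite size_map -cardE card_ord dvE.
- rewrite -(rho_rec (F := fun i => branch v (n i))) //; last first.
    by move=> i; apply: branch_tree => //; case/andP: (nb i).
  have ri := branch_join Gt uv ni nP; have bt := branch_tree Gt uv.
  apply/esym/rho_inv => //; apply: giso_tree bt; apply/giso_sym/riso_giso.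
  exact: ri.
- move=> a /mapP[i _ ->]; exists (branch v (n i)) => //.
  by apply: branch_tree => //; case/andP: (nb i).
- move=> a; split=> [/mapP[i _ ->]|[x /nP[i <-] ->]]; first by exists (n i).
  by apply: map_f; rewrite mem_enum.
Qed.

Lemma bullet_tree : is_tree bullet.
Proof.
split=> //; first by rewrite card_unit.
- by move=> [] [].
- by move=> [|x [|y c]] // /andP[] /=; rewrite ?andbF.
Qed.

Lemma brho_leaf u v : edge u v -> deg v = 1%N -> brho u v = rho bullet.
Proof.
move=> uv dv; apply: rho_inv.
- exact: branch_tree.
- exact: bullet_tree.
have H y : br u v y -> y = v.
  move=> h; apply/eqP; apply: contraT => yv.
  case: (br_dec uv h yv) => z /andP[vz zu] _.
  have vu : edge v u by rewrite edge_sym.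
  suff : (1 < deg v)%N by rewrite dv.
  by apply/(deg_gt1P vu); exists z.
exists (fun _ => tt).
  apply: emb_bij => [[x hx] [y hy] _|[]]; last by exists (rootv (branch u v)).
  by apply: val_inj; rewrite /= (H _ hx) (H _ hy).
by split=> // [[x hx] [y hy]] /=; rewrite (H _ hx) (H _ hy) edge_irr.
Qed.

Lemma brho_nonleaf u v :
  edge u v -> (1 < deg v)%N -> (1 < #|branch u v|)%N.
Proof.
move=> uv; have vu : edge v u by rewrite edge_sym.
case/(deg_gt1P vu) => x vx xu.
have hx : br u v x by apply: br_sub vx xu (br_refl _ _).
rewrite (cardD1 (rootv (branch u v))) inE add1n ltnS.
apply/card_gt0P; exists (exist _ x hx); rewrite !inE andbT -val_eqE /=.
by rewrite eq_sym; apply: edge_neq.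
Qed.

(** The monotone [F] is kept apart from [f] so that the decreasing case can take [F] to be the
    negative of [f]. *)
Lemma branch_dominance (F : seq R -> R) u v s t :
  strictly_increasing rho F -> edge u v -> edge s t -> (1 < deg v)%N ->
  (1 < deg t)%N -> (deg t <= deg v)%N ->
  (forall x y, edge v x -> x != u -> edge t y -> y != s -> brho t y <= brho v x) ->
  exists X Y : seq R, [/\ brho u v = f X, brho s t = f Y, F Y <= F X
    & F X <= F Y -> deg v = deg t /\
      forall x y, edge v x -> x != u -> edge t y -> y != s -> brho v x <= brho t y].
Proof.
move=> Fi uv st dv dt dtv le.
have [X [sX rX vX XP]] := brho_rec uv dv.
have [Y [sY rY vY YP]] := brho_rec st dt.
exists X, Y; have [|||h1 h2] := @F_dominance _ _ _ Fi X Y _ _ vX vY.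
- by rewrite -size_eq0 sY; case: (deg t) dt => [|[]].
- by rewrite sX sY; case: (deg t) dt dtv => [|[]]; case: (deg v).
- move=> x y /XP[a /andP[va au] ->] /YP[b /andP[tb bs] ->]; exact: le.
split=> // /h2[sXY h]; split.
  by move: sXY dv dt; rewrite sX sY; case: (deg v) => // a; case: (deg t) => // b /= ->.
move=> x y vx xu ty ys; apply: h; first by apply/XP; exists x; rewrite ?vx.
by apply/YP; exists y; rewrite ?ty.
Qed.

Lemma strictly_decreasingN :
  strictly_decreasing rho f -> strictly_increasing rho (fun X : seq R => - f X).
Proof.
by case=> h1 h2; split=> *; rewrite ltrN2; [apply: h1|apply: h2].
Qed.

End Rho.

(** * Domination between vertices *)

Section Disjoint.
Variables (G : graph) (Gt : is_tree G).
Implicit Types (u v w x y z s t a b : G).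

Definition dis s w t a := forall u, br s w u -> br t a u -> False.

Lemma dis_sym s w t a : dis s w t a -> dis t a s w.
Proof. by move=> d u h1 h2; apply: d h2 h1. Qed.

Lemma dis_neq s w t a : dis s w t a -> w != a.
Proof. by move=> d; apply/eqP => E; apply: (d w); rewrite -?E br_refl. Qed.

Lemma dis_child s w t a x :
  dis s w t a -> edge s w -> edge w x -> x != s -> dis w x t a.
Proof. by move=> d sw wx xs u /(br_sub Gt sw wx xs); apply: d. Qed.

(** For disjoint branches, facing away from the other root is the same as being a child. This turns
    [xge] into a comparison of child branches. *)
Lemma dis_away s w t a x : dis s w t a -> edge s w -> edge w x ->
  ~~ br w x a = (x != s).
Proof.
move=> d sw wx; apply/idP/idP => [|xs].
  apply: contraNneq => ->; rewrite br_cut 1?edge_sym //.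
  by apply/negP => h; apply: d h (br_refl _ _).
by apply/negP => h; apply: (dis_child d sw wx xs h); apply: br_refl.
Qed.

Lemma dis_nbr v w x y :
  v != w -> edge v x -> edge w y -> ~~ br v x w -> ~~ br w y v -> dis v x w y.
Proof. by move=> vw vx wy h1 h2 u; apply: br_disj. Qed.

Lemma exists_child u v : edge u v -> (1 < deg v)%N -> exists2 x, edge v x & x != u.
Proof. by move=> uv; rewrite edge_sym // in uv; case/(deg_gt1P uv) => x; exists x. Qed.

Lemma deg_child u v x : edge u v -> edge v x -> x != u -> (1 < deg v)%N.
Proof. by move=> uv vx xu; rewrite edge_sym // in uv; apply/(deg_gt1P uv); exists x. Qed.

Lemma deg_edge_gt0 u v : edge u v -> (0 < deg v)%N.
Proof. by rewrite edge_sym //; apply: deg_gt0. Qed.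

Lemma deg_gt1_neq1 u v : edge u v -> (1 < deg v)%N = (deg v != 1%N).
Proof. by move/deg_edge_gt0; case: (deg v) => [|[]]. Qed.

Lemma br_deg v w y : edge v w -> br v w y -> (1 < deg y)%N -> (1 < deg w)%N.
Proof.
move=> vw h; have [<-//|yw] := eqVneq y w; case: (br_dec vw h yw) => z /andP[wz zv] _ _.
exact: deg_child vw wz zv.
Qed.

End Disjoint.

(* [rle] is [<=] or its converse, according to the monotonicity of [f]. *)
Section Compare.
Variables (R : realType) (G : graph) (Gt : is_tree G) (r : G -> G -> R).
Variable rle : rel R.
Implicit Types (u v w x y z s t a b : G).
Hypothesis rle_refl : reflexive rle.
Hypothesis r_total : forall v w, v != w -> (1 < deg v)%N -> (1 < deg w)%N ->
  xge r v w || xge r w v.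
Hypothesis r_leaf2 : forall u v s w, edge u v -> edge s w -> deg v = 1%N ->
  deg w = 1%N -> r u v = r s w.
Hypothesis r_leaf : forall u v s w, edge u v -> edge s w -> deg v = 1%N ->
  (1 < deg w)%N -> rle (r u v) (r s w) && ~~ rle (r s w) (r u v).
Hypothesis r_dom : forall u v s t, edge u v -> edge s t -> (1 < deg v)%N ->
  (1 < deg t)%N -> (deg t <= deg v)%N ->
  (forall x y, edge v x -> x != u -> edge t y -> y != s -> (r t y <= r v x)%R) ->
  rle (r s t) (r u v) /\
  (rle (r u v) (r s t) -> deg v = deg t /\
   forall x y, edge v x -> x != u -> edge t y -> y != s -> (r v x <= r t y)%R).

(* Leaves are put below all other vertices. *)
Definition vge v w := (deg w == 1%N) || (1 < deg v)%N && xge r v w.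

Lemma xge_dis s w t a : dis s w t a -> edge s w -> edge t a ->
  xge r w a <-> ((deg a <= deg w)%N /\ forall x y, edge w x -> x != s ->
                  edge a y -> y != t -> (r a y <= r w x)%R).
Proof.
move=> d sw ta; have d' := dis_sym d; split=> [/xgeP[h1 h2]|[h1 h2]].
  split=> // x y wx xs ay yt; apply: h2 => //.
    by rewrite (dis_away Gt d).
  by rewrite (dis_away Gt d').
apply/xgeP; split=> // x y wx xs ay yt; apply: h2 => //.
  by rewrite -(dis_away Gt d sw).
by rewrite -(dis_away Gt d' ta).
Qed.

(** The bridge between domination and values. One direction is [r_dom]. Conversely, if the values
    compare but [a] dominates [w] instead, the equality case of [r_dom] makes degrees and child
    values agree, so [w] dominates [a] as well. *)
Lemma vgeE s w t a : dis s w t a -> edge s w -> edge t a ->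
  vge w a = rle (r t a) (r s w).
Proof.
move=> d sw ta; rewrite /vge.
have [da|da] := eqVneq (deg a) 1%N => /=.
  have [dw|dw] := eqVneq (deg w) 1%N.
    by rewrite (r_leaf2 ta sw) // rle_refl.
  rewrite -(deg_gt1_neq1 Gt sw) in dw.
  by case/andP: (r_leaf ta sw da dw) => ->.
rewrite -(deg_gt1_neq1 Gt ta) in da.
have [dw|dw] /= := boolP (1 < deg w)%N; last first.
  rewrite (deg_gt1_neq1 Gt sw) negbK in dw.
  by case/andP: (r_leaf sw ta (eqP dw) da) => _ /negbTE ->.
have dom1 := xge_dis d sw ta; have dom2 := xge_dis (dis_sym d) ta sw.
apply/idP/idP => [/dom1[h1 h2]|h]; first by case: (r_dom sw ta dw da h1 h2).
case/orP: (r_total (dis_neq d) dw da) => // /dom2[h1 h2].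
case: (r_dom ta sw da dw h1 h2) => _ /(_ h)[h3 h4].
by apply/dom1; split=> [|x y wx xs ay yt]; rewrite ?h3 // h4.
Qed.

Lemma vge_total v w u s : edge u v -> edge s w -> v != w -> vge v w || vge w v.
Proof.
move=> uv sw vw; rewrite /vge.
have [//|dw] := eqVneq (deg w) 1%N; have [dv|dv] := eqVneq (deg v) 1%N.
  by rewrite orbT.
rewrite -(deg_gt1_neq1 Gt uv) in dv; rewrite -(deg_gt1_neq1 Gt sw) in dw.
by rewrite /= dv dw; apply: r_total.
Qed.

Lemma vge_deg v w u : edge u v -> vge v w -> (deg w <= deg v)%N.
Proof.
move=> uv /orP[/eqP->|/andP[_ /xgeP[]]//]; exact: deg_edge_gt0 uv.
Qed.

(** If [w] is a leaf, its only neighbour lies towards [v] and there is nothing to compare. *)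
Lemma vge_away v w x y : vge v w -> edge v x -> ~~ br v x w ->
  edge w y -> ~~ br w y v -> v != w -> (r w y <= r v x)%R.
Proof.
case/orP=> [/eqP dw _ _ wy vn vw|/andP[_ /xgeP[_ h]] *]; last exact: h.
have wv : w != v by rewrite eq_sym.
have : (1 < deg w)%N.
  apply/(deg_gt1P (nx_edge Gt vw)); exists y => //.
  by apply: contraNneq vn => ->; apply: nx_br.
by rewrite dw.
Qed.

End Compare.

(** * Rooted trees: parents, ancestors and depth *)

Section Rooted.
Variables (G : graph) (Gt : is_tree G) (x0 : G).
Implicit Types (u v w x y z s t a b : G).

Definition par y := nx y x0.

(** Reflexive away from the root. The root counts as nobody's ancestor, so that each ancestor has a
    parent edge and the number of ancestors is the depth. *)
Definition anc z x := (z != x0) && br (par z) z x.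

Lemma par_root : par x0 = x0.
Proof.
rewrite /par /nx; case: pickP => //= x /andP[e h].
by rewrite (negbTE (br_self Gt e)) in h.
Qed.

Lemma edge_par y : y != x0 -> edge (par y) y.
Proof. by move=> yx; rewrite edge_sym // nx_edge // eq_sym. Qed.

Lemma br_par y : y != x0 -> br y (par y) x0.
Proof. by move=> yx; apply: nx_br => //; rewrite eq_sym. Qed.

Lemma child_par x z : edge x z -> z != par x -> par z = x /\ z != x0.
Proof.
move=> xz zp; have zx : edge z x by rewrite edge_sym.
have zx0 : z != x0.
  by apply: contraNneq zp => zE; rewrite /par -zE nx_nbr.
split=> //; apply: br_nx => //; rewrite br_cut // br_nxE //.
by rewrite negb_and -/(par x) [par x == z]eq_sym zp orbT.
Qed.

Lemma edge_parE x y :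
  edge x y = (x != x0) && (par x == y) || (y != x0) && (par y == x).
Proof.
apply/idP/idP => [xy|].
  have [E|n] := eqVneq y (par x).
    have [xE|//] := eqVneq x x0.
    by move: xy; rewrite E xE par_root edge_irr.
  by case: (child_par xy n) => -> ->; rewrite eqxx orbT.
case/orP=> /andP[h /eqP <-]; last exact: edge_par.
by rewrite edge_sym // edge_par.
Qed.

Lemma ancP z x : z != x0 -> anc z x = ~~ br z (par z) x.
Proof. by move=> zx; rewrite /anc zx br_cut // edge_par. Qed.

Lemma anc_neq z x : anc z x -> z != x0. Proof. by case/andP. Qed.

Lemma anc_refl x : x != x0 -> anc x x. Proof. by rewrite /anc br_refl => ->. Qed.

Lemma anc_root z : anc z x0 = false.
Proof. by apply/negP => /andP[zx]; rewrite br_cut ?edge_par // br_par. Qed.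

Lemma anc_neq_root z x : anc z x -> x != x0.
Proof. by apply: contraTneq => ->; rewrite anc_root. Qed.

Lemma anc_par z x : x != x0 -> anc z x = (z != x0) && (z == x) || anc z (par x).
Proof.
move=> xx; have [->|zx0] := eqVneq z x0; first by rewrite /anc eqxx.
have [->|zx] /= := eqVneq z x; first by rewrite anc_refl.
have ex := edge_par xx; have ez := edge_par zx0; apply/idP/idP => h.
  apply: contraT => h'; rewrite /anc zx0 /= in h h'.
  have xp : edge x (par x) by rewrite edge_sym.
  by case: (br_cross Gt ez h xp h') => xz; rewrite xz eqxx in zx.
apply: contraT => h'; rewrite /anc zx0 /= in h h'.
case: (br_cross Gt ez h ex h') => pz xp.
have h1 := br_par zx0; have h2 := br_par xx.
rewrite -xp in h1; rewrite pz in h2.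
by rewrite br_cut ?h2 // edge_sym // xp in h1.
Qed.

Lemma anc_trans x y z : anc x y -> anc y z -> anc x z.
Proof.
move=> h1 h2; have xx := anc_neq h1; have yx := anc_neq h2.
have [->//|xy] := eqVneq x y.
have ex := edge_par xx; have ey := edge_par yx.
have h3 : ~~ br x (par x) y by rewrite -ancP.
apply: contraT; rewrite ancP // negbK => h4.
have xp : edge x (par x) by rewrite edge_sym.
have E1 := nx_const Gt xp h3 h4; have E2 := nx_const Gt xp h3 (br_par xx).
have : nx y z = par y by rewrite E1 -E2.
move: h2; rewrite /anc yx /= => h2 E.
have [zy|zy] := eqVneq z y; first by rewrite zy (negbTE h3) in h4.
by have := br_nx_neq Gt ey h2 zy; rewrite E eqxx.
Qed.

Lemma anc_antisym x y : anc x y -> anc y x -> x = y.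
Proof.
move=> h1 h2; apply/eqP; apply: contraT => xy.
have xx := anc_neq h1; have yx := anc_neq h2.
have h3 : ~~ br x (par x) y by rewrite -ancP.
have xp : edge x (par x) by rewrite edge_sym // edge_par.
have E := nx_const Gt xp h3 (br_par xx).
have E2 : nx y (par x) = nx y x.
  have [pE|pn] := eqVneq (par x) y; first by rewrite pE br_refl in h3.
  by apply/esym/nx_edge_eq.
move: h2; rewrite ancP // br_nxE 1?edge_sym ?edge_par // xy /=.
by rewrite -E2 -E eqxx.
Qed.

Lemma anc_parent x y : anc x y -> x != y -> anc x (par y).
Proof.
move=> h xy; move: (h); rewrite anc_par ?(anc_neq_root h) //.
by rewrite (negbTE xy) andbF.
Qed.

(** Seen from [y], the whole branch at [x] lies in the direction of [par y], so no vertex of it can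
    hang below [y]. *)
Lemma dis_anc x y : x != x0 -> y != x0 -> ~~ anc x y -> ~~ anc y x ->
  dis (par x) x (par y) y.
Proof.
move=> xx yx h1 h2 u h3 h4.
have ux : anc x u by rewrite /anc xx.
have uy : anc y u by rewrite /anc yx.
have yn : ~~ br (par x) x y by move: h1; rewrite /anc xx.
have E := nx_const Gt (edge_par xx) yn h3.
have E1 : nx y x = par y.
  move: h2; rewrite ancP // negbK => h2.
  by rewrite (br_nx Gt _ h2) // edge_sym // edge_par.
have [uE|uyn] := eqVneq u y; first by rewrite uE (negbTE yn) in h3.
by have := br_nx_neq Gt (edge_par yx) h4 uyn; rewrite E E1 eqxx.
Qed.

Definition depth x := #|[pred z | anc z x]|.

Lemma depth_root : depth x0 = 0%N.
Proof. by apply: eq_card0 => z; rewrite inE anc_root. Qed.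

Lemma depth_par x : x != x0 -> depth x = (depth (par x)).+1.
Proof.
move=> xx; rewrite /depth (cardD1 x) inE anc_refl // add1n; congr S.
apply: eq_card => z; rewrite !inE anc_par //.
have [->|zx] := eqVneq z x; last by rewrite andbF.
by rewrite /anc xx (negbTE (br_self Gt (edge_par xx))).
Qed.

Lemma depth_eq0 x : (depth x == 0%N) = (x == x0).
Proof.
have [->|xx] := eqVneq x x0; first by rewrite depth_root.
by rewrite depth_par.
Qed.

Lemma anc_depth x y : anc x y -> (depth x <= depth y)%N.
Proof.
move=> h; apply: subset_leq_card; apply/subsetP => z; rewrite !inE => h'.
exact: anc_trans h' h.
Qed.

End Rooted.

(** * Rankings of the vertices of a rooted tree *)

Definition strict_total (T : eqType) (lt : rel T) :=
  [/\ irreflexive lt, transitive lt & forall x y, x != y -> lt x y || lt y x].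

Definition lex_by (S T : eqType) (p : T -> S) (lt1 : rel S) (lt2 : rel T) : rel T :=
  fun x y => lt1 (p x) (p y) || (p x == p y) && lt2 x y.

Lemma lex_by_total (S T : eqType) (p : T -> S) lt1 lt2 :
  strict_total lt1 -> strict_total lt2 -> strict_total (lex_by p lt1 lt2).
Proof.
move=> [i1 t1 c1] [i2 t2 c2]; split=> [x|y x z|x y xy]; rewrite /lex_by.
- by rewrite i1 i2 andbF.
- case/orP=> [h|/andP[/eqP E h]] /orP[h'|/andP[/eqP E' h']].
  + by rewrite (t1 _ _ _ h h').
  + by rewrite -E' h.
  + by rewrite E h'.
  + by rewrite E E' eqxx (t2 _ _ _ h h') orbT.
- have [E|n] := eqVneq (p x) (p y); last by case/orP: (c1 _ _ n) => ->; rewrite ?orbT.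
  by case/orP: (c2 _ _ xy) => ->; rewrite !orbT.
Qed.

Lemma strict_total_rev (T : eqType) (lt : rel T) :
  strict_total lt -> strict_total (fun x y => lt y x).
Proof.
move=> [i t c]; split=> // [y x z h h'|x y]; first exact: t h' h.
by rewrite eq_sym => /c.
Qed.

Lemma ltn_strict_total : strict_total ltn.
Proof.
split=> [x|y x z|x y]; [exact: ltnn|exact: ltn_trans|].
by rewrite neq_ltn.
Qed.

Lemma strict_total_inj (T : eqType) (rk : T -> nat) :
  injective rk -> strict_total (fun x y => (rk x < rk y)%N).
Proof.
move=> ri; split=> [x|y x z|x y]; [exact: ltnn|exact: ltn_trans|].
by rewrite -(inj_eq ri) neq_ltn.
Qed.

(* The recursion refers to [lt] at the parents; fuel makes it well-founded. *)
Section Refine.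
Variables (T : finType) (r0 : T) (p : T -> T) (dep kap : T -> nat).
Variables (key : rel T) (b : bool).
Hypothesis dep_p : forall x, x != r0 -> (dep (p x) < dep x)%N.
Hypothesis kap_root : forall x, kap x = kap r0 -> x = r0.
Hypothesis key_total : strict_total key.

Definition flip (lt : rel T) : rel T := fun x y => if b then lt x y else lt y x.

Definition refine_step (lt : rel T) : rel T := lex_by kap ltn (lex_by p (flip lt) key).

Lemma refine_stepE lt x y : refine_step lt x y = (kap x < kap y)%N ||
  (kap x == kap y) && (flip lt (p x) (p y) || (p x == p y) && key x y).
Proof. by []. Qed.

Lemma refine_step_total lt : strict_total lt -> strict_total (refine_step lt).
Proof.
move=> h; apply: lex_by_total ltn_strict_total _.
apply: lex_by_total => //; rewrite /flip; case: b => //.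
exact: strict_total_rev.
Qed.

Lemma iter_refine_total n : strict_total (iter n refine_step key).
Proof. by elim: n => //= n IH; apply: refine_step_total. Qed.

(** Comparing vertices of depth at most [n] consults only parents of smaller depth, hence stability
    after [n.+1] rounds. By [kap_root] the root is never compared with another vertex through
    [p r0], about which nothing is assumed. *)
Lemma iter_refine_stable n x y : (dep x <= n)%N -> (dep y <= n)%N ->
  iter n.+2 refine_step key x y = iter n.+1 refine_step key x y.
Proof.
elim: n x y => [|n IH] x y dx dy.
  have rt z : (dep z <= 0)%N -> z = r0.
    by move=> dz; apply/eqP; apply: contraLR dz => /dep_p; rewrite -ltnNge; apply: leq_ltn_trans.
  rewrite (rt _ dx) (rt _ dy).
  by case: (iter_refine_total 2) => -> _ _; case: (iter_refine_total 1) => ->.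
rewrite (iterS n.+2) (iterS n.+1) !refine_stepE.
have [E|//] := eqVneq (kap x) (kap y); congr (_ || (_ && (_ || _))).
have [xr|xr] := eqVneq x r0.
  rewrite xr in E *; rewrite (kap_root (esym E)) /flip.
  have irr k z : iter k refine_step key z z = false by case: (iter_refine_total k).
  by case: b; exact: (etrans (irr n.+2 _) (esym (irr n.+1 _))).
have [yr|yr] := eqVneq y r0; first by rewrite yr in E; case/eqP: xr; apply: kap_root.
have px : (dep (p x) <= n)%N by rewrite -ltnS; apply: leq_trans (dep_p xr) dx.
have py : (dep (p y) <= n)%N by rewrite -ltnS; apply: leq_trans (dep_p yr) dy.
by rewrite /flip; case: b; apply: IH.
Qed.

Lemma refineP : exists2 lt : rel T, strict_total lt
  & forall x y, lt x y = refine_step lt x y.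
Proof.
pose N := \max_(x : T) dep x.
have dN x : (dep x <= N)%N by apply: leq_bigmax.
exists (iter N.+1 refine_step key); first exact: iter_refine_total.
by move=> x y; rewrite -[RHS]/(iter N.+2 refine_step key x y) iter_refine_stable.
Qed.
End Refine.

Section Position.
Variables (T : finType) (lt : rel T) (lt_total : strict_total lt).

Definition pos (x : T) : nat := #|[pred y | lt y x]|.

Lemma lt_pos x y : lt x y -> (pos x < pos y)%N.
Proof.
case: lt_total => i t _ xy; apply: proper_card; apply/properP; split.
  by apply/subsetP => z; rewrite !inE => zx; apply: t zx xy.
by exists x; rewrite !inE // i.
Qed.

Lemma pos_lt x y : lt x y = (pos x < pos y)%N.
Proof.
apply/idP/idP => [/lt_pos//|h]; case: (lt_total) => i t c.
have [E|n] := eqVneq x y; first by rewrite E ltnn in h.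
case/orP: (c _ _ n) => // /lt_pos h'.
by move: (ltn_trans h h'); rewrite ltnn.
Qed.

Lemma pos_inj : injective pos.
Proof.
move=> x y E; apply/eqP; apply: contraT; case: (lt_total) => _ _ c /c.
by rewrite !pos_lt E ltnn.
Qed.

Lemma pos_ltn x : (pos x < #|T|)%N.
Proof.
case: lt_total => i _ _; apply: proper_card; apply/properP; split.
  exact/subsetP.
by exists x; rewrite !inE // i.
Qed.

Lemma pos_surj i : (i < #|T|)%N -> exists x, pos x = i.
Proof.
move=> iT; pose g x : 'I_#|T| := Ordinal (pos_ltn x).
have gi : injective g by move=> x y /(congr1 val)/=; apply: pos_inj.
have gb : bijective g by apply: inj_card_bij => //; rewrite card_ord.
by case: gb => h _ hK; exists (h (Ordinal iT)); have /(congr1 val) := hK (Ordinal iT).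
Qed.

Variable x0 : T.

Definition at_pos i := odflt x0 [pick x | pos x == i].

Lemma pos_atK i : (i < #|T|)%N -> pos (at_pos i) = i.
Proof.
case/pos_surj => x xi; rewrite /at_pos; case: pickP => [y /eqP//|/(_ x)].
by rewrite xi eqxx.
Qed.

Lemma at_posK x : at_pos (pos x) = x.
Proof. by apply: pos_inj; rewrite pos_atK ?pos_ltn. Qed.

Lemma perm_at_pos : perm_eq [seq at_pos i | i <- iota 0 #|T|] (enum T).
Proof.
apply: uniq_perm; rewrite ?enum_uniq //.
  rewrite map_inj_in_uniq ?iota_uniq // => i j; rewrite !mem_iota !add0n => hi hj E.
  by rewrite -(pos_atK hi) E pos_atK.
move=> x; rewrite mem_enum inE; apply/mapP; exists (pos x); last by rewrite at_posK.
by rewrite mem_iota pos_ltn.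
Qed.

Lemma count_at_pos (P : pred T) :
  count (fun i => P (at_pos i)) (iota 0 #|T|) = #|P|.
Proof.
rewrite -(@count_map _ _ at_pos P) (permP perm_at_pos) enumT cardE size_filter.
exact: eq_count.
Qed.
End Position.

(* Vertex [i] has degree [d i] and, unless [i = m] is the root, parent [q i]. *)
Section Parents.
Variables (G : graph) (r0 : G) (p : G -> G) (dep : G -> nat).
Hypothesis edge_p : forall x y,
  edge x y = (x != r0) && (p x == y) || (y != r0) && (p y == x).
Hypothesis dep_p : forall x, x != r0 -> (dep (p x) < dep x)%N.

(** Since [dep] decreases towards the root, the parent of [x] is not also one of its children. *)
Lemma deg_children x : deg x = ((x != r0) + #|[pred y | (y != r0) && (p y == x)]|)%N.
Proof.
rewrite /deg; have [->|xr] /= := eqVneq x r0.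
  by apply: eq_card => y; rewrite !inE edge_p eqxx.
rewrite (cardD1 (p x)) inE edge_p xr eqxx /=; congr (_ + _)%N.
apply: eq_card => y; rewrite !inE edge_p xr /= eq_sym.
have [E|//] := eqVneq (p x) y; rewrite -E /=; apply/esym/negP => /andP[h1 /eqP h2].
by have := ltn_trans (dep_p h1) (dep_p xr); rewrite h2 ltnn.
Qed.

(** Each vertex other than the root contributes twice, once through its parent edge and once as a
    child. *)
Lemma sum_deg : \sum_(x : G) deg x = (#|G|.-1).*2.
Proof.
under eq_bigr => x _ do rewrite deg_children.
rewrite big_split /=.
have -> : (\sum_(x : G) (x != r0) = #|G|.-1)%N.
  rewrite -(cardC1 r0) -sum1_card [RHS]big_mkcond; apply: eq_bigr => x _.
  by rewrite inE; case: (x != r0).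
rewrite -addnn; congr (_ + _)%N.
rewrite -(cardC1 r0) -[RHS]sum1_card [RHS](partition_big p predT) //=.
apply: eq_bigr => x _; rewrite -sum1_card; apply: eq_bigl => y.
by rewrite !inE.
Qed.

Variables (lt : rel G) (lt_total : strict_total lt).
Notation at_ := (at_pos lt r0).
Notation pos := (pos lt).

Definition pidx i := pos (p (at_ i)).

Lemma count_pidx j : (j < #|G|)%N ->
  count (fun i => (i != pos r0) && (pidx i == j)) (iota 0 #|G|) =
  (deg (at_ j) - (j != pos r0))%N.
Proof.
move=> jG; rewrite deg_children.
have -> : (at_ j != r0) = (j != pos r0).
  by rewrite -(inj_eq (pos_inj lt_total)) pos_atK.
rewrite addKn -[RHS](count_at_pos lt_total r0); apply: eq_in_count => i.
rewrite mem_iota add0n => /= iG; rewrite /pidx.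
rewrite -[at_ i == r0](inj_eq (pos_inj lt_total)) pos_atK //.
by rewrite -[p _ == _](inj_eq (pos_inj lt_total)) pos_atK.
Qed.

Lemma edge_pidx i j : (i < #|G|)%N -> (j < #|G|)%N ->
  edge (at_ i) (at_ j) =
  (i != pos r0) && (pidx i == j) || (j != pos r0) && (pidx j == i).
Proof.
move=> iG jG; rewrite edge_p /pidx.
by rewrite -!(inj_eq (pos_inj lt_total)) !pos_atK.
Qed.
End Parents.

(* A rooting with a ranking [kap] of the vertices by decreasing degree, in
   which parents are ranked in the opposite order of their children. *)
Definition layout (G : graph) (r0 : G) (p : G -> G) (dep kap : G -> nat) :=
  [/\ (1 < deg r0)%N,
      forall x y, edge x y = (x != r0) && (p x == y) || (y != r0) && (p y == x),
      forall x, x != r0 -> (dep (p x) < dep x)%N,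
      forall x, kap x = kap r0 -> x = r0
    & (forall x y, (kap x <= kap y)%N -> (deg y <= deg x)%N) /\
      forall x y, x != r0 -> y != r0 -> (kap x < kap y)%N ->
        p x = p y \/ (kap (p y) < kap (p x))%N].

(** * Strictly increasing invariants *)

Section Increasing.
Variables (R : realType) (G : graph) (Gt : is_tree G) (r : G -> G -> R).
Let rle : rel R := fun a b => (a <= b)%R.
Implicit Types (u v w x y z s t a b : G).
Hypothesis r_total : forall v w, v != w -> (1 < deg v)%N -> (1 < deg w)%N ->
  xge r v w || xge r w v.
Hypothesis r_leaf2 : forall u v s w, edge u v -> edge s w -> deg v = 1%N ->
  deg w = 1%N -> r u v = r s w.
Hypothesis r_leaf : forall u v s w, edge u v -> edge s w -> deg v = 1%N ->
  (1 < deg w)%N -> rle (r u v) (r s w) && ~~ rle (r s w) (r u v).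
Hypothesis r_dom : forall u v s t, edge u v -> edge s t -> (1 < deg v)%N ->
  (1 < deg t)%N -> (deg t <= deg v)%N ->
  (forall x y, edge v x -> x != u -> edge t y -> y != s -> (r t y <= r v x)%R) ->
  rle (r s t) (r u v) /\
  (rle (r u v) (r s t) -> deg v = deg t /\
   forall x y, edge v x -> x != u -> edge t y -> y != s -> (r v x <= r t y)%R).

Let rle_refl : reflexive rle. Proof. by move=> a; apply: lexx. Qed.
Let leE := vgeE Gt rle_refl r_total r_leaf2 r_leaf r_dom.

(* Otherwise every branch inside the one of [y] would be smaller than each
   child branch of [y]. *)
Lemma small_child s y : edge s y -> (1 < deg y)%N ->
  (forall u, br s y u -> (deg u <= deg y)%N) ->
  exists g, [/\ edge y g, g != s & (r y g < r s y)%R].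
Proof.
move=> sy dy dmax.
case: (boolP [exists g, [&& edge y g, g != s & (r y g < r s y)%R]]).
  by case/existsP => g /and3P[]; exists g.
move/existsPn => H.
have {}H z : edge y z -> z != s -> (r s y <= r y z)%R.
  by move=> yz zs; have := H z; rewrite yz zs /= -leNgt.
(* Taking the branch of [z] itself gives [r y z < r y z]. The claim is proved from the leaves
   upwards: by induction the children of [b] have smaller values than those of [y], and strictness
   excludes equality in [r_dom]. *)
suff K a b : edge a b -> br s y a -> ~~ br a b s ->
    forall z, edge y z -> z != s -> (r a b < r y z)%R.
  case: (exists_child Gt sy dy) => z yz zs.
  have nb : ~~ br y z s.
    rewrite br_nxE //; apply/negP => /andP[_]; rewrite nx_nbr 1?edge_sym //.
    by rewrite eq_sym (negbTE zs).
  by have := K y z yz (br_refl _ _) nb z yz zs; rewrite ltxx.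
move=> ab; move: a b ab.
apply: (br_ind Gt) => a b ab IH ha hs z yz zs.
have hb : br s y b.
  apply: contraT => hb; case: (br_cross Gt sy ha ab hb) => _ bs.
  by rewrite bs br_refl in hs.
apply: lt_le_trans (H z yz zs).
have [db|db] := eqVneq (deg b) 1%N.
  by case/andP: (r_leaf ab sy db dy); rewrite /rle -ltNge.
rewrite -(deg_gt1_neq1 Gt ab) in db.
have IH' x z' : edge b x -> x != a -> edge y z' -> z' != s -> (r b x < r y z')%R.
  move=> bx xa yz' zs'; apply: IH => //.
  by apply: contra hs; apply: br_sub.
case: (r_dom sy ab dy db (dmax _ hb)) => [x y' yx xs' by' ya|h1 h2].
  exact/ltW/IH'.
rewrite lt_neqAle [(_ <= _)%R]h1 andbT; apply/negP => /eqP E.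
case: h2 => [|_ h2]; first by rewrite E /rle lexx.
case: (exists_child Gt ab db) => x bx xa.
have := h2 z x yz zs bx xa; rewrite leNgt.
by rewrite IH'.
Qed.

(** Domination over [z] spreads from [y] back to [w]. If [t] dominates [z], then the branch at [t]
    exceeds the child branch of [z] found by [small_child]; hence [z] cannot dominate the vertex
    preceding [t], which therefore dominates [z] too. At [w] this contradicts [~~ xge r w z]. *)
Lemma no_mutual v w y z :
  edge v w -> br v w y -> br w v z -> (1 < deg z)%N -> deg y = deg z ->
  (forall u, (deg u <= deg z)%N) -> ~~ xge r w z -> xge r y z -> False.
Proof.
move=> vw hy hz dz dyz dmax nwz yz.
have wv : edge w v by rewrite edge_sym.
have zw : z != w by apply: contraTneq hz => ->; rewrite br_self.
have zn : ~~ br v w z by rewrite br_cut // hz.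
pose zp := nx z w.
have wz : w != z by rewrite eq_sym.
have ezp : edge z zp by apply: nx_edge.
have ezp' : edge zp z by rewrite edge_sym.
have sub u : br v w u -> br z zp u.
  move=> hu; have uz : u != z by apply: contraTneq hu => ->.
  by rewrite br_nxE // uz (nx_const Gt vw zn hu) eqxx.
have [g [zg gz gr]] := small_child ezp' dz (fun u _ => dmax u).
have dw : (1 < deg w)%N by apply: (br_deg Gt vw hy); rewrite dyz.
suff K s t : edge s t -> (forall u, br s t u -> br v w u) -> br s t y ->
    exists g, [/\ edge z g, g != zp & (r z g < r s t)%R].
  have [yw|yw] := eqVneq y w; first by rewrite -yw yz in nwz.
  case: (br_dec vw hy yw) => t /andP[wt tv] ht.
  case: (K w t wt _ ht) => [u hu|g' [zg' gz' gr']]; first exact: (br_sub Gt vw wt tv hu).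
  have := r_total zw dz dw; rewrite (negbTE nwz) orbF => /xgeP[_ h].
  have := h g' t zg' _ wt; rewrite leNgt gr' => H; suff: false by [].
  apply: H; first by rewrite br_nxE // wz eq_sym.
  by apply: contra zn; apply: br_sub.
move=> st; move: s t st; apply: (br_ind Gt) => s t st IH stb hty.
have tz : t != z.
  by apply: contraNneq zn => <-; apply: stb; apply: br_refl.
have d : dis s t zp z.
  move=> u hu; rewrite br_cut // => /negP; apply; apply: sub; exact: stb.
suff : xge r t z.
  move=> h; exists g; split=> //; apply: lt_le_trans gr _.
  have := leE d st ezp'; rewrite /rle => <-.
  apply/orP; right; rewrite h andbT; apply: leq_trans dz _.
  by case/xgeP: h.
have [<-//|yt] := eqVneq y t.
case: (br_dec st hty yt) => x /andP[tx xs] hx.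
have dt := deg_child Gt st tx xs.
case: (IH x tx xs _ hx) => [u hu|g' [zg' gz' gr']].
  exact: (stb _ (br_sub Gt st tx xs hu)).
case/orP: (r_total tz dt dz) => // /xgeP[_ h].
have := h g' x zg' _ tx; rewrite leNgt gr' => H; suff: false by [].
apply: H; first by rewrite br_nxE // tz eq_sym (nx_const Gt vw zn (stb _ (br_refl _ _))).
by apply: contra zn => hzx; apply: stb; apply: (br_sub Gt st tx xs).
Qed.

Notation Ge := (vge r).

Lemma dominating_vertex : exists x0, forall v, v != x0 -> Ge x0 v.
Proof.
have [_ _ G0 _ _] := Gt.
case/card_gt0P: (G0) => g0 _.
pose vm := [arg max_(v > g0) deg v].
have vmax u : (deg u <= deg vm)%N by rewrite /vm; case: arg_maxnP => // i _; apply.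
have [dvm|dvm] := leqP (deg vm) 1.
  exists g0 => v vg; rewrite /vge; apply/orP; left.
  have := deg_edge_gt0 Gt (edge_par Gt vg).
  by have := leq_trans (vmax v) dvm; case: (deg v) => [|[]].
(* Vertices of maximal degree are enough: one of smaller degree cannot dominate a vertex of maximal
   degree, so totality settles the rest. *)
pose good x := [forall y, (y != x) && (deg y == deg vm) ==> xge r x y].
case: (boolP [exists x, (1 < deg x)%N && good x]) => [|bad].
  case/existsP=> x /andP[dx /forallP gx]; exists x => v vx; rewrite /vge.
  have ex := edge_par Gt vx.
  have [//|dv] := eqVneq (deg v) 1%N; rewrite -(deg_gt1_neq1 Gt ex) in dv.
  rewrite dx /=.
  have xv : x != v by rewrite eq_sym.
  have dxm : deg x = deg vm.
    have [->//|xm] := eqVneq x vm.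
    have := gx vm; rewrite eq_sym xm eqxx => /xgeP[h _].
    by apply/eqP; rewrite eqn_leq h vmax.
  case/orP: (r_total xv dx dv) => // h.
  have /xgeP[h1 _] := h.
  by apply: (implyP (gx v)); rewrite vx eqn_leq vmax -dxm.
(* Without a good vertex, each non-leaf vertex points towards a vertex of maximal degree that it
   does not dominate. Two neighbours pointing at each other are refuted by [no_mutual], whichever of
   [y] and [z] dominates the other. *)
pose Bd v w := exists y, [/\ br v w y, deg y = deg vm & ~~ xge r v y].
have [|v [w [vw [y [hy dy ny]] [z [hz dz nz]]]]] :=
    @turning_edge _ Gt (fun v => 1 < deg v)%N Bd vm dvm.
  move=> v dv; move/existsPn: bad => /(_ v); rewrite dv /= negb_forall => /existsP[y].
  rewrite negb_imply => /andP[/andP[yv /eqP dy] ny].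
  exists (nx v y); split; first exact: nx_edge.
    by apply: (br_deg Gt (nx_edge Gt yv) (nx_br Gt yv)); rewrite dy.
  by exists y; split=> //; apply: nx_br.
have yz : y != z.
  by apply/eqP => E; move: hy; rewrite E br_cut // hz.
have wv : edge w v by rewrite edge_sym.
have dm u : (deg u <= deg z)%N by rewrite dz.
have dm' u : (deg u <= deg y)%N by rewrite dy.
have dzy : deg z = deg y by rewrite dy.
have dz1 : (1 < deg z)%N by rewrite dz.
have dy1 : (1 < deg y)%N by rewrite dy.
case/orP: (r_total yz dy1 dz1) => h.
  by case: (no_mutual vw hy hz dz1 (esym dzy) dm nz h).
by case: (no_mutual wv hz hy dy1 dzy dm' ny h).
Qed.

Section Root.
Variable x0 : G.
Hypothesis x0_ge : forall v, v != x0 -> Ge x0 v.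
Notation par := (par x0).
Notation anc := (anc x0).
Notation depth := (depth x0).

(** Take a counterexample [y] of maximal degree below [x], so that [small_child] applies at [y].
    Since [par x] dominates [y], the value at [y] is at most that of the branch at [par x] seen from
    [x]; since [y] dominates [x], the latter is at most every child value of [y]. The small child
    contradicts this. *)
Lemma anc_ge x y : anc x y -> x != y -> Ge x y.
Proof.
have [n] := ubnP (depth x); elim: n x y => [//|n IH] x y; rewrite ltnS => dn.
move=> axy xy; apply: contraT => bad.
pose B := [pred y | [&& anc x y, x != y & ~~ Ge x y]].
have By : B y by apply/and3P.
case: (@arg_maxnP _ y B (@deg G) By) => {axy xy bad By}y /and3P[axy xy bad] ymax.
have xx := anc_neq axy; have yx0 := anc_neq_root Gt axy.
have ex := edge_par Gt xx; have ey := edge_par Gt yx0.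
have ex' : edge x (par x) by rewrite edge_sym.
have ayx : ~~ anc y x.
  by apply: contra xy => h; rewrite (anc_antisym Gt axy h).
have dx : (1 < deg x)%N.
  case/andP: (axy) => _ h; rewrite eq_sym in xy.
  by case: (br_dec ex h xy) => z /andP[xz zp] _; apply: deg_child ex xz zp.
move: bad; rewrite /vge negb_or dx /= -(deg_gt1_neq1 Gt ey) => /andP[dy nxy].
have := r_total xy dx dy; rewrite (negbTE nxy) /= => yx.
have yp : y != par x.
  by apply: contraNneq ayx => yE; rewrite anc_par // -yE anc_refl // orbT.
have gp : Ge (par x) y.
  have [pE|pn] := eqVneq (par x) x0; first by rewrite pE; apply: x0_ge.
  apply: IH; last by rewrite eq_sym.
    by apply: leq_trans dn; rewrite (depth_par Gt xx).
  by apply: (anc_trans Gt _ axy); rewrite (anc_par Gt _ xx) anc_refl // orbT.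
have d : dis x (par x) (par y) y.
  move=> u hu hu'; have : anc x u by apply: (anc_trans Gt axy); rewrite /anc yx0.
  by rewrite ancP // hu.
have h1 : (r (par y) y <= r x (par x))%R.
  by have := leE d ex' ey; rewrite /rle => <-.
have h2 z : edge y z -> z != par y -> (r x (par x) <= r y z)%R.
  move=> yz zp; case/xgeP: yx => _; apply => //; last by rewrite -ancP.
  rewrite br_nxE // xy /=.
  move: ayx; rewrite ancP // negbK => h.
  by rewrite (br_nx Gt _ h) 1?edge_sym // eq_sym.
have dmax u : br (par y) y u -> (deg u <= deg y)%N.
  move=> hu; rewrite leqNgt; apply/negP => du.
  have ayu : anc y u by rewrite /anc yx0.
  suff /ymax : B u by rewrite /geq /= leqNgt du.
  apply/and3P; split; first exact: (anc_trans Gt axy ayu).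
    by apply: contraNneq ayx => ->.
  apply/negP => /(vge_deg Gt ex) h.
  case/xgeP: yx => h' _; move: (leq_trans h h').
  by rewrite leqNgt du.
have [g [yg gp' gr]] := small_child ey dy dmax.
by have := lt_le_trans gr (le_trans h1 (h2 g yg gp')); rewrite ltxx.
Qed.

Definition skey : rel G :=
  @lex_by R G (fun x => r (par x) x) (fun a b : R => (b < a)%R)
    (fun x y => (enum_rank x < enum_rank y)%N).

Lemma skey_total : strict_total skey.
Proof.
apply: lex_by_total; last exact: (strict_total_inj (fun x y h => enum_rank_inj (val_inj h))).
split=> [a|b a c h h'|a b]; [exact: ltxx|exact: lt_trans h' h|].
by rewrite neq_lt orbC.
Qed.

(** Vertices are ordered by depth, then by the order of their parents, then by branch value. That
    earlier vertices dominate later ones follows by induction on depth: incomparable vertices have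
    disjoint branches, whose values compare by [skey] under a common parent and by domination of the
    parents otherwise. *)
Lemma bfs_order : exists lt : rel G,
  [/\ strict_total lt, forall x, x != x0 -> lt x0 x,
      forall x y, lt x y -> (deg y <= deg x)%N
    & forall x y, x != x0 -> y != x0 -> lt x y -> par x = par y \/ lt (par x) (par y)].
Proof.
have [||lt ltt ltE] := @refineP _ x0 par depth depth skey true _ _ skey_total.
- by move=> x xx; rewrite (depth_par Gt xx).
- by move=> x; rewrite depth_root // => /eqP; rewrite depth_eq0 // => /eqP.
have ltE' x y : lt x y = (depth x < depth y)%N || (depth x == depth y) &&
    (lt (par x) (par y) || (par x == par y) && skey x y) by rewrite ltE.
have ltp x y : x != x0 -> y != x0 -> lt x y -> par x = par y \/ lt (par x) (par y).
  move=> xx yx; rewrite ltE' => /orP[h|/andP[_ /orP[->|/andP[/eqP->]]]]; [|by right|by left].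
  by right; rewrite ltE'; move: h; rewrite (depth_par Gt xx) (depth_par Gt yx) ltnS => ->.
exists lt; split=> //.
  by move=> x xx; rewrite ltE' depth_root // lt0n depth_eq0 // xx.
suff K x y : lt x y -> Ge x y.
  move=> x y xy; have [xE|xx] := eqVneq x x0; last exact: (vge_deg Gt (edge_par Gt xx) (K _ _ xy)).
  have yx : y != x0 by apply: contraTneq xy => yE; rewrite xE yE; case: ltt => ->.
  have := K _ _ xy; rewrite /vge => /orP[/eqP->|/andP[_ /xgeP[]]//].
  apply: (deg_gt0 (v := nx x y)); apply: nx_edge => //.
  by rewrite xE.
have [n] := ubnP (depth y); elim: n x y => [//|n IH] x y; rewrite ltnS => dn xy.
have nxy : y != x by apply: contraTneq xy => ->; case: ltt => ->.
have nyx : x != y by rewrite eq_sym.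
have [xE|xx] := eqVneq x x0; first by rewrite xE in nxy *; apply: x0_ge.
have dxy : (depth x <= depth y)%N.
  by move: xy; rewrite ltE' => /orP[/ltnW//|/andP[/eqP->]].
have yx : y != x0.
  by apply: contraNneq xx => yE; move: dxy; rewrite yE depth_root // leqn0 depth_eq0.
case: (boolP (anc x y)) => [h|axy]; first exact: anc_ge.
have ex := edge_par Gt xx; have ey := edge_par Gt yx.
have ayx : ~~ anc y x.
  apply/negP => h; move: (anc_depth Gt h) (h); rewrite anc_par // yx (negbTE nxy) /=.
  move=> _ /(anc_depth Gt) h'; move: (leq_trans dxy h').
  by rewrite (depth_par Gt xx) ltnn.
have d := dis_anc Gt xx yx axy ayx.
rewrite (leE d ex ey) /rle.
have [pE|pn] := eqVneq (par x) (par y).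
  move: xy; rewrite ltE' -pE; have -> : lt (par x) (par x) = false by case: ltt => ->.
  rewrite eqxx (depth_par Gt xx) (depth_par Gt yx) pE ltnn eqxx /=.
  by rewrite /skey /lex_by pE => /orP[/ltW//|/andP[/eqP E _]]; rewrite E.
case: (ltp x y xx yx xy) => [E|pxy]; first by rewrite E eqxx in pn.
have gp : Ge (par x) (par y).
  by apply: IH pxy; apply: leq_trans dn; rewrite (depth_par Gt yx).
apply: (vge_away Gt gp) => //.
  apply/negP => h; have : anc x (par y) by rewrite /anc xx.
  by move=> h'; move: axy; rewrite anc_par // h' orbT.
apply/negP => h; have : anc y (par x) by rewrite /anc yx.
by move=> h'; move: ayx; rewrite anc_par // h' orbT.
Qed.

End Root.
End Increasing.

(** * Greedy trees *)

(** A non-increasing list is determined by its multiset of entries, so [D] is read off along any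
    order of non-increasing degrees. *)
Lemma nth_degree_sequence (G : graph) (x0 : G) (lt : rel G) (D : seq nat) :
  strict_total lt -> (forall x y, lt x y -> (deg y <= deg x)%N) ->
  degree_sequence G D ->
  size D = #|G| /\ forall i, (i < #|G|)%N -> nth 0%N D i = deg (at_pos lt x0 i).
Proof.
move=> ltt ltd [Ds Dp].
have E : D = [seq deg (at_pos lt x0 i) | i <- iota 0 #|G|].
  apply: (sorted_eq (leT := geq)) => //.
  - by move=> a b c h1 h2; apply: leq_trans h2 h1.
  - by move=> a b; rewrite /geq -eqn_leq eq_sym => /eqP.
  - apply: (homo_sorted_in (e := ltn) (P := [pred i | i < #|G|])%N).
    + move=> i j iG jG ij; rewrite /geq /=; apply: ltd.
      by rewrite pos_lt // !pos_atK.
    + by apply/allP => i; rewrite mem_iota.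
    + exact: iota_ltn_sorted.
  apply: perm_trans Dp _; rewrite /image_mem perm_sym (map_comp (@deg G)).
  exact/perm_map/perm_at_pos.
split; first by rewrite E size_map size_iota.
by move=> i iG; rewrite E (nth_map 0%N) ?size_iota // nth_iota.
Qed.

(** The entries below [j] form an initial segment. For the list of parents, its length is the sum in
    [greedy_first_child]. *)
Lemma nth_lt_count (L : seq nat) j k : sorted leq L -> (k < size L)%N ->
  (nth 0%N L k < j)%N = (k < count (fun x => x < j)%N L)%N.
Proof.
elim: L k => [//|a L IH] k pL kL; have sL := path_sorted pL.
have aL : all (leq a) L by apply: order_path_min pL; exact: leq_trans.
have [aj|ja] /= := ltnP a j; last first.
  have -> : count (fun x => x < j)%N L = 0%N.
    apply/eqP; rewrite -leqn0 leqNgt -has_count; apply/hasPn => x /(allP aL) ax.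
    by rewrite -leqNgt (leq_trans ja).
  rewrite addn0 (ltnNge a) ja ltn0; apply/negbTE; rewrite -leqNgt; apply: leq_trans ja _.
  by case: k kL => //= k kL; apply: (allP aL); apply: mem_nth.
by rewrite aj; case: k kL => [|k] //= kL; rewrite IH.
Qed.

Lemma count_lt_sum (L : seq nat) j :
  count (fun x => x < j)%N L = \sum_(m < j) count_mem (m : nat) L.
Proof.
elim: j => [|j IH]; first by rewrite big_ord0; apply/eqP; rewrite -leqn0 leqNgt -has_count; apply/hasPn.
rewrite big_ord_recr /= -IH -count_predUI.
rewrite [X in (_ + X)%N](_ : _ = 0%N).
  by rewrite addn0; apply: eq_count => x /=; rewrite ltnS leq_eqVlt orbC.
apply/eqP; rewrite -leqn0 leqNgt -has_count; apply/hasPn => x _ /=.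
by apply/negP => /andP[h /eqP E]; rewrite E ltnn in h.
Qed.

(** Along the order the parents form a non-decreasing list in which [j] occurs
    [greedy_nchildren D j] times. This determines the list: the children of [j] fill the interval
    that the greedy tree prescribes. *)
Lemma greedy_iso (G : graph) (x0 : G) (p : G -> G) (dep : G -> nat)
    (lt : rel G) (D : seq nat) :
  (forall x y, edge x y = (x != x0) && (p x == y) || (y != x0) && (p y == x)) ->
  (forall x, x != x0 -> (dep (p x) < dep x)%N) ->
  strict_total lt -> (forall x, x != x0 -> lt x0 x) ->
  (forall x y, lt x y -> (deg y <= deg x)%N) ->
  (forall x y, x != x0 -> y != x0 -> lt x y -> p x = p y \/ lt (p x) (p y)) ->
  degree_sequence G D -> giso G (greedy_tree D).
Proof.
move=> ep dp ltt lt0 ltd ltp DG.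
have [sD nD] := nth_degree_sequence x0 ltt ltd DG.
have p0 : pos lt x0 = 0%N.
  apply: eq_card0 => y; rewrite inE; have [->|/lt0 h] := eqVneq y x0.
    by case: ltt.
  by apply/negP => h'; case: ltt => i t _; move: (t _ _ _ h h'); rewrite i.
pose q := pidx x0 p lt; set at_ := at_pos lt x0 in nD.
have qG i : (q i < #|G|)%N by apply: pos_ltn.
have qmono i j : (0 < i)%N -> (i <= j < #|G|)%N -> (q i <= q j)%N.
  move=> i0 /andP[]; rewrite leq_eqVlt => /predU1P[->//|ij] jG.
  have iG := ltn_trans ij jG; have j0 := ltn_trans i0 ij.
  have nz k : (0 < k < #|G|)%N -> at_ k != x0.
    case/andP=> k0 kG; rewrite -(inj_eq (pos_inj ltt)) pos_atK // p0.
    by rewrite -lt0n.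
  have := ltp (at_ i) (at_ j); rewrite !nz ?i0 ?j0 // pos_lt // !pos_atK // ij.
  by case=> // [h|/(lt_pos ltt)/ltnW//]; rewrite /q /pidx -/at_ h.
have cq j : (j < #|G|)%N ->
    count_mem j [seq q i | i <- iota 1 #|G|.-1] = greedy_nchildren D j.
  move=> jG; have := count_pidx ep dp ltt jG; rewrite p0 -/at_ -nD // count_map.
  have G0 : (0 < #|G|)%N := leq_ltn_trans (leq0n j) jG.
  rewrite -{1}(prednK G0) /= add0n => E.
  transitivity (nth 0%N D j - (j != 0%N))%N; last by case: j {jG E} => [|j]; rewrite ?subn0 ?subn1.
  rewrite -E; apply: eq_in_count => i; rewrite mem_iota /= => /andP[i0 _].
  by rewrite -lt0n i0.
have sq : sorted leq [seq q i | i <- iota 1 #|G|.-1].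
  apply: (homo_sorted_in (e := ltn) (P := [pred i | 0 < i < #|G|])%N).
  - move=> i j /andP[i0 _] /andP[_ jG] ij; apply: qmono => //.
    by rewrite (ltnW ij).
  - apply/allP => i; rewrite mem_iota /= => /andP[-> h]; apply: leq_trans h _.
    by rewrite add1n prednK //; apply: leq_ltn_trans (qG 0%N).
  - exact: iota_ltn_sorted.
(* The list of parents starts at position 1, because the root has none; hence the [1 +] in
   [greedy_first_child]. *)
have qlt i j : (0 < i < #|G|)%N -> (j <= #|G|)%N ->
    (q i < j)%N = (i < greedy_first_child D j)%N.
  case/andP; case: i => // i _ iG jG.
  have iG' : (i < #|G|.-1)%N by case: #|G| iG.
  have := @nth_lt_count _ j i sq; rewrite size_map size_iota iG' => /(_ isT).
  rewrite (nth_map 0%N) ?size_iota // nth_iota // add1n => ->.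
  rewrite count_lt_sum /greedy_first_child add1n ltnS; congr (_ < _)%N.
  apply: eq_bigr => m _; apply: cq; exact: leq_trans (ltn_ord m) jG.
have cE i j : (i < #|G|)%N -> (j < #|G|)%N ->
    greedy_child D j i = (i != 0%N) && (q i == j).
  move=> iG jG; rewrite /greedy_child.
  have [->|i0] := eqVneq i 0%N; first by rewrite /greedy_first_child add1n.
  rewrite -lt0n in i0; rewrite leqNgt -!qlt ?i0 //= ?(ltnW jG) //.
  by rewrite -leqNgt ltnS -eqn_leq eq_sym.
have pD x : (pos lt x < size D)%N by rewrite sD pos_ltn.
exists (fun x => Ordinal (pD x) : greedy_tree D).
  apply: inj_card_bij => [x y /(congr1 val)/= /(pos_inj ltt)//|].
  by rewrite card_ord sD.
move=> x y; rewrite /= !cE ?pos_ltn //.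
rewrite -[in RHS](at_posK ltt x0 x) -[in RHS](at_posK ltt x0 y).
by rewrite (edge_pidx ep ltt) ?pos_ltn // p0 orbC.
Qed.

(** * Strictly decreasing invariants *)

(* [ld n u v]: the branch at [v] away from [u] has a leaf at depth [n]. *)
Fixpoint ld (G : graph) (n : nat) (u v : G) : bool :=
  if n is n'.+1 then [exists x, [&& edge v x, x != u & ld n' v x]]
  else deg v == 1%N.

Section LeafDepth.
Variables (G : graph) (Gt : is_tree G).
Implicit Types (u v w x y z s t a b : G).

Lemma ld_ex u v : edge u v -> exists n, ld n u v.
Proof.
move: u v; apply: (br_ind Gt) => u v uv IH.
have [dv|dv] := eqVneq (deg v) 1%N; first by exists 0%N; apply/eqP.
rewrite -(deg_gt1_neq1 Gt uv) in dv; case: (exists_child Gt uv dv) => x vx xu.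
case: (IH x vx xu) => n h; exists n.+1; apply/existsP; exists x.
by rewrite vx xu.
Qed.

Lemma ldS n u v x : edge v x -> x != u -> ld n v x -> ld n.+1 u v.
Proof. by move=> h1 h2 h3; apply/existsP; exists x; rewrite h1 h2. Qed.

Lemma ld_nonleaf n u v : edge u v -> (1 < deg v)%N -> ld n u v ->
  exists n' x, [/\ n = n'.+1, edge v x, x != u & ld n' v x].
Proof.
move=> uv dv; case: n => [/eqP dv1|n /existsP[x /and3P[h1 h2 h3]]].
  by rewrite dv1 in dv.
by exists n, x.
Qed.

Lemma ld_leaf n u v : edge u v -> deg v = 1%N -> ld n u v -> n = 0%N.
Proof.
move=> uv dv; case: n => // n /existsP[x /and3P[h1 h2 _]].
by have := deg_child Gt uv h1 h2; rewrite dv.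
Qed.

(** Here [m] is the distance from [v] to [t]. Its positivity, and the position of [s] when it is 1,
    are all that is used later. *)
Lemma ld_up n u v s t : edge u v -> edge s t -> br u v t -> ~~ br s t u ->
  ld n s t -> exists m, [/\ ld (n + m) u v, m = 0%N -> s = u /\ t = v
                         & m = 1%N -> s = v].
Proof.
move=> uv st hut hstu hn; move: u v uv hut hstu; apply: (br_ind Gt) => u v uv IH hut hstu.
have [tE|tv] := eqVneq t v.
  have sE : s = u.
    apply/eqP; apply: contraT => su; case/negP: hstu; rewrite tE in st *.
    apply: br_step (br_refl _ _) _ _ _; rewrite 1?edge_sym // 1?eq_sym //.
    exact: edge_neq.
  by exists 0%N; rewrite addn0 -sE -tE.
case: (br_dec uv hut tv) => x /andP[vx xu] hx.
have vn : ~~ br s t v.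
  apply/negP => h; have vu : edge v u by rewrite edge_sym.
  by case: (br_cross Gt st h vu hstu) => E; rewrite E eqxx in tv.
case: (IH x vx xu hx vn) => m [h1 h2 _]; exists m.+1; split=> //.
  by rewrite addnS; apply: ldS vx xu h1.
by case=> /h2[].
Qed.

End LeafDepth.

Section Decreasing.
Variables (R : realType) (G : graph) (Gt : is_tree G) (r : G -> G -> R).
Let rle : rel R := fun a b => (b <= a)%R.
Implicit Types (u v w x y z s t a b : G).
Hypothesis r_total : forall v w, v != w -> (1 < deg v)%N -> (1 < deg w)%N ->
  xge r v w || xge r w v.
Hypothesis r_leaf2 : forall u v s w, edge u v -> edge s w -> deg v = 1%N ->
  deg w = 1%N -> r u v = r s w.
Hypothesis r_leaf : forall u v s w, edge u v -> edge s w -> deg v = 1%N ->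
  (1 < deg w)%N -> rle (r u v) (r s w) && ~~ rle (r s w) (r u v).
Hypothesis r_dom : forall u v s t, edge u v -> edge s t -> (1 < deg v)%N ->
  (1 < deg t)%N -> (deg t <= deg v)%N ->
  (forall x y, edge v x -> x != u -> edge t y -> y != s -> (r t y <= r v x)%R) ->
  rle (r s t) (r u v) /\
  (rle (r u v) (r s t) -> deg v = deg t /\
   forall x y, edge v x -> x != u -> edge t y -> y != s -> (r v x <= r t y)%R).

Let rle_refl : reflexive rle. Proof. by move=> a; apply: lexx. Qed.

Notation Ge := (vge r).

Lemma vge_r s w t a : dis s w t a -> edge s w -> edge t a ->
  Ge w a = (r s w <= r t a)%R.
Proof. exact: (vgeE Gt rle_refl r_total r_leaf2 r_leaf r_dom). Qed.

(** Passing to child branches reverses the comparison, so the induction swaps the two branches and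
    lowers both depths by one. When one side reaches its leaf first, that leaf must be on the side
    of the larger value, which fixes the parity of its depth. *)
Lemma ld_parity i j s w t a : edge s w -> edge t a -> dis s w t a ->
  (r s w <= r t a)%R -> ld i s w -> ld j t a ->
  ((i < j)%N -> odd i) /\ ((j < i)%N -> ~~ odd j).
Proof.
have [n] := ubnP (i + j); elim: n i j s w t a => [//|n IH] i j s w t a.
rewrite ltnS => ijn sw ta d le hi hj.
case: i ijn hi => [|i] ijn hi.
  have [da|da] := eqVneq (deg a) 1%N; first by rewrite (ld_leaf Gt ta da hj).
  rewrite -(deg_gt1_neq1 Gt ta) in da.
  by case/andP: (r_leaf sw ta (eqP hi) da) => _; rewrite /rle le.
case: j ijn hj => [|j] ijn hj; first by split.
case/existsP: hi => x /and3P[wx xs hx]; case/existsP: hj => y /and3P[ay yt hy].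
have dw := deg_child Gt sw wx xs; have da := deg_child Gt ta ay yt.
have := vge_r d sw ta; rewrite le /vge => /orP[/eqP E|/andP[_]].
  by rewrite E in da.
move/(xge_dis Gt r d sw ta) => [_ h].
have d2 : dis a y w x.
  exact: (dis_child Gt (dis_sym (dis_child Gt d sw wx xs)) ta ay yt).
have lt : (j + i < n)%N by move: ijn; rewrite addSn addnS addnC; apply: ltn_trans.
have [h1 h2] := IH j i a y w x lt ay wx d2 (h x y wx xs ay yt) hy hx.
rewrite !ltnS /=; split=> [/h2|/h1]; rewrite ?negbK //.
Qed.

(** Equal values give the parity statement in both directions; the smaller of two different depths
    would be both odd and even. *)
Lemma ld_eq i j s w t a : edge s w -> edge t a -> dis s w t a ->
  r s w = r t a -> ld i s w -> ld j t a -> i = j.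
Proof.
move=> sw ta d E hi hj.
have le1 : (r s w <= r t a)%R by rewrite E.
have le2 : (r t a <= r s w)%R by rewrite E.
have [h1 h2] := ld_parity sw ta d le1 hi hj.
have [h3 h4] := ld_parity ta sw (dis_sym d) le2 hj hi.
case: (ltngtP i j) => // ij.
  by move: (h1 ij); rewrite (negbTE (h4 ij)).
by move: (h3 ij); rewrite (negbTE (h2 ij)).
Qed.

(** [y] lies between [x] and [z]. A leaf beyond [x] at depth [p] reappears at depth [p + m] in the
    branch at [y] towards [x], and similarly [q] and [q + l] for [z]. As [m] and [l] are positive,
    the three comparisons of values violate [ld_parity] whatever the order of [p] and [q]. *)
Lemma not_collinear x y z : (1 < deg x)%N -> (1 < deg z)%N ->
  x != y -> y != z -> nx y x != nx y z ->
  xge r x y -> xge r y z -> xge r z x -> False.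
Proof.
move=> dx dz xy yz cn gxy gyz gzx.
have yx : y != x by rewrite eq_sym.
have zy : z != y by rewrite eq_sym.
have xz : x != z by apply: contraNneq cn => ->.
pose c := nx y x; pose e := nx y z.
have yc : edge y c := nx_edge Gt xy; have ye : edge y e := nx_edge Gt zy.
have hcx : br y c x := nx_br Gt xy; have hez : br y e z := nx_br Gt zy.
have hcz : ~~ br y c z by rewrite br_nxE // zy eq_sym.
have hex : ~~ br y e x by rewrite br_nxE // xy.
case/(deg_gt1P (nx_edge Gt yx)): dx => u xu un.
case/(deg_gt1P (nx_edge Gt yz)): dz => g zg gn.
have huy : ~~ br x u y by rewrite br_nxE // yx eq_sym.
have hgy : ~~ br z g y by rewrite br_nxE // yz eq_sym.
have hgx : ~~ br z g x.
  by rewrite br_nxE // xz (nx_away Gt yc zy hcz hcx) eq_sym.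
have huz : ~~ br x u z.
  by rewrite br_nxE // eq_sym xz (nx_away Gt ye xy hex hez) eq_sym.
have r1 : (r y e <= r x u)%R by case/xgeP: gxy => _; apply.
have r2 : (r z g <= r y c)%R by case/xgeP: gyz => _; apply.
have r3 : (r x u <= r z g)%R by case/xgeP: gzx => _; apply.
case: (ld_ex Gt xu) => p hp; case: (ld_ex Gt zg) => q hq.
have hcu : br y c u.
  apply: br_step hcx xu xy _; apply: contraNneq huy => ->; exact: br_refl.
have heg : br y e g.
  apply: br_step hez zg zy _; apply: contraNneq hgy => ->; exact: br_refl.
case: (ld_up Gt yc xu hcu huy hp) => m [hm m0 _].
case: (ld_up Gt ye zg heg hgy hq) => l [hl l0 _].
have {m0}m0 : (0 < m)%N.
  by rewrite lt0n; apply/eqP => /m0[E _]; rewrite E eqxx in xy.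
have {l0}l0 : (0 < l)%N.
  by rewrite lt0n; apply/eqP => /l0[E _]; rewrite E eqxx in zy.
have [a1 a2] := ld_parity ye xu (dis_nbr Gt yx ye xu hex huy) r1 hl hp.
have [b1 b2] := ld_parity zg yc (dis_nbr Gt zy zg yc hgy hcz) r2 hq hm.
have [c1 c2] := ld_parity xu zg (dis_nbr Gt xz xu zg huz hgx) r3 hp hq.
case: (ltngtP p q) => pq.
- have := c1 pq; rewrite (negbTE (a2 _)) //; exact: ltn_addr.
- have := b1 (ltn_addr _ pq); rewrite (negbTE (c2 pq)) //.
- have k1 : (p < q + l)%N by rewrite pq -addn1 leq_add2l.
  have k2 : (q < p + m)%N by rewrite pq -addn1 leq_add2l.
  by move: (a2 k1) (b1 k2); rewrite pq => /negbTE ->.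
Qed.

(** It suffices to consider a cycle of dominations. If one vertex lies between the other two, a
    rotation of [not_collinear] refutes it. Otherwise each vertex sees the other two in one
    direction, and the inequalities are chained through a branch at [y] facing away from both. *)
Lemma xge_trans x y z : (1 < deg x)%N -> (1 < deg y)%N -> (1 < deg z)%N ->
  x != y -> y != z -> x != z -> xge r x y -> xge r y z -> xge r x z.
Proof.
move=> dx dy dz xy yz xz gxy gyz.
case/orP: (r_total xz dx dz) => // gzx.
have yx : y != x by rewrite eq_sym.
have zy : z != y by rewrite eq_sym.
have zx : z != x by rewrite eq_sym.
have [e1|n1] := eqVneq (nx y x) (nx y z); last by case: (not_collinear dx dz xy yz n1).
have [e2|n2] := eqVneq (nx z y) (nx z x); last by case: (not_collinear dy dx yz zx n2).
have [e3|n3] := eqVneq (nx x z) (nx x y); last by case: (not_collinear dz dy zx xy n3).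
case/xgeP: gxy => h1 h2; case/xgeP: gyz => h3 h4; apply/xgeP; split.
  exact: leq_trans h3 h1.
move=> u g xu un zg gn.
case/(deg_gt1P (nx_edge Gt xy)): dy => h yh hn.
have hx : ~~ br y h x by rewrite br_nxE // xy eq_sym.
have hz : ~~ br y h z by rewrite br_nxE // zy -e1 eq_sym.
apply: le_trans (h4 h g yh hz zg _) (h2 u h xu _ yh hx).
  by move: gn; rewrite !br_nxE // yz xz e2.
by move: un; rewrite !br_nxE // zx yx e3.
Qed.

Lemma vge_trans x y z : x != y -> y != z -> x != z -> Ge x y -> Ge y z -> Ge x z.
Proof.
move=> xy yz xz; rewrite /vge.
have [//|dz] := eqVneq (deg z) 1%N; rewrite /= => + /andP[dy gyz].
have [E|_ /= /andP[dx gxy]] := eqVneq (deg y) 1%N; first by rewrite E in dy.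
rewrite dx; apply: xge_trans gxy gyz => //.
have ez : edge (nx z y) z by rewrite edge_sym // nx_edge.
by rewrite (deg_gt1_neq1 Gt ez).
Qed.

Lemma squeeze h h' m l : (0 < m)%N -> (0 < l)%N -> (h' + m <= h.+1)%N ->
  (h + l <= h'.+1)%N -> [/\ h = h', m = 1%N & l = 1%N].
Proof. by clear => m0 l0 h1 h2; split; lia. Qed.

(** * Paths along which the comparison does not reverse *)

Section BadPath.

Definition rising x y a b := [&& Ge x y, Ge a b & ~~ Ge b a].

(* [a], [x], [b], [y] lie in this order on a path. Seen from a root beyond [a],
   the vertices [x], [y] would be ordered in the same way as their parents. *)
Definition bad_path a x b y :=
  [&& edge a x, edge b y, x != y, ~~ br x a y, br y b x, (1 < deg a)%N,
      (1 < deg x)%N & rising x y a b || rising y x b a].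

Lemma path_geometry a x b y : edge a x -> edge b y -> x != y ->
  ~~ br x a y -> br y b x -> [/\ a != b, ~~ br x a b, br a x b & br y b a].
Proof.
move=> ax by_ xy xay ybx.
have xa : edge x a by rewrite edge_sym.
have yb : edge y b by rewrite edge_sym.
have h1 : ~~ br x a b.
  apply: contra xay => h; apply: (br_step h by_); last by rewrite eq_sym.
  by apply: contraTneq h => ->; rewrite br_self.
have h2 : br y b a.
  apply: contraT => h; case: (br_cross Gt yb ybx xa h) => _ E.
  by rewrite E br_refl in xay.
split=> //; first by apply: contraNneq h1 => ->; apply: br_refl.
by rewrite br_cut.
Qed.

(** Comparing [x] with [y] relates the branch at [a] to the child branches of [y]; comparing [a]
    with [b] relates the branch at [y] to the child branches of [a]. Under [ld_parity] these two
    bound [j], and in the extreme case the parity of [h] tells the two kinds of bad path apart. *)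
Lemma bad_depth a x b y h j : bad_path a x b y -> ld h b y -> ld j x a ->
  (j <= h.+1)%N /\ (j = h.+1 -> if rising x y a b then ~~ odd h else odd h).
Proof.
case/and5P=> ax by_ xy xay /and4P[ybx da dx bad] hh hj.
have xa : edge x a by rewrite edge_sym.
have [ab xab axb yba] := path_geometry ax by_ xy xay ybx.
have ba : b != a by rewrite eq_sym.
have yx : y != x by rewrite eq_sym.
case: (ld_nonleaf xa da hj) => j' [a2 [jE aa2 a2x hj']].
have a2b : ~~ br a a2 b by rewrite br_nxE // ba (br_nx Gt ax axb) eq_sym.
have bya : ~~ br b y a by rewrite br_cut // negbK.
have dA : dis b y a a2 by apply: dis_nbr.
have dB z : edge y z -> z != b -> dis y z x a /\ ~~ br y z x.
  move=> yz zb; have yzx : ~~ br y z x by rewrite br_nxE // xy (br_nx Gt _ ybx) 1?edge_sym // eq_sym.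
  by split=> //; apply: dis_nbr.
case: ifP bad => [/and3P[gxy gab _] _|_ /= /and3P[gyx gba _]].
  have r2 := vge_away Gt gab aa2 a2b by_ bya ab.
  have [a1 a2'] := ld_parity by_ aa2 dA r2 hh hj'.
  case: h hh a1 a2' => [|h'] hh a1 a2'.
    by rewrite jE; case: (j') a1 => // k /(_ isT).
  case/existsP: hh => z /and3P[yz zb hz]; case: (dB z yz zb) => dz yzx.
  have r1 := vge_away Gt gxy xa xay yz yzx xy.
  have [b1 b2] := ld_parity yz xa dz r1 hz hj.
  move: a1 a2' b1 b2; rewrite jE /= => a1 a2' b1 b2; split.
    rewrite ltnS leqNgt; apply/negP => k.
    have k' : (h' < j'.+1)%N by rewrite ltnS; apply: leq_trans (leqnSn _) (ltnW k).
    by have := a1 k; rewrite (b1 k').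
  by case=> k; rewrite negbK; apply: b1; rewrite k ltnW.
have r2 := vge_away Gt gba by_ bya aa2 a2b ba.
have [a1 a2'] := ld_parity aa2 by_ (dis_sym dA) r2 hj' hh.
have dy : (1 < deg y)%N.
  by move: gyx; rewrite /vge => /orP[/eqP E|/andP[]//]; rewrite E in dx.
case: (ld_nonleaf by_ dy hh) => h' [z [hE yz zb hz]]; case: (dB z yz zb) => dz yzx.
have r1 := vge_away Gt gyx yz yzx xa xay yx.
have [b1 b2] := ld_parity xa yz (dis_sym dz) r1 hj hz.
move: a1 a2' b1 b2; rewrite jE hE /= => a1 a2' b1 b2; split.
  rewrite ltnS leqNgt; apply/negP => k.
  have k' : (h' < j'.+1)%N by rewrite ltnS; apply: leq_trans (leqnSn _) (ltnW k).
  by have := a2' k; rewrite negbK (negbTE (b2 k')).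
by case=> k; apply: b2; rewrite k ltnW.
Qed.

Lemma bad_path_side v w a x b y : edge v w -> bad_path a x b y ->
  br x a v -> br v w x -> [/\ forall u, br w v u -> br x a u,
    br v w b, br v w y & forall u, br w v u -> br y b u].
Proof.
move=> vw /and5P[ax by_ xy xay /and4P[ybx da dx _]] hv hx.
have wv : edge w v by rewrite edge_sym.
have xa : edge x a by rewrite edge_sym.
have yb : edge y b by rewrite edge_sym.
have [ab xab axb yba] := path_geometry ax by_ xy xay ybx.
have xn : ~~ br w v x by rewrite br_cut // hx.
have sub u : br w v u -> br x a u.
  move=> hu; have ux : u != x by apply: contraTneq hu => ->.
  rewrite br_nxE // ux (nx_const Gt wv xn hu).
  by rewrite (br_nx Gt xa hv) eqxx.
have out u : ~~ br x a u -> br v w u.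
  by move=> hu; rewrite br_cut //; apply: contra hu; apply: sub.
split=> //; [exact: out|exact: out|] => u hu.
have hu' := sub u hu.
have uy : u != y by apply: contraNneq xay => <-.
by rewrite br_nxE // uy (nx_const Gt xa xay hu') (br_nx Gt yb yba) eqxx.
Qed.

(** A leaf below [y] also lies in the branch at [a'] seen from [x'], and vice versa, so [bad_depth]
    gives [h + l <= h'.+1] and [h' + m <= h.+1] with [m] and [l] positive. Hence [h = h'],
    [m = l = 1], [b' = a] and [b = a']. Equal parity makes both paths of the same kind, but then [a]
    and [a'] are strictly comparable in both directions. *)
Lemma no_opposite_bad_paths v w a x b y a' x' b' y' : edge v w ->
  bad_path a x b y -> br x a v -> br v w x ->
  bad_path a' x' b' y' -> br x' a' w -> br w v x' -> False.
Proof.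
move=> vw B1 hv hx B2 hw hx'.
have wv : edge w v by rewrite edge_sym.
have [s1 vb vy s2] := bad_path_side vw B1 hv hx.
have [t1 wb wy t2] := bad_path_side wv B2 hw hx'.
have /and5P[ax by_ xy xay /and4P[ybx da dx bad]] := B1.
have /and5P[ax' by_' xy' xay' /and4P[ybx' da' dx' bad']] := B2.
have xa : edge x a by rewrite edge_sym.
have xa' : edge x' a' by rewrite edge_sym.
case: (ld_ex Gt by_) => h hh; case: (ld_ex Gt by_') => h' hh'.
have g1 : ~~ br b' y' x by rewrite br_cut // negbK; apply: t2.
have g2 : ~~ br b y x' by rewrite br_cut // negbK; apply: s2.
case: (ld_up Gt xa by_' (s1 _ wy) g1 hh') => m [hm m0 m1].
case: (ld_up Gt xa' by_ (t1 _ vy) g2 hh) => l [hl l0 l1].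
have {}m0 : (0 < m)%N.
  by rewrite lt0n; apply/eqP => /m0[E _]; move: wb; rewrite E br_cut // hx.
have {}l0 : (0 < l)%N.
  by rewrite lt0n; apply/eqP => /l0[E _]; move: vb; rewrite E br_cut // hx'.
have [p1 p2] := bad_depth B1 hh hm; have [q1 q2] := bad_depth B2 hh' hl.
have [hE mE lE] := squeeze m0 l0 p1 q1.
have bE := m1 mE; have bE' := l1 lE.
rewrite mE lE hE addn1 in p2 q2; have {p2}p2 := p2 erefl; have {q2}q2 := q2 erefl.
move: bad bad' p2 q2; rewrite /rising bE' bE.
by case: (Ge x y); case: (Ge x' y'); case: (Ge a a'); case: (Ge a' a) => //=;
  case: (Ge y x) => //=; case: (Ge y' x') => //=; case: (odd h').
Qed.
(** Otherwise each non-leaf vertex points along a bad path leading away from it, and some two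
    neighbours point at each other. *)
Lemma central_vertex v0 : (1 < deg v0)%N ->
  exists2 x0, (1 < deg x0)%N & forall a x b y, bad_path a x b y -> ~~ br x a x0.
Proof.
move=> dv0.
pose away v a x b y := bad_path a x b y && br x a v.
case: (boolP [exists v, (1 < deg v)%N &&
    ~~ [exists a, exists x, exists b, exists y, away v a x b y]]) => [|bad].
  case/existsP=> x0 /andP[dx0 H]; exists x0 => // a x b y B.
  apply: contra H => h; apply/existsP; exists a; apply/existsP; exists x.
  by apply/existsP; exists b; apply/existsP; exists y; rewrite /away B.
pose Bd v w := exists a x b y, [/\ bad_path a x b y, br x a v & br v w x].
have [|v [w [vw [a [x [b [y [B1 hv hx]]]]] [a' [x' [b' [y' [B2 hw hx']]]]]]]] :=
    @turning_edge _ Gt (fun v => 1 < deg v)%N Bd v0 dv0.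
  move=> v dv; move/existsPn: bad => /(_ v); rewrite dv negbK.
  case/existsP=> a /existsP[x /existsP[b /existsP[y /andP[B h]]]].
  have /and5P[ax by_ xy xay /and4P[ybx da dx bad]] := B.
  have xv : x != v by apply: contraTneq h => <-; rewrite br_self // edge_sym.
  have vnx := nx_edge Gt xv; have hnx := nx_br Gt xv.
  exists (nx v x); split=> //; first exact: (br_deg Gt vnx hnx dx).
  by exists a, x, b, y.
by case: (no_opposite_bad_paths vw B1 hv hx B2 hw hx').
Qed.

End BadPath.

(** * The ranking of the vertices seen from a central root *)

Section Root.
Variable x0 : G.
Hypothesis dx0 : (1 < deg x0)%N.
Hypothesis central : forall a x b y, bad_path a x b y -> ~~ br x a x0.
Notation par := (par x0).
Notation anc := (anc x0).

Lemma par_nonleaf x : x != x0 -> (1 < deg (par x))%N.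
Proof.
move=> xx; have [->//|px] := eqVneq (par x) x0.
apply: (deg_child Gt (edge_par Gt px) (edge_par Gt xx)).
by apply: contraTneq (br_par Gt px) => <-; rewrite br_cut ?(br_par Gt xx) // edge_par.
Qed.

Lemma anc_facts x y : anc x y -> x != y ->
  [/\ x != x0, y != x0, ~~ br x (par x) y, br y (par y) x & (1 < deg x)%N].
Proof.
move=> h xy; have xx := anc_neq h; have yx := anc_neq_root Gt h.
have nyx : ~~ anc y x by apply: contraNN xy => h'; rewrite (anc_antisym Gt h h').
split=> //; first by rewrite -ancP.
  by move: nyx; rewrite ancP // negbK.
case/andP: (h) => _ hb; rewrite eq_sym in xy.
have ex := edge_par Gt xx.
by case: (br_dec ex hb xy) => z /andP[xz zp] _; apply: deg_child ex xz zp.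
Qed.

(** A failure would be a bad path leading away from the root. *)
Lemma anc_antitone x y : anc x y -> x != y ->
  (Ge x y -> Ge (par y) (par x)) /\ (Ge y x -> Ge (par x) (par y)).
Proof.
move=> h xy; case: (anc_facts h xy) => xx yx xay ybx dx.
have ex := edge_par Gt xx; have ey := edge_par Gt yx; have da := par_nonleaf xx.
have [ab _ _ _] := path_geometry ex ey xy xay ybx.
have nb : ~~ (rising x y (par x) (par y) || rising y x (par y) (par x)).
  apply/negP => B; have := central (a := par x) (x := x) (b := par y) (y := y).
  by rewrite /bad_path ex ey xy xay ybx da dx B (br_par Gt xx) => /(_ isT).
have ea : edge (nx (par x) (par y)) (par x).
  by rewrite edge_sym // nx_edge // eq_sym.
have eb : edge (nx (par y) (par x)) (par y) by rewrite edge_sym // nx_edge.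
have := vge_total Gt r_total ea eb ab.
move: nb; rewrite negb_or /rising => /andP[n1 n2] tot; split=> g.
  by move: n1 tot; rewrite g /=; case: (Ge (par x) _) => //=; rewrite negbK.
by move: n2 tot; rewrite g /=; case: (Ge (par y) _) => //=; rewrite ?negbK // orbF.
Qed.

(** The parents are tied as well by [anc_antitone]. The two ties give two equalities of branch
    values, hence of leaf depths: [i = j.+1] and [i.+1 = j]. *)
Lemma anc_not_tied x y : anc x y -> x != y -> Ge x y -> Ge y x -> False.
Proof.
move=> h xy g1 g2; case: (anc_facts h xy) => xx yx xay ybx dx.
have ex := edge_par Gt xx; have ey := edge_par Gt yx; have da := par_nonleaf xx.
have xp : edge x (par x) by rewrite edge_sym.
have [ab xab axb yba] := path_geometry ex ey xy xay ybx.
have [/(_ g1) gba /(_ g2) gab] := anc_antitone h xy.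
have dy : (1 < deg y)%N.
  by move: g2; rewrite /vge => /orP[/eqP E|/andP[]//]; rewrite E in dx.
have yx' : y != x by rewrite eq_sym.
have ba : par y != par x by rewrite eq_sym.
case: (exists_child Gt xp da) => a2 aa2 a2x; case: (exists_child Gt ey dy) => z yz zb.
case: (ld_ex Gt aa2) => j hj; case: (ld_ex Gt yz) => i hi.
have a2b : ~~ br (par x) a2 (par y) by rewrite br_nxE // ba (br_nx Gt ex axb) eq_sym.
have bya : ~~ br (par y) y (par x) by rewrite br_cut // ?negbK // edge_sym.
have yzx : ~~ br y z x.
  by rewrite br_nxE // xy (br_nx Gt _ ybx) 1?edge_sym // eq_sym.
have r1 : r y z = r x (par x).
  apply/eqP; rewrite eq_le (vge_away Gt g1 xp xay yz yzx xy).
  exact: (vge_away Gt g2 yz yzx xp xay yx').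
have r2 : r (par y) y = r (par x) a2.
  apply/eqP; rewrite eq_le (vge_away Gt gab aa2 a2b ey bya ab).
  exact: (vge_away Gt gba ey bya aa2 a2b ba).
have e1 := ld_eq yz xp (dis_nbr Gt yx' yz xp yzx xay) r1 hi (ldS aa2 a2x hj).
have e2 := ld_eq ey aa2 (dis_nbr Gt ba ey aa2 bya a2b) r2 (ldS yz zb hi) hj.
by move: e1; rewrite -e2 => /eqP; rewrite ltn_eqF.
Qed.

Definition strict_ge x y := [&& x != y, Ge x y & ~~ Ge y x].

Definition rank x := #|[pred y | (1 < deg y)%N && strict_ge y x]|.

Lemma nonleaf_edge v : (1 < deg v)%N -> exists u, edge u v.
Proof.
move=> dv; have /card_gt0P[u] : (0 < deg v)%N by apply: leq_trans dv.
by rewrite inE edge_sym //; exists u.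
Qed.

Lemma Ge_total v w : (1 < deg v)%N -> (1 < deg w)%N -> v != w -> Ge v w || Ge w v.
Proof.
move=> /nonleaf_edge[u uv] /nonleaf_edge[s sw]; exact: (vge_total Gt r_total uv sw).
Qed.

Lemma rank_le x y : x != y -> Ge x y -> (rank x <= rank y)%N.
Proof.
move=> xy g; apply: subset_leq_card; apply/subsetP => z; rewrite !inE.
case/andP=> dz /and3P[zx gzx nxz]; rewrite dz /=.
have zy : z != y by apply: contraNneq nxz => ->.
apply/and3P; split=> //; first exact: (vge_trans zx xy zy).
apply: contra nxz; rewrite eq_sym in zy; rewrite eq_sym in zx.
exact: (vge_trans xy zy zx).
Qed.

Lemma rank_lt x y : (1 < deg x)%N -> strict_ge x y -> (rank x < rank y)%N.
Proof.
move=> dx s; have /and3P[xy g n] := s.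
apply: proper_card; apply/properP; split; last first.
  by exists x; [rewrite inE dx|rewrite inE /strict_ge eqxx andbF].
apply/subsetP => z; rewrite !inE.
case/andP=> dz /and3P[zx gzx nxz]; rewrite dz /=.
have zy : z != y by apply: contraNneq nxz => ->.
apply/and3P; split=> //; first exact: (vge_trans zx xy zy).
apply: contra nxz; rewrite eq_sym in zy; rewrite eq_sym in zx.
exact: (vge_trans xy zy zx).
Qed.

Lemma rank_ltP x y : (1 < deg x)%N -> (1 < deg y)%N -> (rank x < rank y)%N ->
  Ge x y && ~~ Ge y x.
Proof.
move=> dx dy lt; have xy : x != y by apply: contraTneq lt => ->; rewrite ltnn.
have yx : y != x by rewrite eq_sym.
have n : ~~ Ge y x by apply/negP => /(rank_le yx); rewrite leqNgt lt.
by have := Ge_total dx dy xy; rewrite n (negbTE n) orbF => ->.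
Qed.

(** The tie equates the value of the branch at [y] with that of the branch at [c], hence also their
    leaf depths. The parity of [n] then comes from [ld_parity], applied between [y] and the
    neighbour of the root towards [b]. *)
Lemma root_tie_depth b y c n : b != x0 -> (1 < deg b)%N -> Ge x0 b -> Ge b x0 ->
  edge b y -> ~~ br b y x0 -> edge x0 c -> c != nx x0 b -> ld n x0 c ->
  (forall k, ld k b y -> k = n) /\
  (Ge (nx x0 b) y -> ~~ odd n) /\ (Ge y (nx x0 b) -> odd n).
Proof.
move=> bx db g1 g2 eby byx xc cn hn.
have xb : x0 != b by rewrite eq_sym.
have cb : ~~ br x0 c b by rewrite br_nxE // bx eq_sym.
have rE : r b y = r x0 c.
  apply/eqP; rewrite eq_le (vge_away Gt g1 xc cb eby byx xb).
  exact: (vge_away Gt g2 eby byx xc cb bx).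
have kE k : ld k b y -> k = n.
  move=> hk; exact: (ld_eq eby xc (dis_nbr Gt bx eby xc byx cb) rE hk hn).
split=> //; set x := nx x0 b.
have x0x : edge x0 x := nx_edge Gt bx; have hxb : br x0 x b := nx_br Gt bx.
have xx0 : edge x x0 by rewrite edge_sym.
have hn1 : ld n.+1 x x0 := ldS xc cn hn.
have yx : y != x.
  apply: contraNneq byx => yE.
  have [bE|bn] := eqVneq b x; first by move: eby; rewrite yE bE edge_irr.
  case: (br_dec x0x hxb bn) => z /andP[xz zx0] hz.
  rewrite yE in eby *; have zb : z = b.
    by apply: (br_nbr Gt xz _ hz); rewrite edge_sym.
  by apply: br_step (br_refl _ _) _ _ _; rewrite // 1?eq_sym //; apply: edge_neq.
have bx' : br y b x0.
  by rewrite br_cut ?byx // edge_sym.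
have hxy : br x0 x y.
  apply: br_step hxb eby bx _; apply: contraNneq byx => ->; exact: br_refl.
have yx0 : y != x0 by apply: contraTneq hxy => ->; rewrite br_self.
have xx0y : ~~ br x x0 y by rewrite br_cut // negbK.
have dx : (1 < deg x)%N by apply: (br_deg Gt x0x hxb).
have yb : edge y b by rewrite edge_sym.
have ybx : br y b x.
  by apply: br_step bx' x0x _ _; rewrite eq_sym.
split=> [g|g].
  case: n kE hn hn1 => [//|k] kE hn hn1.
  case: (ld_ex Gt eby) => k1 h1; have E := kE _ h1; rewrite E in h1.
  case/existsP: h1 => z /and3P[yz zb hz].
  have yzx : ~~ br y z x by rewrite br_nxE // eq_sym yx (br_nx Gt yb ybx) eq_sym.
  have xy : x != y by rewrite eq_sym.
  have r1 := vge_away Gt g xx0 xx0y yz yzx xy.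
  have [a1 _] := ld_parity yz xx0 (dis_nbr Gt yx yz xx0 yzx xx0y) r1 hz hn1.
  by rewrite /= negbK; apply: a1; rewrite ltnW.
have dy : (1 < deg y)%N.
  by move: g; rewrite /vge => /orP[/eqP E|/andP[]//]; rewrite E in dx.
case: (ld_ex Gt eby) => k1 h1; have E := kE _ h1; rewrite E in h1.
case: (ld_nonleaf eby dy h1) => k [z [nE yz zb hz]].
have yzx : ~~ br y z x by rewrite br_nxE // eq_sym yx (br_nx Gt yb ybx) eq_sym.
have r1 := vge_away Gt g yz yzx xx0 xx0y yx.
have [_ a2] := ld_parity xx0 yz (dis_sym (dis_nbr Gt yx yz xx0 yzx xx0y)) r1 hn1 hz.
by rewrite nE /=; apply: a2; rewrite nE ltnW.
Qed.

Definition root_tie b y :=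
  [&& b != x0, (1 < deg b)%N, Ge x0 b, Ge b x0, edge b y & ~~ br b y x0].

Lemma tied_depth b y c k n : root_tie b y -> edge x0 c -> c != nx x0 b ->
  ld n x0 c -> ld k b y -> k = n.
Proof.
case/and5P=> h1 h2 h3 h4 /andP[h5 h6] h7 h8 h9.
by case: (root_tie_depth h1 h2 h3 h4 h5 h6 h7 h8 h9) => h _; apply: h.
Qed.

(** With ties in two directions, the root branch towards one of them faces away from the other and
    contains the leaf below the first at a strictly larger depth. Each of the two leaf depths would
    be smaller than the other. *)
Lemma tied_same_side b y b' y' : root_tie b y -> root_tie b' y' ->
  nx x0 b = nx x0 b'.
Proof.
suff K b1 y1 b2 y2 k1 k2 : root_tie b1 y1 -> root_tie b2 y2 ->
    nx x0 b2 != nx x0 b1 -> ld k1 b1 y1 -> ld k2 b2 y2 -> (k2 < k1)%N.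
  move=> t t'; apply/eqP; apply: contraT => n.
  have /and5P[_ _ _ _ /andP[e1 _]] := t; have /and5P[_ _ _ _ /andP[e2 _]] := t'.
  case: (ld_ex Gt e1) => k1 h1; case: (ld_ex Gt e2) => k2 h2.
  have l1 := K _ _ _ _ _ _ t' t n h2 h1; rewrite eq_sym in n.
  by have := ltn_trans l1 (K _ _ _ _ _ _ t t' n h1 h2); rewrite ltnn.
move=> t1 t2 n h1 h2; have /and5P[bx db g1 g2 /andP[e nr]] := t2.
have x0c := nx_edge Gt bx.
have hy : br x0 (nx x0 b2) y2.
  apply: br_step (nx_br Gt bx) e bx _; apply: contraNneq nr => ->; exact: br_refl.
case: (ld_up Gt x0c e hy nr h2) => m [hm m0 _].
rewrite (tied_depth t1 x0c n hm h1) -[ltnLHS]addn0 ltn_add2l lt0n.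
by apply/eqP => /m0[E _]; rewrite E eqxx in bx.
Qed.

(** All ties lie on one side of the root, so a single leaf depth [n], taken in a root branch facing
    away from them, decides every comparison by its parity. *)
Lemma root_tie_consistent b y b' y' : root_tie b y -> root_tie b' y' ->
  Ge (nx x0 b) y -> Ge y' (nx x0 b') -> False.
Proof.
move=> t t' g g'; have E := tied_same_side t t'.
have /and5P[bx db g1 g2 /andP[e nr]] := t.
have /and5P[bx' db' g1' g2' /andP[e' nr']] := t'.
case/(deg_gt1P (nx_edge Gt bx)): (dx0) => c xc cn.
have cn' := cn; rewrite E in cn'.
case: (ld_ex Gt xc) => n hn.
case: (root_tie_depth bx db g1 g2 e nr xc cn hn) => _ [/(_ g) h _].
case: (root_tie_depth bx' db' g1' g2' e' nr' xc cn' hn) => _ [_ /(_ g')].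
by rewrite (negbTE h).
Qed.

(* The root is moved below the vertices tied with it exactly when it has a
   child above some child of such a vertex. *)
Definition root_low :=
  [exists b, exists y, root_tie b y && Ge (nx x0 b) y].

(** Other non-leaf vertices get odd values, and the root gets the even value just before or just
    after the vertices tied with it. As ranks are at most [#|G|], the value of the leaves exceeds
    all of these. *)
Definition kap x : nat :=
  if deg x == 1%N then (#|G|.*2 + 5)%N
  else if x == x0 then ((rank x).*2 + (if root_low then 2 else 0))%N
  else (rank x).*2.+1.

Lemma rank_max x : (rank x <= #|G|)%N. Proof. exact: max_card. Qed.

Lemma kap_leaf x : deg x = 1%N -> kap x = (#|G|.*2 + 5)%N.
Proof. by rewrite /kap => ->. Qed.

Lemma kap_nonleaf x : (1 < deg x)%N ->
  kap x = if x == x0 then ((rank x).*2 + (if root_low then 2 else 0))%N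
          else (rank x).*2.+1.
Proof. by rewrite /kap; case: (deg x) => [|[]]. Qed.

Lemma kap_bound x : (1 < deg x)%N -> (kap x < #|G|.*2 + 5)%N.
Proof.
move=> dx; rewrite kap_nonleaf //; have := rank_max x.
by case: ifP => _; [case: root_low|]; lia.
Qed.

Lemma kap_root x : kap x = kap x0 -> x = x0.
Proof.
move=> E; apply/eqP; apply: contraT => xx.
have [dx|dx] := eqVneq (deg x) 1%N.
  by have := kap_bound dx0; rewrite -E kap_leaf // ltnn.
have dx' : (1 < deg x)%N by rewrite (deg_gt1_neq1 Gt (edge_par Gt xx)).
move/(congr1 odd): E; rewrite !kap_nonleaf // (negbTE xx) eqxx /=.
by rewrite oddD !odd_double; case: root_low.
Qed.

Lemma root_deg_gt0 x : (0 < deg x)%N.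
Proof.
have [->|xx] := eqVneq x x0; first exact: leq_trans dx0.
exact: (deg_edge_gt0 Gt (edge_par Gt xx)).
Qed.

Lemma deg_cases x : deg x = 1%N \/ (1 < deg x)%N.
Proof. by have := root_deg_gt0 x; case: (deg x) => [|[|n]] //; [left|right]. Qed.

Lemma kap_lt a b : (1 < deg a)%N -> (1 < deg b)%N -> a != b -> ~~ Ge a b ->
  (kap b < kap a)%N.
Proof.
move=> da db ab n; have ba : b != a by rewrite eq_sym.
have := Ge_total da db ab; rewrite (negbTE n) /= => g.
have lt : (rank b < rank a)%N by apply: rank_lt => //; apply/and3P.
rewrite !kap_nonleaf //.
have [ax|ax] := eqVneq a x0; have [bx|bx] := eqVneq b x0.
- by rewrite ax bx eqxx in ab.
- by case: root_low; lia.
- by case: root_low; lia.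
- by lia.
Qed.

Lemma kap_deg x y : (kap x <= kap y)%N -> (deg y <= deg x)%N.
Proof.
case: (deg_cases y) => [->|dy]; first by rewrite root_deg_gt0.
case: (deg_cases x) => [dx|dx].
  by rewrite (kap_leaf dx) leqNgt kap_bound.
have [->//|xy] := eqVneq x y; move=> le.
have : Ge x y.
  apply: contraT => n; have := kap_lt dx dy xy n.
  by rewrite ltnNge le.
by rewrite /vge => /orP[/eqP E|/andP[_ /xgeP[]]//]; rewrite E in dy.
Qed.

Lemma kap_Ge x y : x != x0 -> y != x0 -> (kap x < kap y)%N ->
  [/\ (1 < deg x)%N, Ge x y & ~~ Ge y x].
Proof.
move=> xx yx; case: (deg_cases x) => [dx|dx].
  rewrite (kap_leaf dx); case: (deg_cases y) => [dy|dy].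
    by rewrite (kap_leaf dy) ltnn.
  by rewrite ltnNge ltnW // kap_bound.
case: (deg_cases y) => [dy|dy] lt.
  by split=> //; rewrite /vge dy //; case: (deg x) dx => [|[]].
move: lt; rewrite !kap_nonleaf // (negbTE xx) (negbTE yx) ltnS ltn_double.
by case/(rank_ltP dx dy)/andP.
Qed.

Lemma kap_tied b : b != x0 -> (1 < deg b)%N -> Ge x0 b -> Ge b x0 ->
  rank b = rank x0.
Proof.
move=> bx db g1 g2; have xb : x0 != b by rewrite eq_sym.
by apply/eqP; rewrite eqn_leq !rank_le.
Qed.

Lemma par_nx x y : anc x y -> par x = x0 -> nx x0 y = x.
Proof.
move=> h E; have := edge_par Gt (anc_neq h); case/andP: h => _; rewrite E => h e.
exact: br_nx.
Qed.

(** If the parents fail to compare strictly and [x], [y] are nested, then the parents are nested and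
    tied, so one of them is the root and [root_low] was chosen to separate them. If [x], [y] are not
    nested, domination between the parents would bound the branch values the wrong way. *)
Lemma kap_antitone x y : x != x0 -> y != x0 -> (kap x < kap y)%N ->
  par x = par y \/ (kap (par y) < kap (par x))%N.
Proof.
move=> xx yx lt; case: (kap_Ge xx yx lt) => dx g n.
have [->|ab] := eqVneq (par x) (par y); [by left|right].
have da := par_nonleaf xx; have db := par_nonleaf yx.
case: (boolP (Ge (par x) (par y))) => [gab|]; last exact: kap_lt.
have ex := edge_par Gt xx; have ey := edge_par Gt yx.
have xy : x != y by apply: contraTneq lt => ->; rewrite ltnn.
have yx' : y != x by rewrite eq_sym.
case: (boolP (anc x y)) => [axy|axy].
  have [/(_ g) gba _] := anc_antitone axy xy.
  have axb := anc_parent Gt axy xy.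
  have [aE|ax] := eqVneq (par x) x0; last first.
    have aab : anc (par x) (par y).
      by apply: (anc_trans Gt _ axb); rewrite (anc_par Gt _ xx) anc_refl // orbT.
    by case: (anc_not_tied aab ab gab gba).
  have bx : par y != x0 by move: ab; rewrite aE eq_sym.
  rewrite aE in gab gba *.
  have nE := par_nx axb aE.
  have low : root_low.
    apply/existsP; exists (par y); apply/existsP; exists y.
    rewrite /root_tie bx db gab gba ey nE g.
    by rewrite br_cut // negbK br_par.
  by rewrite !kap_nonleaf // (negbTE bx) eqxx low (kap_tied bx db gab gba) addn2.
case: (boolP (anc y x)) => [ayx|ayx].
  have [_ /(_ g) gba] := anc_antitone ayx yx'.
  have aya := anc_parent Gt ayx yx'.
  have [bE|bx] := eqVneq (par y) x0; last first.
    have aba : anc (par y) (par x).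
      by apply: (anc_trans Gt _ aya); rewrite (anc_par Gt _ yx) anc_refl // orbT.
    have ba : par y != par x by rewrite eq_sym.
    by case: (anc_not_tied aba ba gba gab).
  have ax : par x != x0 by move: ab; rewrite bE.
  rewrite bE in gab gba *.
  have nE := par_nx aya bE.
  have t : root_tie (par x) x.
    by rewrite /root_tie ax da gab gba ex br_cut // negbK br_par.
  have low : root_low = false.
    apply/negbTE/existsPn => b; apply/existsPn => z; apply/negP => /andP[t' g'].
    by apply: (root_tie_consistent t' t g'); rewrite nE.
  by rewrite !kap_nonleaf // (negbTE ax) eqxx low (kap_tied ax da gba gab) addn0.
have d := dis_anc Gt xx yx axy ayx.
have := vge_r (dis_sym d) ey ex; rewrite (negbTE n) => /esym/negbT.
rewrite (vge_away Gt gab) //.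
  apply/negP => h; have h' : anc x (par y) by rewrite /anc xx.
  by move: axy; rewrite anc_par // h' orbT.
apply/negP => h; have h' : anc y (par x) by rewrite /anc yx.
by move: ayx; rewrite anc_par // h' orbT.
Qed.

Lemma root_layout : layout x0 par (depth x0) kap.
Proof.
split=> //; first exact: edge_parE.
- by move=> x xx; rewrite (depth_par Gt xx).
- exact: kap_root.
- split; [exact: kap_deg|exact: kap_antitone].
Qed.

End Root.

Lemma decreasing_layout v0 : (1 < deg v0)%N ->
  exists r0 p dep kap, @layout G r0 p dep kap.
Proof.
case/central_vertex => x0 dx0 central.
exists x0, (par x0), (depth x0), (kap x0).
exact: root_layout.
Qed.

End Decreasing.

(** * Trees with antitone parents *)

Lemma count_uniq_split (T : eqType) (P : pred T) (s : seq T) x : uniq s -> x \in s ->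
  count P s = (P x + count (fun i => (i != x) && P i) s)%N.
Proof.
move=> us xs; rewrite (permP (perm_to_rem xs)) /= rem_filter // count_filter.
by congr (_ + _)%N; apply: eq_count => i /=; rewrite andbC.
Qed.

Lemma leq_in_count (T : eqType) (P Q : pred T) (s : seq T) :
  {in s, forall i, P i -> Q i} -> (count P s <= count Q s)%N.
Proof.
move=> PQ; rewrite (eq_in_count (a2 := fun x => P x && Q x)); last first.
  by move=> x xs /=; case: (boolP (P x)) => // /(PQ x xs) ->.
by apply: sub_count => x /andP[].
Qed.

Lemma count_sub_eq (T : eqType) (P Q : pred T) (s : seq T) :
  {in s, forall i, P i -> Q i} -> (count Q s <= count P s)%N ->
  {in s, forall i, Q i -> P i}.
Proof.
elim: s => [//|a s IH] PQ /= le i.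
have PQs : {in s, forall i, P i -> Q i} by move=> x xs; apply: PQ; rewrite inE xs orbT.
have sub : (count P s <= count Q s)%N.
  by apply: leq_in_count => x xs; apply: PQs.
have Pa := PQ a (mem_head _ _).
have le' : (count Q s <= count P s)%N.
  rewrite -(leq_add2l (P a)); apply: leq_trans le; rewrite leq_add2r.
  by case: (P a) Pa => // /(_ isT) ->.
rewrite inE => /predU1P[->|]; last exact: IH.
move=> Qa; apply: contraT => nPa; move: le; rewrite Qa (negbTE nPa) /= add0n add1n.
by move/leq_trans/(_ sub); rewrite ltnn.
Qed.

(** What remains of a [layout] once vertices are replaced by their positions. The value [q m] is
    arbitrary, so every clause on parents skips the root [m]. *)
Record antitone_tree (n : nat) (d : nat -> nat) (m : nat) (q : nat -> nat) : Prop :=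
  AntitoneTree {
    at_root : (m < n)%N;
    at_deg_root : (1 < d m)%N;
    at_parent : forall i, (i < n)%N -> i != m -> (q i < n)%N;
    at_antitone : forall i j, (i <= j)%N -> (j < n)%N -> i != m -> j != m -> (q j <= q i)%N;
    at_count : forall j, (j < n)%N ->
      count (fun i => (i != m) && (q i == j)) (iota 0 n) = (d j - (j != m))%N;
    at_acyclic : exists dep : nat -> nat,
      forall i, (i < n)%N -> i != m -> (dep (q i) < dep i)%N;
    at_deg : forall i j, (i <= j)%N -> (j < n)%N -> (d j <= d i)%N }.

Definition adj (m : nat) (q : nat -> nat) i j :=
  (i != m) && (q i == j) || (j != m) && (q j == i).

(** Once the root is fixed, the parents form a non-increasing list whose multiplicities are
    prescribed by the degrees. *)
Lemma same_root_parents n d m q1 q2 :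
  (forall i, (i < n)%N -> i != m -> (q1 i < n)%N) ->
  (forall i, (i < n)%N -> i != m -> (q2 i < n)%N) ->
  (forall i j, (i <= j)%N -> (j < n)%N -> i != m -> j != m -> (q1 j <= q1 i)%N) ->
  (forall i j, (i <= j)%N -> (j < n)%N -> i != m -> j != m -> (q2 j <= q2 i)%N) ->
  (forall j, (j < n)%N ->
    count (fun i => (i != m) && (q1 i == j)) (iota 0 n) = (d j - (j != m))%N) ->
  (forall j, (j < n)%N ->
    count (fun i => (i != m) && (q2 i == j)) (iota 0 n) = (d j - (j != m))%N) ->
  forall i, (i < n)%N -> i != m -> q1 i = q2 i.
Proof.
move=> p1 p2 a1 a2 c1 c2 i iN im.
pose s := [seq i <- iota 0 n | i != m].
have sP x : x \in s = (x < n)%N && (x != m) by rewrite mem_filter mem_iota add0n andbC.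
have ss (q : nat -> nat) :
    (forall i j, (i <= j)%N -> (j < n)%N -> i != m -> j != m -> (q j <= q i)%N) ->
    sorted geq [seq q i | i <- s].
  move=> anti; apply: (homo_sorted_in (e := ltn) (P := mem s)).
  - move=> x y; rewrite !sP => /andP[xn xm] /andP[yn ym] xy.
    by apply: anti => //; apply: ltnW.
  - by apply/allP.
  - by apply: sorted_filter; [exact: ltn_trans|exact: iota_ltn_sorted].
have E : [seq q1 i | i <- s] = [seq q2 i | i <- s].
  apply: (sorted_eq (leT := geq)) => //; [ | |exact: ss|exact: ss|].
  - by move=> a b c h1 h2; apply: leq_trans h2 h1.
  - by move=> a b; rewrite /geq -eqn_leq eq_sym => /eqP.
  apply/allP => j _ /=; rewrite !count_map !count_filter.
  have eqc (q : nat -> nat) : count (predI (preim q (pred1 j)) (fun i => i != m)) (iota 0 n)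
      = count (fun i => (i != m) && (q i == j)) (iota 0 n).
    by apply: eq_count => x /=; rewrite andbC.
  rewrite !eqc; have [jn|jn] := ltnP j n; first by rewrite c1 // c2.
  have z (q : nat -> nat) : (forall i, (i < n)%N -> i != m -> (q i < n)%N) ->
      count (fun i => (i != m) && (q i == j)) (iota 0 n) = 0%N.
    move=> pq; apply/eqP; rewrite -leqn0 leqNgt -has_count; apply/hasPn => x.
    rewrite mem_iota add0n /= => xn; apply/negP => /andP[xm /eqP qx].
    by have := pq x xn xm; rewrite qx ltnNge jn.
  by rewrite !z.
have iS : i \in s by rewrite sP iN.
have iX : (index i s < size s)%N by rewrite index_mem.
have := congr1 (fun t => nth 0%N t (index i s)) E.
by rewrite /= !(nth_map 0%N) // nth_index.
Qed.

Section OneTree.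
Variables (n : nat) (d : nat -> nat) (m : nat) (q : nat -> nat).
Hypothesis A : antitone_tree n d m q.

Lemma at_child j : (j < n)%N -> (1 < d j)%N -> exists c, [/\ (c < n)%N, c != m & q c = j].
Proof.
move=> jn dj; have : (0 < count (fun i => (i != m) && (q i == j)) (iota 0 n))%N.
  by rewrite (at_count A jn); case: (d j) dj => [|[]] // k _; case: (j != m).
rewrite -has_count => /hasP[c]; rewrite mem_iota add0n => /= cn /andP[cm /eqP qc].
by exists c.
Qed.

Lemma at_parent_deg i : (i < n)%N -> i != m -> (1 < d (q i))%N.
Proof.
move=> iN im; have qn := at_parent A iN im.
have : (0 < count (fun k => (k != m) && (q k == q i)) (iota 0 n))%N.
  by rewrite -has_count; apply/hasP; exists i; rewrite ?mem_iota // im eqxx.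
rewrite (at_count A qn); case: eqP => [->|_] /=; first by rewrite (at_deg_root A).
by rewrite subn_gt0.
Qed.

Lemma at_no_fix i : (i < n)%N -> i != m -> q i != i.
Proof.
move=> iN im; case: (at_acyclic A) => dep h; apply/eqP => E.
by have := h i iN im; rewrite E ltnn.
Qed.

(* Both [k] and [k.+1] have children; antitonicity forces these to be [k.+1]
   and [k] themselves, which is a cycle. *)
Lemma at_no_crossing k : (k.+1 < n)%N -> k != m -> k.+1 != m -> (1 < d k.+1)%N ->
  (k < q k)%N -> (q k.+1 <= k)%N -> False.
Proof.
move=> kn km km1 dk1 h1 h2.
have kn' : (k < n)%N := ltnW kn.
have dk : (1 < d k)%N by apply: leq_trans dk1 (at_deg A (leqnSn k) kn).
case: (at_child kn' dk) => c [cn cm qc]; case: (at_child kn dk1) => c' [cn' cm' qc'].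
have E1 : q k.+1 = k.
  apply/eqP; rewrite eqn_leq h2 /=.
  have [ck|ck] := leqP c k; last by rewrite -[X in (X <= _)%N]qc (at_antitone A).
  by move: (leq_trans h1 (at_antitone A ck kn' cm km)); rewrite qc ltnn.
have E2 : q k = k.+1.
  apply/eqP; rewrite eqn_leq h1 andbT.
  have [ck|ck] := leqP c' k; first by rewrite -[X in (_ <= X)%N]qc' (at_antitone A).
  by move: (at_antitone A ck cn' km1 cm'); rewrite qc' E1 ltnn.
case: (at_acyclic A) => dep h; have := h k kn' km; have := h k.+1 kn km1.
by rewrite E1 E2 => h3 h4; move: (ltn_trans h3 h4); rewrite ltnn.
Qed.

(** By [at_no_crossing], [j < q j] propagates from 0 up to the position just before the root;
    antitonicity carries the resulting bound back to all earlier positions. *)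
Lemma at_above i : (i < m)%N -> (m <= q i)%N.
Proof.
have mn := at_root A.
have K j : (j < m)%N -> (j < q j)%N.
  elim: j => [|j IH] jm.
    have j0 : 0%N != m by rewrite ltn_eqF.
    by rewrite lt0n; apply: at_no_fix => //; apply: leq_trans mn.
  have jn := ltn_trans jm mn; have jm' := ltnW jm.
  have nj : j != m by rewrite ltn_eqF.
  have nj1 : j.+1 != m by rewrite ltn_eqF.
  rewrite ltnNge leq_eqVlt negb_or at_no_fix //= -ltnNge.
  rewrite ltnNge; apply/negP => h.
  apply: (at_no_crossing jn nj nj1 _ (IH jm') h).
  exact: leq_trans (at_deg_root A) (at_deg A jm' mn).
move=> im; case: m im mn K (A) => // m' im mn K A'.
apply: leq_trans (K m' (ltnSn m')) _.
by apply: (at_antitone A') => //; rewrite ?ltn_eqF // ltnW.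
Qed.

(** The mirror image of [at_above], by descending induction. A position followed only by leaves
    needs a separate argument: leaves are not parents. *)
Lemma at_below i : (m < i < n)%N -> (q i <= m)%N.
Proof.
have K k j : (j + k).+1 = n -> (m < j)%N -> (1 < d j)%N -> (q j < j)%N.
  elim: k j => [|k IH] j jk mj dj.
    have jn : (j < n)%N by rewrite -jk addn0.
    have jm : j != m by rewrite gtn_eqF.
    have := at_parent A jn jm; rewrite -jk addn0 ltnS leq_eqVlt.
    by rewrite (negbTE (at_no_fix jn jm)).
  have jn : (j < n)%N by rewrite -jk ltnS leq_addr.
  have j1n : (j.+1 < n)%N by rewrite -jk addnS !ltnS leq_addr.
  have jm : j != m by rewrite gtn_eqF.
  have jm1 : j.+1 != m by rewrite gtn_eqF // ltnW.
  have := at_no_fix jn jm; rewrite neq_ltn => /orP[//|h].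
  have [dj1|dj1] := ltnP 1 (d j.+1).
    have h2 : (q j.+1 <= j)%N.
      by rewrite -ltnS; apply: IH => //; [rewrite addSn -addnS|apply: ltnW].
    by case: (at_no_crossing j1n jm jm1 dj1 h h2).
  have qn := at_parent A jn jm; have := at_parent_deg jn jm.
  by rewrite ltnNge (leq_trans (at_deg A h qn) dj1).
case/andP=> mi iN; have im : i != m by rewrite gtn_eqF.
have m1n : (m.+1 < n)%N := leq_ltn_trans mi iN.
have m1m : m.+1 != m by rewrite gtn_eqF.
have [dm1|dm1] := ltnP 1 (d m.+1).
  apply: leq_trans (at_antitone A mi iN m1m im) _.
  rewrite -ltnS; apply: (K (n - m.+2)%N) => //.
  by rewrite -addSn subnKC.
rewrite leqNgt; apply/negP => h; have := at_parent_deg iN im.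
by rewrite ltnNge (leq_trans (at_deg A h (at_parent A iN im)) dm1).
Qed.

Lemma at_count_ge a : count (fun i => (i != m) && (a <= q i)%N) (iota 0 n) =
  \sum_(a <= j < n) (d j - (j != m))%N.
Proof.
transitivity (\sum_(a <= j < n) \sum_(i <- iota 0 n) ((i != m) && (q i == j) : nat)).
  rewrite exchange_big /= -sum1_count [LHS]big_mkcond /=.
  rewrite !big_seq; apply: eq_bigr => i; rewrite mem_iota add0n => /= iN.
  case: (altP (i =P m)) => [_|im] /=; first by rewrite big1.
  have [aq|qa] := leqP a (q i); last first.
    rewrite big_nat_cond big1 // => j /andP[/andP[aj _] _].
    by rewrite ltn_eqF // (leq_trans qa).
  rewrite (bigD1_seq (q i)) ?iota_uniq ?mem_index_iota ?aq ?(at_parent A) //=.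
  rewrite eqxx big1 ?addn0 // => j jq.
  by rewrite eq_sym (negbTE jq).
apply: eq_big_nat => j /andP[_ jn].
rewrite -(at_count A jn) -sum1_count [RHS]big_mkcond /=; apply: eq_bigr => i _.
by case: (_ && _).
Qed.

End OneTree.

Lemma count_lt_iota n m : (m <= n)%N -> count (fun i => i < m)%N (iota 0 n) = m.
Proof.
move=> mn; rewrite -(subnKC mn) iotaD count_cat add0n.
rewrite (eq_in_count (a2 := predT)) ?count_predT ?size_iota; last first.
  by move=> i; rewrite mem_iota add0n.
rewrite (eq_in_count (a2 := pred0)) ?count_pred0 ?addn0 // => i.
by rewrite mem_iota => /andP[mi _]; apply/negbTE; rewrite -leqNgt.
Qed.

(** In the first tree the vertices with parent after [m1] number [S m1.+1] and all precede [m1]; in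
    the second all positions before [m2] have their parent at or after [m2], and there are
    [(S m2).+1] such vertices. So [m2 <= (S m2).+1 <= (S m1.+1).+1 <= m1.+1]. Hence [m2 = m1.+1],
    and both inclusions are equalities. *)
Lemma adj_lt n d m1 q1 m2 q2 : antitone_tree n d m1 q1 -> antitone_tree n d m2 q2 ->
  (m1 < m2)%N -> forall i j, (i < n)%N -> (j < n)%N -> adj m1 q1 i j = adj m2 q2 i j.
Proof.
move=> A1 A2 m12.
have m1n := at_root A1; have m2n := at_root A2.
pose S a := \sum_(a <= j < n) (d j - 1)%N.
have c1 : count (fun i => (i != m1) && (m1 < q1 i)%N) (iota 0 n) = S m1.+1.
  rewrite (at_count_ge A1); apply: eq_big_nat => j /andP[mj _].
  by rewrite gtn_eqF.
have c2 : count (fun i => (i != m2) && (m2 <= q2 i)%N) (iota 0 n) = (S m2).+1.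
  rewrite (at_count_ge A2) /S big_ltn // [in RHS]big_ltn // eqxx subn0.
  rewrite -addSn subn1 prednK ?(ltnW (at_deg_root A2)) //; congr (_ + _)%N.
  by apply: eq_big_nat => j /andP[mj _]; rewrite gtn_eqF.
have sub1 : {in iota 0 n, forall i, (i != m1) && (m1 < q1 i)%N -> (i < m1)%N}.
  move=> i; rewrite mem_iota add0n => /= iN /andP[im qi].
  rewrite ltn_neqAle im leqNgt; apply/negP => mi.
  by have := at_below A1 (i := i); rewrite mi iN leqNgt qi => /(_ isT).
have sub2 : {in iota 0 n, forall i, (i < m2)%N -> (i != m2) && (m2 <= q2 i)%N}.
  by move=> i _ im; rewrite ltn_eqF //= (at_above A2).
have l1 : (S m1.+1 <= m1)%N.
  rewrite -c1 -[leqRHS](count_lt_iota (ltnW m1n)).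
  exact: leq_in_count.
have l2 : (m2 <= (S m2).+1)%N.
  rewrite -c2 -[leqLHS](count_lt_iota (ltnW m2n)).
  exact: leq_in_count.
have l3 : (S m2 <= S m1.+1)%N.
  by rewrite /S (@big_cat_nat _ _ _ m2 m1.+1) //= ?leq_addl // ltnW.
have mE : m2 = m1.+1.
  apply/eqP; rewrite eqn_leq m12 andbT; apply: leq_trans l2 _.
  by rewrite ltnS (leq_trans l3).
have F1 i : (i < m1)%N -> (m1 < q1 i)%N.
  move=> im; have iN := ltn_trans im m1n.
  have le : (count (fun i => i < m1)%N (iota 0 n) <=
      count (fun i => (i != m1) && (m1 < q1 i)%N) (iota 0 n))%N.
    rewrite (count_lt_iota (ltnW m1n)) c1.
    by apply: leq_trans l3; rewrite -ltnS -mE.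
  have iI : i \in iota 0 n by rewrite mem_iota.
  by case/andP: (count_sub_eq sub1 le iI im).
have F2 i : (m2 < i < n)%N -> (q2 i < m2)%N.
  case/andP=> mi iN; rewrite ltnNge; apply/negP => h.
  have le : (count (fun i => (i != m2) && (m2 <= q2 i)%N) (iota 0 n) <=
      count (fun i => i < m2)%N (iota 0 n))%N.
    rewrite c2 (count_lt_iota (ltnW m2n)) [X in (_ <= X)%N]mE ltnS.
    exact: leq_trans l3 l1.
  have iI : i \in iota 0 n by rewrite mem_iota.
  have := count_sub_eq sub2 le iI; rewrite h gtn_eqF // => /(_ isT).
  by rewrite ltnNge (ltnW mi).
have m21 : m1 != m2 by rewrite ltn_eqF.
have q2m : q2 m1 = m2.
  apply/eqP; rewrite eqn_leq (at_above A2) // andbT.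
  case: (at_child A2 m2n (at_deg_root A2)) => c [cn cm qc].
  have cm2 : (c <= m1)%N.
    rewrite -ltnS -mE ltn_neqAle cm leqNgt; apply/negP => mc.
    by have := F2 c; rewrite mc cn qc ltnn => /(_ isT).
  by have := at_antitone A2 cm2 m1n cm m21; rewrite qc.
have q1m : q1 m2 = m1.
  apply/eqP; rewrite eqn_leq (at_below A1) ?m12 //=.
  case: (at_child A1 m1n (at_deg_root A1)) => c [cn cm qc].
  have cm2 : (m2 <= c)%N.
    rewrite mE ltn_neqAle eq_sym cm leqNgt; apply/negP => mc.
    by have := F1 c mc; rewrite qc ltnn.
  have m21' : m2 != m1 by rewrite eq_sym.
  by have := at_antitone A1 cm2 cn m21' cm; rewrite qc.
(* The first tree rerooted at [m2], by reversing the edge between the two roots; it is then compared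
   with the second through [same_root_parents]. *)
pose q1' i := if i == m1 then m2 else q1 i.
have qE i : (i < n)%N -> i != m2 -> q1' i = q2 i.
  apply: (@same_root_parents n d); [| exact: at_parent A2| |exact: at_antitone A2| |exact: at_count A2].
  - by move=> k kn km; rewrite /q1'; case: eqP => // /eqP; apply: (at_parent A1 kn).
  - move=> k l kl ln km lm; rewrite /q1'.
    have [lE|lm1] := eqVneq l m1.
      have [//|km1] := eqVneq k m1; rewrite mE; apply: F1.
      by rewrite ltn_neqAle km1 -lE.
    have [kE|km1] := eqVneq k m1; last exact: (at_antitone A1).
    apply: leq_trans (ltnW m12); apply: (at_below A1).
    by rewrite ln andbT ltn_neqAle eq_sym lm1 -kE.
  - move=> j jn; have := at_count A1 jn.
    rewrite (count_uniq_split _ (iota_uniq 0 n) (x := m2)) ?mem_iota // => E1.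
    rewrite (count_uniq_split _ (iota_uniq 0 n) (x := m1)) ?mem_iota //.
    pose C := count (fun i => [&& i != m1, i != m2 & q1 i == j]) (iota 0 n).
    have {}E1 : ((m1 == j) + C = d j - (j != m1))%N.
      rewrite -E1 q1m [m2 == m1]eq_sym m21 /=; congr (_ + _)%N; apply: eq_count => k /=.
      by rewrite andbCA.
    have -> : count (fun i => (i != m1) && ((i != m2) && (q1' i == j))) (iota 0 n) = C.
      by apply: eq_count => k /=; rewrite /q1'; case: (k =P m1).
    rewrite /q1' eqxx m21 /=; move: E1.
    rewrite ![_ == j]eq_sym.
    have d1 := at_deg_root A1; have d2 := at_deg_root A2.
    have [jE|j1] := eqVneq j m1.
      by rewrite jE (negbTE m21) /= add0n subn0 add1n => <-; rewrite subn1.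
    have [jE|j2] //= := eqVneq j m2.
    by rewrite add0n jE subn0 => ->; rewrite subn1 add1n prednK // ltnW.
have adjC m q i j : adj m q i j = adj m q j i by rewrite /adj orbC.
have out i j : (i < n)%N -> i != m1 -> i != m2 -> (i != m1) && (q1 i == j) = (i != m2) && (q2 i == j).
  by move=> iN i1 i2; rewrite i1 i2 -qE // /q1' (negbTE i1).
have K1 j : (j < n)%N -> adj m1 q1 m1 j = adj m2 q2 m1 j.
  move=> jn; rewrite /adj eqxx m21 /= q2m.
  have [->|j1] := eqVneq j m1; first by rewrite q2m m21 /= ![m2 == _]eq_sym (negbTE m21).
  have [->|j2] := eqVneq j m2; first by rewrite q1m !eqxx.
  by rewrite /= -(qE j) // /q1' (negbTE j1).
have K2 j : (j < n)%N -> j != m1 -> adj m1 q1 m2 j = adj m2 q2 m2 j.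
  move=> jn j1; rewrite /adj eqxx [m2 == m1]eq_sym m21 j1 /= q1m [m1 == j]eq_sym (negbTE j1) /=.
  have [->|j2] := eqVneq j m2; first by rewrite q1m (negbTE m21).
  by rewrite -(qE j) // /q1' (negbTE j1).
move=> i j iN jN.
have [->|i1] := eqVneq i m1; first exact: K1.
have [->|j1] := eqVneq j m1; first by rewrite adjC K1 // adjC.
have [->|i2] := eqVneq i m2; first exact: K2.
have [->|j2] := eqVneq j m2; first by rewrite adjC K2 // adjC.
by rewrite /adj !out.
Qed.

Lemma adj_unique n d m1 q1 m2 q2 : antitone_tree n d m1 q1 -> antitone_tree n d m2 q2 ->
  forall i j, (i < n)%N -> (j < n)%N -> adj m1 q1 i j = adj m2 q2 i j.
Proof.
move=> A1 A2 i j iN jN; case: (ltngtP m1 m2) => m12.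
- exact: adj_lt A1 A2 m12 i j iN jN.
- by rewrite (adj_lt A2 A1 m12 iN jN).
- rewrite m12 in A1 *.
  have E := same_root_parents (at_parent A1) (at_parent A2) (at_antitone A1)
    (at_antitone A2) (at_count A1) (at_count A2).
  rewrite /adj; have [iE|im] := eqVneq i m2; have [jE|jm] := eqVneq j m2 => //=.
  - by rewrite E.
  - by rewrite E.
  - by rewrite !E.
Qed.

(** Ties of [kap] are broken by the reversed order of the parents, the case [b = false] of
    [refineP], which keeps the parent antitone. *)
Lemma layout_antitone (G : graph) (r0 : G) p dep kap (D : seq nat) :
  layout r0 p dep kap -> degree_sequence G D ->
  exists lt : rel G, [/\ strict_total lt,
    antitone_tree #|G| (nth 0%N D) (pos lt r0) (pidx r0 p lt)
    & forall x y, edge x y = adj (pos lt r0) (pidx r0 p lt) (pos lt x) (pos lt y)].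
Proof.
case=> dr ep dp kr [kd ka] DG.
pose key (x y : G) := (enum_rank x < enum_rank y)%N.
have keyt : strict_total key.
  apply: (@strict_total_inj G (fun x => enum_rank x)) => x y h.
  exact: enum_rank_inj (val_inj h).
have [lt ltt ltE] := refineP (p := p) false dp kr keyt.
have {}ltE x y : lt x y = (kap x < kap y)%N ||
    (kap x == kap y) && (lt (p y) (p x) || (p x == p y) && key x y) by rewrite ltE.
have ltd x y : lt x y -> (deg y <= deg x)%N.
  by rewrite ltE => /orP[/ltnW/kd//|/andP[/eqP E _]]; apply: kd; rewrite E.
have lta x y : x != r0 -> y != r0 -> lt x y -> p x = p y \/ lt (p y) (p x).
  move=> xr yr; rewrite ltE => /orP[/(ka _ _ xr yr)[->|h]|]; first by left.
    by right; rewrite ltE h.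
  by case/andP=> _ /orP[->|/andP[/eqP-> _]]; [right|left].
have [sD nD] := nth_degree_sequence r0 ltt ltd DG.
have atr i : (i < #|G|)%N -> (at_pos lt r0 i == r0) = (i == pos lt r0).
  by move=> iG; rewrite -(inj_eq (pos_inj ltt)) pos_atK.
exists lt; split=> //; last first.
  move=> x y; rewrite -[in LHS](at_posK ltt r0 x) -[in LHS](at_posK ltt r0 y).
  by rewrite (edge_pidx ep ltt) ?pos_ltn.
split.
- exact: pos_ltn.
- by rewrite nD ?pos_ltn // at_posK.
- by move=> i _ _; apply: pos_ltn.
- move=> i j; rewrite leq_eqVlt => /predU1P[->//|ij] jG im jm.
  have iG := ltn_trans ij jG.
  have := lta (at_pos lt r0 i) (at_pos lt r0 j); rewrite !atr // pos_lt // !pos_atK //.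
  by case=> // [E|/(lt_pos ltt)/ltnW//]; rewrite /pidx E.
- by move=> j jG; rewrite (count_pidx ep dp ltt) // nD.
- exists (fun i => dep (at_pos lt r0 i)) => i iG im.
  by rewrite /pidx at_posK //; apply: dp; rewrite atr.
- move=> i j; rewrite leq_eqVlt => /predU1P[->//|ij] jG.
  have iG := ltn_trans ij jG.
  by rewrite !nD //; apply: ltd; rewrite pos_lt // !pos_atK.
Qed.

(** Vertices are matched by position. The two roots may have different positions, since [adj_unique]
    compares only edges. *)
Lemma layout_iso (G H : graph) (r : G) p dep kap (r' : H) p' dep' kap' (D : seq nat) :
  layout r p dep kap -> layout r' p' dep' kap' ->
  degree_sequence G D -> degree_sequence H D -> giso G H.
Proof.
move=> LG LH DG DH.
have [lt [ltt AG eG]] := layout_antitone LG DG.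
have [lt' [ltt' AH eH]] := layout_antitone LH DH.
have GH : #|G| = #|H|.
  have [_ /perm_size] := DG; have [_ /perm_size] := DH.
  by rewrite !size_image => <-.
have pG x : (pos lt x < #|H|)%N by rewrite -GH pos_ltn.
pose g x := at_pos lt' r' (pos lt x).
have pg x : pos lt' (g x) = pos lt x by rewrite pos_atK.
exists g.
  apply: inj_card_bij; last by rewrite GH.
  by move=> x y /(congr1 (pos lt')); rewrite !pg => /(pos_inj ltt).
move=> x y; rewrite eH eG !pg; rewrite -GH in AH.
by apply: (adj_unique AH AG); apply: pos_ltn.
Qed.

(** * M-trees *)

Section StarJoin.
Variables (k : nat) (e : 'I_k -> nat).

Definition star_join : rooted_graph := root_join (fun i => star (e i)).

Definition twig (i : 'I_k) : star_join := root_join_child (fun i => star (e i)) i.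

Definition tip (i : 'I_k) (j : 'I_(e i).-1) : star_join :=
  Some (Tagged (fun i => star (e i) : Type)
    (Some (Tagged (fun _ => bullet : Type) (i := j) tt) : star (e i))).

Variant star_join_spec : star_join -> Type :=
| StarJoinRoot : star_join_spec (rootv star_join)
| StarJoinTwig i : star_join_spec (twig i)
| StarJoinTip i j : star_join_spec (@tip i j).

Lemma star_joinP x : star_join_spec x.
Proof.
case: x => [[i [[j []]|]]|].
- exact: (StarJoinTip j).
- exact: StarJoinTwig.
- exact: StarJoinRoot.
Qed.

Definition star_join_par (x : star_join) : star_join :=
  match x with
  | Some (existT i (Some _)) => twig i
  | _ => rootv star_join
  end.

Definition star_join_dep (x : star_join) : nat :=
  match x with
  | Some (existT i (Some _)) => 2
  | Some (existT i None) => 1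
  | None => 0
  end.

Lemma twig_inj : injective twig.
Proof. by move=> i j [] /=. Qed.

Lemma tip_inj i : injective (@tip i).
Proof.
move=> j j' /eqP; rewrite /tip (inj_eq Some_inj) -tag_eqE /tag_eq /= eqxx tagged_asE.
by rewrite (inj_eq Some_inj) -tag_eqE /tag_eq /= => /andP[/eqP].
Qed.

Lemma twig_tip i i' (j : 'I_(e i').-1) : (twig i == tip j) = false.
Proof. by apply/eqP => /(congr1 star_join_dep). Qed.

Lemma star_join_edge x y : edge x y =
  (x != rootv star_join) && (star_join_par x == y) ||
  (y != rootv star_join) && (star_join_par y == x).
Proof.
case: (star_joinP x) => [|i|i j]; case: (star_joinP y) => [|i'|i' j'] //=.
- by case: (eqVneq i i') => [E|//]; subst i'; rewrite tagged_asE.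
- rewrite (inj_eq twig_inj) eq_sym; case: (eqVneq i' i) => [E|//]; subst i'.
  by rewrite tagged_asE /= eqxx.
- rewrite (inj_eq twig_inj) orbF; case: (eqVneq i i') => [E|//]; subst i'.
  by rewrite tagged_asE /= eqxx.
- rewrite !twig_tip; case: (eqVneq i i') => [E|//]; subst i'.
  by rewrite tagged_asE /= andbF.
Qed.

Lemma star_join_dep_par x : x != rootv star_join ->
  (star_join_dep (star_join_par x) < star_join_dep x)%N.
Proof. by case: (star_joinP x). Qed.

Lemma deg_star_join_root : deg (rootv star_join) = k.
Proof.
rewrite (deg_children star_join_edge star_join_dep_par) eqxx add0n.
rewrite -[RHS]card_ord -(card_codom twig_inj); apply: eq_card => y; rewrite !inE.
apply/andP/codomP => [[y0 /eqP yp]|[i ->]]; last by [].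
case: (star_joinP y) y0 yp => [|i|i j] //; by exists i.
Qed.

Lemma deg_twig i : deg (twig i) = (e i).-1.+1.
Proof.
rewrite (deg_children star_join_edge star_join_dep_par) add1n; congr S.
rewrite -[RHS]card_ord -(card_codom (@tip_inj i)); apply: eq_card => y; rewrite !inE.
apply/andP/codomP => [[y0 /eqP yp]|[j ->]]; last by [].
case: (star_joinP y) y0 yp => [|i'|i' j] // _ /twig_inj E; subst i'.
by exists j.
Qed.

Lemma deg_tip i (j : 'I_(e i).-1) : deg (tip j) = 1%N.
Proof.
rewrite (deg_children star_join_edge star_join_dep_par).
rewrite eq_card0 // => y; rewrite !inE; apply/negP => /andP[y0 /eqP yp].
by case: (star_joinP y) y0 yp => [|i'|i' j'] //= _ /eqP; rewrite twig_tip.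
Qed.
End StarJoin.

Lemma enum_ord_take k n : [seq val i | i <- take k (enum 'I_n)] = iota 0 (minn k n).
Proof. by rewrite map_take val_enum_ord take_iota. Qed.

Lemma mem_take_enum k n (i : 'I_n) : (i \in take k (enum 'I_n)) = (i < k)%N.
Proof.
rewrite -(mem_map val_inj) enum_ord_take mem_iota add0n /=.
by rewrite leq_min ltn_ord andbT.
Qed.

Lemma pairwise_rev_take k n :
  pairwise (fun i j : 'I_n => (j < i)%N) (rev (take k (enum 'I_n))).
Proof.
rewrite -sorted_pairwise; last by move=> a b c h1 h2; apply: ltn_trans h2 h1.
rewrite rev_sorted.
by have := iota_ltn_sorted 0 (minn k n); rewrite -enum_ord_take sorted_map.
Qed.

(* The invariant of the recursion: the vertex of rank [i] is the [i]-th
   non-leaf of [ds], and leaves get rank [size ds]. *)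
Record M_layout (ds : seq nat) (G : lgraph) (r0 : G) (p : G -> G) (dep kap : G -> nat) :=
  MLayout {
    ml_edge : forall x y, edge x y = (x != r0) && (p x == y) || (y != r0) && (p y == x);
    ml_dep : forall x, x != r0 -> (dep (p x) < dep x)%N;
    ml_max : forall x, (kap x <= size ds)%N;
    ml_deg : forall x, deg x = nth 1%N ds (kap x);
    ml_inj : forall x y, (kap x < size ds)%N -> kap x = kap y -> x = y;
    ml_surj : forall i, (i < size ds)%N -> exists x, kap x = i;
    ml_root : (kap r0 < size ds)%N;
    ml_anti : forall x y, x != r0 -> y != r0 -> (kap x < kap y)%N ->
      p x = p y \/ (kap (p y) < kap (p x))%N;
    ml_labels : forall x, x \in labels G -> (kap x < size ds)%N;
    ml_sorted : pairwise (fun x y => (kap y < kap x)%N) (labels G);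
    ml_leaves : forall v u, edge v u -> leaf u -> v \in labels G }.

Definition reduced (ds : seq nat) := sorted geq ds && all (leq 2) ds.

Section Base.
Variables (ds : seq nat).
Hypotheses (ds0 : ds != [::]) (dsr : reduced ds) (small : (size ds <= (last 0%N ds).+1)%N).
Let t := size ds.
Let dt := last 0%N ds.
Let e (i : 'I_dt) := nth 1%N (take t.-1 ds) i.
Let G := star_join e.

Let t0 : (0 < t)%N. Proof. by rewrite lt0n size_eq0. Qed.

Let ds_ge2 i : (i < t)%N -> (1 < nth 1%N ds i)%N.
Proof. by move=> it; case/andP: dsr => _ /allP; apply; apply: mem_nth. Qed.

Let dtE : dt = nth 1%N ds t.-1.
Proof. by rewrite nth_last /dt; case: ds ds0. Qed.

Let eE (i : 'I_dt) : (i < t.-1)%N -> e i = nth 1%N ds i.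
Proof. by move=> h; rewrite /e nth_take. Qed.

Let e1 (i : 'I_dt) : (i < t.-1)%N = false -> e i = 1%N.
Proof.
move=> /negbT; rewrite -leqNgt => h; rewrite /e nth_default // size_take_min.
exact: leq_trans (geq_minl _ _) h.
Qed.

(** The centre has the smallest degree in the list, hence the last rank [t.-1]. Children with
    [i >= t.-1] are the copies of [[1]], that is, leaves. *)
Definition base_kap (x : G) : nat :=
  match x with
  | None => t.-1
  | Some (existT i None) => if (i < t.-1)%N then (i : nat) else t
  | Some (existT i (Some _)) => t
  end.

Let tip_lt i (j : 'I_(e i).-1) : (i < t.-1)%N.
Proof. by case: ltnP => // h; case: j => j; rewrite e1 // ltnNge h. Qed.

Lemma base_layout :
  @M_layout ds (M_base ds) (rootv G) (@star_join_par _ e) (@star_join_dep _ e) base_kap.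
Proof.
have tt : (t.-1 < t)%N by rewrite prednK.
have lt_t (i : nat) : (i < t.-1)%N -> (i < t)%N by move=> h; apply: ltn_trans h tt.
split.
- exact: star_join_edge.
- exact: star_join_dep_par.
- move=> x; case: (star_joinP x) => [|i|i j] /=; first exact: ltnW.
    by case: ifP => // /lt_t/ltnW.
  exact: leqnn.
- move=> x; case: (star_joinP x) => [|i|i j] /=.
  + by rewrite deg_star_join_root -dtE.
  + rewrite (deg_twig e i); case: ifPn => h; last by rewrite e1 ?nth_default //; apply/negbTE.
    by rewrite eE // prednK // ltnW // ds_ge2 // lt_t.
  + by rewrite deg_tip nth_default.
- move=> x y; case: (star_joinP x) => [|i|i j]; case: (star_joinP y) => [|i'|i' j'] //=.
  + by case: ifP => [h _ E|_ _ E]; [rewrite -E ltnn in h|rewrite E ltnn in tt].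
  + by move=> _ E; rewrite E ltnn in tt.
  + by case: ifP => [h _ E|]; [rewrite E ltnn in h|rewrite ltnn].
  + case: ifP => [h _|]; last by rewrite ltnn.
    by case: ifP => [h' /val_inj->//|_ E]; move: (lt_t _ h); rewrite E ltnn.
  + by case: ifP => [h _ E|]; [move: (lt_t _ h); rewrite E ltnn|rewrite ltnn].
  + by rewrite ltnn.
  + by rewrite ltnn.
  + by rewrite ltnn.
- move=> i it; have [h|h] := ltnP i t.-1.
    have idt : (i < dt)%N.
      by apply: leq_trans h _; rewrite -ltnS prednK.
    by exists (twig e (Ordinal idt)); rewrite /= h.
  exists (rootv G) => /=; apply/eqP; rewrite eqn_leq h /=.
  by rewrite -ltnS prednK.
- exact: tt.
- move=> x y; case: (star_joinP x) => [|i|i j]; case: (star_joinP y) => [|i'|i' j'] //= _ _.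
  + by move=> _; left.
  + by move=> _; right; have h := tip_lt j'; rewrite h.
  + by rewrite ltnNge; case: ifP => [/lt_t/ltnW->//|_]; rewrite leqnn.
  + by rewrite ltnn.
- move=> x; rewrite inE => /orP[/eqP->//|/mapP[i]].
  by rewrite mem_rev mem_take_enum => h -> /=; rewrite h; apply: lt_t.
- rewrite -[labels _]/(rootv G :: [seq twig e i | i <- rev (take t.-1 (enum 'I_dt))]).
  rewrite pairwise_cons; apply/andP; split.
    apply/allP => x /mapP[i]; rewrite mem_rev mem_take_enum => h -> /=.
    by rewrite h.
  rewrite pairwise_map; apply: (@sub_in_pairwise _ [pred i : 'I_dt | i < t.-1]%N _ _ _ _ _ (pairwise_rev_take _ _)).
    by move=> i j; rewrite !inE => h h' /=; rewrite h h'.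
  by apply/allP => i; rewrite mem_rev mem_take_enum.
- move=> v u; rewrite inE.
  have twig_mem (i : 'I_dt) : (i < t.-1)%N ->
      twig e i \in [seq root_join_child (fun i => star (e i)) i | i <- rev (take t.-1 (enum 'I_dt))].
    by move=> h; apply: map_f; rewrite mem_rev mem_take_enum.
  rewrite star_join_edge /leaf.
  case: (star_joinP v) => [//|i|i j]; case: (star_joinP u) => [|i'|i' j'] //=.
  + move=> _ /eqP; rewrite (deg_star_join_root e) => E.
    by have := ds_ge2 tt; rewrite -dtE E.
  + by rewrite eq_sym (inj_eq (@twig_inj _ e)) => /eqP-> _; rewrite twig_mem ?tip_lt ?orbT.
  + rewrite (inj_eq (@twig_inj _ e)) orbF => /eqP <-; rewrite (deg_twig e i).
    have h := tip_lt j; rewrite eE // => /eqP E.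
    by have := ds_ge2 (lt_t _ h); case: (nth 1%N ds i) E => [|[|]].
  + by rewrite !twig_tip.
Qed.
End Base.

Section MLeaf.
Variables (ds : seq nat) (G : lgraph) (r0 : G) (p : G -> G) (dep kap : G -> nat).
Hypotheses (L : M_layout ds r0 p dep kap) (ds_ge2 : forall i, (i < size ds)%N -> (1 < nth 1%N ds i)%N).

Lemma ml_leafE x : leaf x = (kap x == size ds).
Proof.
rewrite /leaf (ml_deg L); have [E|n] := eqVneq (kap x) (size ds).
  by rewrite E nth_default.
by rewrite gtn_eqF // ds_ge2 // ltn_neqAle n (ml_max L).
Qed.

Lemma ml_leaf_root x : leaf x -> x != r0.
Proof.
rewrite ml_leafE; apply: contraTneq => ->.
by rewrite ltn_eqF // (ml_root L).
Qed.

Lemma ml_edge_par x : x != r0 -> edge (p x) x.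
Proof. by move=> xr; rewrite (ml_edge L) xr eqxx /= orbT. Qed.

Lemma ml_deg_par x : x != r0 -> (1 < deg (p x))%N.
Proof.
move=> xr; have [E|px] := eqVneq (p x) r0.
  by rewrite E (ml_deg L) ds_ge2 // (ml_root L).
rewrite (deg_children (ml_edge L) (ml_dep L)) px add1n ltnS.
by apply/card_gt0P; exists x; rewrite !inE xr eqxx.
Qed.

Lemma ml_kap_par x : x != r0 -> (kap (p x) < size ds)%N.
Proof.
move=> xr; rewrite ltn_neqAle (ml_max L) andbT; apply/negP => /eqP E.
by have := ml_deg_par xr; rewrite (ml_deg L) E nth_default.
Qed.

Lemma ml_leaf_nbr v w : edge v w -> leaf w -> w != r0 /\ v = p w.
Proof.
move=> vw lw; have wr := ml_leaf_root lw; split=> //.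
move: vw; rewrite (ml_edge L) => /orP[/andP[vr /eqP E]|/andP[_ /eqP->]//].
by have := ml_deg_par vr; rewrite E; move: lw; rewrite /leaf => /eqP ->.
Qed.

(** A vertex of maximal depth is a leaf, so the search succeeds. Labels are listed by decreasing
    rank, so the first one adjacent to a leaf has the largest rank among all such vertices. *)
Lemma M_leafP : exists u, [/\ M_leaf G = Some u, leaf u, u != r0
  & forall w, leaf w -> (kap (p w) <= kap (p u))%N].
Proof.
pose vm := [arg max_(v > r0) dep v].
have vmax x : (dep x <= dep vm)%N by rewrite /vm; case: arg_maxnP => // i _; apply.
have lvm : leaf vm.
  have c0 : #|[pred y | (y != r0) && (p y == vm)]| = 0%N.
    apply: eq_card0 => y; rewrite !inE; apply/negP => /andP[yr /eqP E].
    by have := ml_dep L yr; rewrite E ltnNge vmax.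
  have := ml_deg L r0; have := ds_ge2 (ml_root L) => h1 h2.
  have vr : vm != r0.
    apply: contraTneq h1 => E; rewrite -h2 -E (deg_children (ml_edge L) (ml_dep L)).
    by rewrite c0 E eqxx.
  by rewrite /leaf (deg_children (ml_edge L) (ml_dep L)) vr c0.
have adj w : leaf w -> p w \in [seq v <- labels G | [exists u : G, edge v u && leaf u]].
  move=> lw; have e := ml_edge_par (ml_leaf_root lw).
  rewrite mem_filter (ml_leaves L e lw) andbT.
  by apply/existsP; exists w; rewrite e.
rewrite /M_leaf; have := adj vm lvm.
have : pairwise (fun x y => (kap y < kap x)%N)
    [seq v <- labels G | [exists u : G, edge v u && leaf u]].
  exact: pairwise_filter (ml_sorted L).
case E: [seq v <- labels G | [exists u : G, edge v u && leaf u]] => [//|vs s] /=.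
case/andP=> /allP vsmax _ _.
have : vs \in [seq v <- labels G | [exists u : G, edge v u && leaf u]] by rewrite E mem_head.
rewrite mem_filter => /andP[/existsP[u0 hu0] _].
case: pickP => [u /andP[vu lu]|/(_ u0)]; last by rewrite hu0.
have [ur vE] := ml_leaf_nbr vu lu.
exists u; split=> // w /adj; rewrite E inE => /predU1P[->|/vsmax/ltnW]; by rewrite vE.
Qed.
End MLeaf.

Lemma pairwise_rev_enum n : pairwise (fun i j : 'I_n => (j < i)%N) (rev (enum 'I_n)).
Proof. by have := pairwise_rev_take n n; rewrite take_oversize // size_enum_ord. Qed.

Section Step.
Variables (ds ds' : seq nat) (k : nat) (G : lgraph) (r0 : G) (p : G -> G) (dep kap : G -> nat).
Hypotheses (L : M_layout ds' r0 p dep kap).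
Hypothesis ds_ge2 : forall i, (i < size ds)%N -> (1 < nth 1%N ds i)%N.
Hypothesis ds'_ge2 : forall i, (i < size ds')%N -> (1 < nth 1%N ds' i)%N.
Hypothesis sizeE : size ds = (size ds' + k).+1.
Hypothesis nthE : forall i, (i < size ds')%N -> nth 1%N ds (i + k) = nth 1%N ds' i.
Hypothesis lastE : nth 1%N ds (size ds' + k) = k.+1.
Variables (u : G) (lu : leaf u) (ur : u != r0).
Hypothesis umax : forall w, leaf w -> (kap (p w) <= kap (p u))%N.
Let e (i : 'I_k) := nth 1%N ds i.
Let A := star_join e.
Let t' := size ds'.

Definition step_graph : lgraph :=
  @LGraph (attach u A)
    ([seq attach_inl u A v | v <- labels G] ++
     [seq attach_inr u (root_join_child (fun i => star (e i)) i) | i <- rev (enum 'I_k)]).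

Definition step_par (x : step_graph) : step_graph :=
  match x with
  | inl v => inl (p v)
  | inr a => attach_inr u (star_join_par (val a))
  end.

Definition step_dep (x : step_graph) : nat :=
  match x with
  | inl v => dep v
  | inr a => (dep u + star_join_dep (val a))%N
  end.

Definition star_join_rank (a : A) : nat :=
  match a with
  | Some (existT i None) => i
  | _ => (t' + k).+1
  end.

(** [ds] consists of [k] new degrees, then [ds'], then [k.+1]. The new twigs take the first [k]
    ranks, the old non-leaves move up by [k], and the merged vertex, now of degree [k.+1], is the
    last non-leaf. *)
Definition step_kap (x : step_graph) : nat :=
  match x with
  | inl v => if v == u then (t' + k)%N else if (kap v < t')%N then (kap v + k)%N else (t' + k).+1
  | inr a => star_join_rank (val a)
  end.

Definition new_twig (i : 'I_k) : step_graph :=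
  inr (exist (fun a : A => a != rootv A) (twig e i) isT).
Definition new_tip (i : 'I_k) (j : 'I_(e i).-1) : step_graph :=
  inr (exist (fun a : A => a != rootv A) (tip j) isT).

Variant step_spec : step_graph -> Type :=
| StepOld v : v != u -> step_spec (inl v)
| StepMerged : step_spec (inl u)
| StepTwig i : step_spec (new_twig i)
| StepTip i j : step_spec (@new_tip i j).

Lemma stepP x : step_spec x.
Proof.
case: x => [v|[a an]].
  by have [->|vu] := eqVneq v u; constructor.
case: (star_joinP a) an => [|i|i j] an; first by [].
- by rewrite (bool_irrelevance an isT); apply: StepTwig.
- by rewrite (bool_irrelevance an isT); apply: StepTip.
Qed.

Lemma par_twig i : step_par (new_twig i) = inl u. Proof. by rewrite /= /attach_inr insubF. Qed.
Lemma par_tip i j : step_par (@new_tip i j) = new_twig i.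
Proof. by rewrite /= /attach_inr insubT. Qed.

Lemma twigE i : attach_inr u (root_join_child (fun i => star (e i)) i) = new_twig i.
Proof. by rewrite /attach_inr insubT. Qed.

Let kap_u : kap u = t'.
Proof. by apply/eqP; rewrite -(ml_leafE L ds'_ge2). Qed.

Let kap_r0 : (kap r0 < t')%N. Proof. exact: ml_root L. Qed.

Lemma kap_par_old v : v != r0 -> step_kap (inl (p v)) = (kap (p v) + k)%N.
Proof.
move=> vr; have h := ml_kap_par L ds'_ge2 vr; rewrite /= h ifN //.
by apply: contraTneq h => ->; rewrite kap_u ltnn.
Qed.

Lemma attach_inr_inl (c : A) (v : G) :
  (attach_inr u c == inl v) = (c == rootv A) && (u == v).
Proof.
rewrite /attach_inr; case: insubP => [b bn <-|]; first by rewrite (negbTE (valP b)).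
by rewrite negbK => ->.
Qed.

Lemma attach_inr_inr (c : A) b : (attach_inr u c == inr b) = (c == val b).
Proof.
rewrite /attach_inr; case: insubP => [d dn <-|]; first by rewrite (inj_eq val_inj).
rewrite negbK => /eqP ->; apply/esym/negbTE; rewrite eq_sym; exact: valP b.
Qed.

Lemma step_edge (x y : step_graph) : edge x y =
  (x != inl r0) && (step_par x == y) || (y != inl r0) && (step_par y == x).
Proof.
have E (b : {a : A | a != rootv A}) :
    edge (rootv A) (val b) = (star_join_par (val b) == rootv A).
  by rewrite star_join_edge eqxx /= (valP b).
have E' (b : {a : A | a != rootv A}) :
    edge (val b) (rootv A) = (star_join_par (val b) == rootv A).
  by rewrite star_join_edge eqxx /= (valP b) orbF.
case: x => [v|a]; case: y => [w|b].
- exact: (ml_edge L v w).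
- rewrite -[LHS]/((v == u) && edge (rootv A) (val b)) E.
  rewrite [step_par (inr b) == _]attach_inr_inl [_ == inr b](_ : _ = false) //.
  by rewrite andbF [u == v]eq_sym [_ && (v == u)]andbC.
- rewrite -[LHS]/((w == u) && edge (val a) (rootv A)) E'.
  rewrite [step_par (inr a) == _]attach_inr_inl [_ == inr a](_ : _ = false) //.
  by rewrite andbF orbF [u == w]eq_sym [_ && (w == u)]andbC.
- rewrite -[LHS]/(edge (val a) (val b)) star_join_edge (valP a) (valP b).
  by rewrite ![step_par _ == _]attach_inr_inr.
Qed.

Lemma step_dep_par x : x != inl r0 -> (step_dep (step_par x) < step_dep x)%N.
Proof.
case: x => [v vr|[a an] _] /=; first exact: (ml_dep L).
rewrite /attach_inr; case: insubP => [b bn bE|_] /=.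
  by rewrite bE ltn_add2l; apply: star_join_dep_par.
by rewrite -[ltnLHS]addn0 ltn_add2l; case: (star_joinP a) an.
Qed.

Lemma card_attach (P : pred (attach u A)) :
  #|P| = (#|[pred v | P (attach_inl u A v)]| + #|[pred a : A | (a != rootv A) && P (attach_inr u a)]|)%N.
Proof.
rewrite -[LHS]sum1_card big_sumType !sum1_card; congr (_ + _)%N.
rewrite -(card_image (@val_inj _ _ {a : A | a != rootv A})).
apply: eq_card => a; rewrite !inE; apply/mapP/andP => [[b]|[an Pa]].
  rewrite mem_enum => Pb ->; split; first exact: valP b.
  by rewrite /attach_inr valK.
exists (exist _ a an) => //; rewrite mem_enum; move: Pa.
by rewrite /attach_inr insubT.
Qed.

Lemma deg_old v : deg (inl v : step_graph) = (deg v + (v == u) * k)%N.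
Proof.
rewrite /deg card_attach; congr (_ + _)%N.
case: (eqVneq v u) => [->|vu]; last first.
  rewrite mul0n; apply: eq_card0 => a; rewrite !inE; apply/negP => /andP[an].
  by rewrite /attach_inr insubT //= (negbTE vu).
rewrite mul1n -[RHS](deg_star_join_root e); apply: eq_card => a; rewrite !inE.
have [->//|an] /= := eqVneq a (rootv A).
by rewrite /attach_inr insubT /= eqxx.
Qed.

Lemma deg_new b : deg (inr b : step_graph) = deg (val b).
Proof.
rewrite /deg card_attach.
have -> : #|[pred v | edge (inr b : step_graph) (attach_inl u A v)]| = edge (val b) (rootv A).
  case h: (edge (val b) (rootv A)); last first.
    by apply: eq_card0 => v; rewrite !inE -[LHS]/((v == u) && edge (val b) (rootv A)) h andbF.
  rewrite (eq_card (B := pred1 u)) ?card1 // => v.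
  by rewrite !inE -[LHS]/((v == u) && edge (val b) (rootv A)) h andbT.
rewrite [RHS](cardD1 (rootv A)) !inE; congr (_ + _)%N; apply: eq_card => a.
rewrite !inE; have [//|an] /= := eqVneq a (rootv A).
by rewrite /attach_inr insubT.
Qed.

(** The delicate clause is antitonicity. The twigs come first and hang at the last non-leaf; the
    tips come last and hang at the first ranks. The merged vertex now precedes every leaf, so its
    parent must have the largest rank among parents of leaves, which is [umax]. *)
Lemma step_layout : M_layout ds (G := step_graph) (inl r0) step_par step_dep step_kap.
Proof.
have kE : (t' + k < size ds)%N by rewrite sizeE.
have oldlt v : (kap v < t')%N -> (kap v + k < t' + k)%N by rewrite ltn_add2r.
have ilt (i : 'I_k) : (i < t' + k)%N by apply: leq_trans (ltn_ord i) (leq_addl _ _).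
have e_ge2 i : (1 < e i)%N by apply: ds_ge2; apply: ltn_trans (ilt i) kE.
have kap_v v : v != u -> step_kap (inl v) = if (kap v < t')%N then (kap v + k)%N else (t' + k).+1.
  by move=> vu; rewrite /= (negbTE vu).
have kap_m : step_kap (inl u) = (t' + k)%N by rewrite /= eqxx.
have kap_old v : (step_kap (inl v) <= (t' + k).+1)%N.
  rewrite /=; case: eqP => _ //; case: ifP => // /oldlt/ltnW/leq_trans; exact.
have old_deg v : v != u -> deg v = nth 1%N ds (step_kap (inl v)).
  move=> vu; rewrite kap_v // (ml_deg L); case: ifPn => [h|]; first by rewrite nthE.
  by rewrite -leqNgt => h; rewrite !nth_default ?sizeE.
split.
- exact: step_edge.
- exact: step_dep_par.
- move=> x; rewrite sizeE; case: (stepP x) => [v vu|||] //=.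
  + exact: kap_old.
  + by rewrite eqxx.
  + by move=> i; rewrite ltnW // ltnS ltnW.
- move=> x; case: (stepP x) => [v vu||i|i j].
  + by rewrite deg_old (negbTE vu) addn0 old_deg.
  + by rewrite deg_old eqxx mul1n kap_m lastE; move: lu; rewrite /leaf => /eqP ->.
  + by rewrite deg_new /= (deg_twig e i) prednK // ltnW.
  + by rewrite deg_new /= (deg_tip j) nth_default // sizeE.
- move=> x y; rewrite sizeE.
  case: (stepP x) => [v vu||i|i j]; case: (stepP y) => [w wu||i'|i' j'].
  + rewrite !kap_v //; case: ifP => [h _|]; last by rewrite ltnn.
    case: ifP => [h' /addIn E|_ E]; first by congr inl; apply: (ml_inj L).
    by have := leqW (oldlt _ h); rewrite E ltnn.
  + rewrite kap_v // kap_m; case: ifP => [h _ E|]; last by rewrite ltnn.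
    by have := oldlt _ h; rewrite E ltnn.
  + rewrite kap_v // /=; case: ifP => [h _ E|]; last by rewrite ltnn.
    by have := ltn_ord i'; rewrite -E ltnNge leq_addl.
  + rewrite kap_v // /=; case: ifP => [h _ E|]; last by rewrite ltnn.
    by have := leqW (oldlt _ h); rewrite E ltnn.
  + rewrite kap_v // kap_m; case: ifP => [h _ E|_ _ /eqP]; last by rewrite ltn_eqF.
    by have := oldlt _ h; rewrite -E ltnn.
  + by [].
  + by rewrite kap_m /= => _ E; have := ilt i'; rewrite -E ltnn.
  + by rewrite kap_m /= => _ /eqP; rewrite ltn_eqF.
  + rewrite kap_v //=; case: ifP => [h _ E|_ _ E].
      by have := ltn_ord i; rewrite E ltnNge leq_addl.
    by have := leqW (ilt i); rewrite -E ltnn.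
  + by rewrite kap_m /= => _ E; have := ilt i; rewrite E ltnn.
  + by move=> _ /= /val_inj ->.
  + by move=> _ /= E; have := leqW (ilt i); rewrite E ltnn.
  + by rewrite /= ltnn.
  + by rewrite /= ltnn.
  + by rewrite /= ltnn.
  + by rewrite /= ltnn.
- move=> i; rewrite sizeE ltnS leq_eqVlt => /predU1P[->|it]; first by exists (inl u).
  have [ik|ki] := ltnP i k; first by exists (new_twig (Ordinal ik)).
  have it' : (i - k < t')%N by rewrite ltn_subLR // addnC.
  have [v vE] := ml_surj L it'.
  exists (inl v); rewrite kap_v ?vE ?it' ?subnK //.
  by apply: contraTneq it' => E; rewrite -vE E kap_u ltnn.
- rewrite sizeE kap_v; last by rewrite eq_sym.
  by rewrite kap_r0 ltnS ltnW // oldlt.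
- move=> x y.
  case: (stepP x) => [v vu||i|i j]; case: (stepP y) => [w wu||i'|i' j'].
  + move=> vr wr; rewrite (kap_v _ vu) (kap_v _ wu); case: ifP => [h|_]; last first.
      by case: ifP => [/oldlt h|_]; rewrite ?ltnn // ltnNge leqW // ltnW.
    move=> lt; have {lt}lt : (kap v < kap w)%N.
      move: lt; case: ifP => [_|/negbT]; first by rewrite ltn_add2r.
      by rewrite -leqNgt => h' _; apply: leq_trans h'.
    case: (ml_anti L vr wr lt) => [E|h']; [left|right].
      by rewrite [LHS]/= E.
    by rewrite [X in (X < _)%N]kap_par_old // [X in (_ < X)%N]kap_par_old // ltn_add2r.
  + move=> vr _; rewrite (kap_v _ vu) kap_m; case: ifP => [h _|_]; last first.
      by rewrite ltnNge leqnSn.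
    have lt : (kap v < kap u)%N by rewrite kap_u.
    case: (ml_anti L vr ur lt) => [E|h']; [left|right].
      by rewrite [LHS]/= E.
    by rewrite [X in (X < _)%N]kap_par_old // [X in (_ < X)%N]kap_par_old // ltn_add2r.
  + rewrite (kap_v _ vu) /=; case: ifP => [h _ _|_ _ _] lt.
      by have := ltn_trans lt (ltn_ord i'); rewrite ltnNge leq_addl.
    by have := leqW (ltn_trans lt (ilt i')); rewrite ltnn.
  + move=> vr _ _; right; rewrite par_tip [X in (_ < X)%N]kap_par_old //=.
    exact: leq_trans (ltn_ord i') (leq_addl _ _).
  + move=> _ wr; rewrite kap_m (kap_v _ wu); case: ifP => [h|h _].
      by rewrite ltnNge ltnW // oldlt.
    have lw : leaf w.
      rewrite (ml_leafE L ds'_ge2) eqn_leq (ml_max L) /=.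
      by move/negbT: h; rewrite -leqNgt.
    have := umax lw; rewrite leq_eqVlt => /predU1P[E|lt]; [left|right].
      by congr inl; apply/esym/(ml_inj L) => //; apply: (ml_kap_par L ds'_ge2).
    by rewrite [X in (X < _)%N]kap_par_old // [X in (_ < X)%N]kap_par_old // ltn_add2r.
  + by rewrite ltnn.
  + by rewrite kap_m /= ltnNge ltnW // ilt.
  + move=> _ _ _; right; rewrite par_tip [X in (_ < X)%N]kap_par_old //=.
    exact: leq_trans (ltn_ord i') (leq_addl _ _).
  + move=> _ wr _; right; rewrite par_twig kap_m kap_par_old // oldlt //.
    exact: (ml_kap_par L ds'_ge2).
  + move=> _ _ _; right; rewrite par_twig kap_m kap_par_old // oldlt //.
    exact: (ml_kap_par L ds'_ge2).
  + by move=> _ _ _; left; rewrite !par_twig.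
  + by move=> _ _ _; right; rewrite par_twig par_tip kap_m /= ilt.
  + by move=> _ _; rewrite ltnNge kap_old.
  + by move=> _ _; rewrite ltnNge kap_old.
  + by move=> _ _ /=; rewrite ltnNge leqW // ltnW.
  + by move=> _ _ /=; rewrite ltnn.
- move=> x; rewrite mem_cat => /orP[/mapP[v vl ->]|/mapP[i _ ->]].
    have h := ml_labels L vl.
    have vu : v != u by apply: contraTneq h => ->; rewrite kap_u ltnn.
    by rewrite [step_kap _]kap_v // h sizeE ltnS ltnW // oldlt.
  by rewrite twigE sizeE /= ltnS ltnW.
- have lab v : v \in labels G -> step_kap (attach_inl u A v) = (kap v + k)%N.
    move=> vl; have h := ml_labels L vl.
    have vu : v != u by apply: contraTneq h => ->; rewrite kap_u ltnn.
    by rewrite [LHS]kap_v // h.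
  rewrite pairwise_cat; apply/and3P; split.
  + apply/allrelP => x y /mapP[v vl ->] /mapP[i _ ->].
    by rewrite twigE lab //=; apply: leq_trans (ltn_ord i) (leq_addl _ _).
  + rewrite pairwise_map.
    apply: (@sub_in_pairwise _ (mem (labels G)) _ _ _ _ _ (ml_sorted L)).
      move=> v w vl wl vw.
      suff : (step_kap (attach_inl u A w) < step_kap (attach_inl u A v))%N by [].
      by rewrite !lab // ltn_add2r.
    exact/allP.
  + rewrite pairwise_map; apply: (sub_pairwise _ (pairwise_rev_enum k)).
    by move=> i j /=; rewrite !twigE.
- move=> x y.
  have labE v : attach_inl u A v \in labels step_graph = (v \in labels G).
    rewrite mem_cat mem_map; last by move=> a b [].
    rewrite orb_idr // => /mapP[i _]; by rewrite twigE.
  have labT i : new_twig i \in labels step_graph.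
    rewrite mem_cat; apply/orP; right; rewrite -twigE; apply: map_f.
    by rewrite mem_rev mem_enum.
  have k0 : (0 < k)%N by have := ds_ge2 kE; rewrite lastE.
  rewrite /leaf; case: (stepP y) => [w wu||i'|i' j'].
  + rewrite deg_old (negbTE wu) addn0; case: (stepP x) => [v vu||i|i j] xy lw.
    * by rewrite labE; apply: (ml_leaves L xy).
    * by rewrite labE; apply: (ml_leaves L xy).
    * exact: labT.
    * by move: xy; rewrite step_edge par_tip => /orP[] /andP[_].
  + rewrite deg_old eqxx mul1n; have /eqP -> := lu.
    by rewrite add1n eqSS eqn0Ngt k0.
  + rewrite deg_new /= (deg_twig e i') prednK; last exact: ltnW.
    by move=> _ /eqP E; have := e_ge2 i'; rewrite E.
  + move=> + _; rewrite step_edge par_tip; case: (stepP x) => [v vu||i|i j].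
    * by case/orP=> /andP[_].
    * by case/orP=> /andP[_].
    * by move=> _; apply: labT.
    * by rewrite par_tip => /orP[] /andP[_ /eqP/(congr1 step_dep)/addnI].
Qed.
End Step.

Lemma reduced_ge2 ds i : reduced ds -> (i < size ds)%N -> (1 < nth 1%N ds i)%N.
Proof. by case/andP=> _ /allP h it; apply: h; apply: mem_nth. Qed.

Lemma M_rec_layout n ds : ds != [::] -> reduced ds -> (size ds <= n)%N ->
  exists r0 p dep kap, @M_layout ds (M_rec n ds) r0 p dep kap.
Proof.
elim: n ds => [|n IH] ds ds0 dsr.
  by rewrite leqn0 size_eq0 (negbTE ds0).
move=> sn /=; case: ifPn => [small|big].
  by do 4!eexists; apply: base_layout.
rewrite -ltnNge in big.
have t0 : (0 < size ds)%N by rewrite lt0n size_eq0.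
have dtE : last 0%N ds = nth 1%N ds (size ds).-1.
  by rewrite nth_last; case: (ds) ds0.
have dt2 : (1 < last 0%N ds)%N by rewrite dtE reduced_ge2 // prednK.
set k := (last 0%N ds).-1; set ds' := drop k _.
have kE : last 0%N ds = k.+1 by rewrite prednK // ltnW.
have kt : (k.+1 < (size ds).-1)%N by rewrite -kE -ltnS prednK.
have s'E : size ds' = ((size ds).-1 - k)%N.
  by rewrite size_drop size_take_min (minn_idPl (leq_pred _)).
have sizeE : size ds = (size ds' + k).+1.
  by rewrite s'E subnK ?prednK // ltnW // ltnW.
have nthE i : (i < size ds')%N -> nth 1%N ds (i + k) = nth 1%N ds' i.
  rewrite s'E ltn_subRL => h; rewrite nth_drop nth_take //.
  by rewrite addnC.
have lastE : nth 1%N ds (size ds' + k) = k.+1.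
  by rewrite -kE dtE sizeE.
have ds'0 : ds' != [::] by rewrite -size_eq0 s'E -lt0n subn_gt0 ltnW.
have ds'r : reduced ds'.
  case/andP: dsr => h1 h2; apply/andP; split.
    apply: drop_sorted; exact: take_sorted.
  by apply/allP => x /mem_drop/mem_take; apply: (allP h2).
have s'n : (size ds' <= n)%N.
  by move: sn; rewrite sizeE ltnS; apply: leq_trans; apply: leq_addr.
have [r0 [p [dep [kap L]]]] := IH ds' ds'0 ds'r s'n.
have ge2 i := reduced_ge2 (i := i) dsr; have ge2' i := reduced_ge2 (i := i) ds'r.
have [u [uE lu ur umax]] := M_leafP L ge2'.
have L2 := step_layout L ge2 ge2' sizeE nthE lastE lu ur umax.
rewrite /M_step uE; do 4!eexists; exact: L2.
Qed.

Lemma sorted_nth_geq (s : seq nat) x i j : sorted geq s -> (i <= j < size s)%N ->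
  (nth x s j <= nth x s i)%N.
Proof.
move=> ss /andP[ij js]; have is_ := leq_ltn_trans ij js.
have tr : transitive geq by move=> a b c h1 h2; apply: leq_trans h2 h1.
have rf : reflexive geq by move=> a; apply: leqnn.
exact: (sorted_leq_nth tr rf x ss i j is_ js ij).
Qed.

Section Degrees.
Variables (ds : seq nat) (G : lgraph) (r0 : G) (p : G -> G) (dep kap : G -> nat).
Hypotheses (L : M_layout ds r0 p dep kap) (dsr : reduced ds).
Let ge2 i : (i < size ds)%N -> (1 < nth 1%N ds i)%N. Proof. exact: reduced_ge2. Qed.

Lemma M_layout_layout : layout r0 p dep kap.
Proof.
split.
- by rewrite (ml_deg L) ge2 // (ml_root L).
- exact: ml_edge L.
- exact: ml_dep L.
- by move=> x E; apply/esym/(ml_inj L); rewrite ?E ?(ml_root L).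
split; last exact: ml_anti L.
move=> x y xy; rewrite !(ml_deg L).
have [yt|yt] := ltnP (kap y) (size ds); last first.
  rewrite nth_default //; have [xt|xt] := ltnP (kap x) (size ds).
    by rewrite ltnW // ge2.
  by rewrite nth_default.
by case/andP: dsr => ss _; apply: sorted_nth_geq; rewrite ?xy.
Qed.

(** The number [l] of leaves is left open here; the degree sum determines it later. *)
Lemma M_layout_degrees : exists l, perm_eq [seq deg x | x : G] (ds ++ nseq l 1%N).
Proof.
pose s := [seq x <- enum G | (kap x < size ds)%N].
pose s' := [seq x <- enum G | ~~ (kap x < size ds)%N].
exists (size s').
have sE : perm_eq [seq kap x | x <- s] (iota 0 (size ds)).
  apply: uniq_perm; rewrite ?iota_uniq //.
    rewrite map_inj_in_uniq; first by apply: filter_uniq; apply: enum_uniq.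
    move=> x y.
    by rewrite !mem_filter => /andP[h _] _; apply: (ml_inj L).
  move=> i; rewrite mem_iota add0n /=; apply/mapP/idP => [[x]|it].
    by rewrite mem_filter => /andP[h _] ->.
  have [x xi] := ml_surj L it; exists x => //.
  by rewrite mem_filter xi it mem_enum.
have E1 : perm_eq [seq deg x | x : G] ([seq deg x | x <- s] ++ [seq deg x | x <- s']).
  by rewrite -map_cat /image_mem perm_map // perm_sym perm_filterC.
apply: perm_trans E1 _.
have -> : [seq deg x | x <- s'] = nseq (size s') 1%N.
  rewrite -(size_map (@deg G)); apply/all_pred1P/allP => d /mapP[x].
  rewrite mem_filter -leqNgt => /andP[h _] ->.
  by rewrite (ml_deg L) nth_default.
rewrite perm_cat2r.
have -> : [seq deg x | x <- s] = [seq nth 1%N ds i | i <- [seq kap x | x <- s]].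
  by rewrite -map_comp; apply: eq_map => x /=; rewrite (ml_deg L).
apply: perm_trans (perm_map _ sE) _.
by rewrite -[X in perm_eq _ X](mkseq_nth 1%N) /mkseq.
Qed.
End Degrees.

(** * Degree sums, and trees without vertices of degree at least 2 *)

Lemma sum_degree (G : graph) (Gt : is_tree G) (D : seq nat) : perm_eq D [seq deg x | x : G] ->
  sumn D = ((size D).-1).*2.
Proof.
move=> DG; rewrite (perm_sumn DG) (perm_size DG) size_image.
case: (Gt) => _ _ /card_gt0P[x0 _] _ _.
have dp x : x != x0 -> (depth x0 (par x0 x) < depth x0 x)%N.
  by move=> xx; rewrite (depth_par Gt xx).
rewrite -(sum_deg (edge_parE Gt x0) dp).
by rewrite sumnE big_image.
Qed.

(** Every vertex other than [g0] is a neighbour of [g0], and there is at most one. *)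
Lemma small_tree_star (G : graph) (Gt : is_tree G) :
  (forall x : G, (deg x <= 1)%N) -> giso G (star #|G|).
Proof.
move=> d1; case: (Gt) => _ Gi /card_gt0P[g0 _] _ _.
have par0 x : x != g0 -> par g0 x = g0.
  move=> xg; apply/eqP; apply: contraT => pg.
  have e1 := edge_par Gt pg; have e2 := edge_par Gt xg.
  have n : x != par g0 (par g0 x).
    by apply: contraTneq (br_par Gt pg) => <-; rewrite br_cut ?(br_par Gt xg) // edge_par.
  by have := deg_child Gt e1 e2 n; rewrite ltnNge d1.
case: (boolP [exists y, y != g0]) => [/existsP[y yg]|/existsPn H].
  have only x : x != g0 -> x = y.
    move=> xg; have ex := edge_par Gt xg; have ey := edge_par Gt yg.
    rewrite par0 // in ex; rewrite par0 // in ey.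
    apply/eqP; apply: contraT => xy.
    by have := introT (deg_gt1P ey) (ex_intro2 _ _ x ex xy); rewrite ltnNge d1.
  have -> : #|G| = 2%N.
    rewrite (eq_card (B := pred2 g0 y)) ?card2 1?eq_sym ?yg // => x; rewrite !inE.
    by have [//|xg] := eqVneq x g0; rewrite (only x xg) eqxx.
  have yE : edge g0 y by have := edge_par Gt yg; rewrite par0.
  pose c : star 2 := Some (Tagged (fun _ : 'I_1 => bullet : Type) (i := ord0) tt).
  exists (fun x => if x == g0 then rootv (star 2) else c).
    apply: (@emb_bij G (star 2)) => [a b|[[i []]|]].
    - by have [->|ag] := eqVneq a g0; have [->|bg] := eqVneq b g0 => //; rewrite (only a ag) (only b bg).
    - by exists y; rewrite (negbTE yg) (ord1 i).
    - by exists g0; rewrite eqxx.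
  move=> a b; have [->|ag] := eqVneq a g0; have [->|bg] := eqVneq b g0.
  - by rewrite Gi.
  - by rewrite (only b bg) yE.
  - by rewrite (only a ag) (edge_sym Gt) yE.
  - by rewrite (only a ag) (only b bg) Gi.
have all0 x : x = g0 by apply/eqP; rewrite -[_ == _]negbK.
have -> : #|G| = 1%N by rewrite (eq_card (B := pred1 g0)) ?card1 // => x; rewrite !inE (all0 x) eqxx.
exists (fun _ => rootv (star 1)); last by move=> a b; rewrite (all0 a) (all0 b) Gi.
apply: (@emb_bij G (star 1)) => [a b _|[[[]]|]//]; first by rewrite (all0 a) (all0 b).
Qed.

(** * The two cases of the theorem *)

Section Main.
Variables (R : realType) (rho : rooted_graph -> R) (f : seq R -> R).
Hypotheses (rho_inv : rooted_tree_invariant rho) (rho_rec : recursive_via rho f).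
Variables (T : graph) (D : seq nat).
Hypotheses (Tt : is_tree T) (T_deg : degree_sequence T D) (T_ext : exchange_extremal rho T).
Local Open Scope ring_scope.

Let r_total v w : v != w -> (1 < deg v)%N -> (1 < deg w)%N ->
  xge (@brho R rho T) v w || xge (@brho R rho T) w v.
Proof. exact: xge_total. Qed.

Let r_leaf2 (u v s w : T) : edge u v -> edge s w -> deg v = 1%N -> deg w = 1%N ->
  brho rho u v = brho rho s w.
Proof. by move=> uv sw dv dw; rewrite !brho_leaf. Qed.

Lemma greedy_of_extremal : strictly_increasing rho f ->
  (forall B : rooted_graph, is_tree B -> (1 < #|B|)%N -> rho bullet < rho B) ->
  giso T (greedy_tree D).
Proof.
move=> fi bmin.
have r_leaf (u v s w : T) : edge u v -> edge s w -> deg v = 1%N -> (1 < deg w)%N ->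
    (brho rho u v <= brho rho s w) && ~~ (brho rho s w <= brho rho u v).
  move=> uv sw dv dw; rewrite (brho_leaf rho_inv Tt uv dv) -ltNge.
  have h := bmin _ (branch_tree Tt sw) (brho_nonleaf Tt sw dw).
  by rewrite h ltW.
have r_dom (u v s t : T) : edge u v -> edge s t -> (1 < deg v)%N ->
    (1 < deg t)%N -> (deg t <= deg v)%N ->
    (forall x y, edge v x -> x != u -> edge t y -> y != s -> brho rho t y <= brho rho v x) ->
    brho rho s t <= brho rho u v /\
    (brho rho u v <= brho rho s t -> deg v = deg t /\
     forall x y, edge v x -> x != u -> edge t y -> y != s -> brho rho v x <= brho rho t y).
  move=> uv st dv dt dtv le.
  by have [X [Y [-> -> h1 h2]]] := branch_dominance rho_inv rho_rec Tt fi uv st dv dt dtv le.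
have [x0 x0ge] := dominating_vertex Tt r_total r_leaf2 r_leaf r_dom.
have [lt [ltt lt0 ltd ltp]] := bfs_order Tt r_total r_leaf2 r_leaf r_dom x0ge.
apply: (greedy_iso (dep := depth x0) (edge_parE Tt x0) _ ltt lt0 ltd ltp T_deg).
by move=> x xx; rewrite (depth_par Tt xx).
Qed.

Lemma M_tree_of_extremal : strictly_decreasing rho f ->
  (forall B : rooted_graph, is_tree B -> (1 < #|B|)%N -> rho B < rho bullet) ->
  giso T (M_tree D).
Proof.
move=> fd bmax; have [Ds Dp] := T_deg.
(* Without a vertex of degree at least 2 the reduced sequence is empty and [M_tree] is a star. *)
case: (boolP [exists v : T, (1 < deg v)%N]) => [/existsP[v0 dv0]|/existsPn H]; last first.
  have red0 : reduced_degree_sequence D = [::].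
    apply/eqP; rewrite -(negbK (_ == _)) -has_filter; apply/hasPn => d.
    by rewrite (perm_mem Dp) => /mapP[x _ ->]; apply: H.
  rewrite /M_tree red0 (perm_size Dp) size_image; apply: small_tree_star => // x.
  by rewrite leqNgt H.
have r_leaf (u v s w : T) : edge u v -> edge s w -> deg v = 1%N -> (1 < deg w)%N ->
    (brho rho s w <= brho rho u v) && ~~ (brho rho u v <= brho rho s w).
  move=> uv sw dv dw; rewrite (brho_leaf rho_inv Tt uv dv) -ltNge.
  have h := bmax _ (branch_tree Tt sw) (brho_nonleaf Tt sw dw).
  by rewrite h ltW.
have r_dom (u v s t : T) : edge u v -> edge s t -> (1 < deg v)%N ->
    (1 < deg t)%N -> (deg t <= deg v)%N ->
    (forall x y, edge v x -> x != u -> edge t y -> y != s -> brho rho t y <= brho rho v x) ->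
    brho rho u v <= brho rho s t /\
    (brho rho s t <= brho rho u v -> deg v = deg t /\
     forall x y, edge v x -> x != u -> edge t y -> y != s -> brho rho v x <= brho rho t y).
  move=> uv st dv dt dtv le; have fi := strictly_decreasingN fd.
  have [X [Y [-> -> h1 h2]]] := branch_dominance rho_inv rho_rec Tt fi uv st dv dt dtv le.
  by rewrite lerN2 in h1; rewrite lerN2 in h2.
have [r0 [p [dep [kap LT]]]] := decreasing_layout Tt r_total r_leaf2 r_leaf r_dom dv0.
set ds := reduced_degree_sequence D.
have v0D : deg v0 \in D by rewrite (perm_mem Dp); apply: map_f; rewrite mem_enum.
have ds0 : ds != [::].
  by rewrite -has_filter; apply/hasP; exists (deg v0).
have dsr : reduced ds.
  apply/andP; split; last exact: filter_all.
  by apply: sorted_filter Ds => a b c h1 h2; apply: leq_trans h2 h1.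
have [q0 [pm [dm [km L]]]] := M_rec_layout ds0 dsr (leqnn _).
have ME : M_tree D = M_rec (size ds) ds.
  by rewrite /M_tree -/ds; case: (ds) ds0.
rewrite ME; apply: (layout_iso LT (M_layout_layout L dsr) T_deg); split=> //.
have [l El] := M_layout_degrees L.
have [l' El'] : exists l', perm_eq D (ds ++ nseq l' 1%N).
  exists (size [seq d <- D | ~~ (2 <= d)%N]).
  rewrite -(perm_filterC (leq 2) D) perm_cat2l -[X in perm_eq X _]/([seq d <- D | ~~ (2 <= d)%N]).
  have -> : [seq d <- D | ~~ (2 <= d)%N] = nseq (size [seq d <- D | ~~ (2 <= d)%N]) 1%N; last by rewrite size_nseq.
  apply/all_pred1P/allP => d; rewrite mem_filter (perm_mem Dp) => /andP[d2 /mapP[x _ dE]].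
  have [xx|xx] := eqVneq x v0; first by rewrite dE xx dv0 in d2.
  have := deg_edge_gt0 Tt (edge_par Tt xx); rewrite -dE.
  by case: (d) d2 => [|[]].
have s1 := sum_degree Tt Dp; rewrite (perm_sumn El') (perm_size El') in s1.
have s2 : sumn (ds ++ nseq l 1%N) = ((size (ds ++ nseq l 1%N)).-1).*2.
  rewrite -(perm_sumn El) -(perm_size El) size_image -(sum_deg (ml_edge L) (ml_dep L)).
  by rewrite sumnE big_image.
(* Both degree sequences are [ds] followed by ones, and both sum to twice the number of vertices
   minus 2; this fixes the number of ones. *)
have ll : l = l'.
  move: s1 s2; rewrite !sumn_cat !sumn_nseq !size_cat !size_nseq !mul1n.
  have : (0 < size ds)%N by rewrite lt0n size_eq0.
  case: (size ds) => // n _; rewrite !addSn /= => s1 s2.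
  by lia.
by apply: perm_trans El' _; rewrite -ll perm_sym.
Qed.
End Main.

Local Open Scope ring_scope.

Theorem mainTheorem1 (R : realType) (rho : rooted_graph -> R) (f : seq R -> R)
    (rho_inv : rooted_tree_invariant rho)
    (rho_rec : recursive_via rho f)
    (f_sym : symmetric_fun rho f)
    (T : graph) (D : seq nat)
    (T_tree : is_tree T) (T_deg : degree_sequence T D)
    (T_ext : exchange_extremal rho T) :
  (strictly_increasing rho f ->
   (forall B : rooted_graph, is_tree B -> (1 < #|B|)%N -> rho bullet < rho B) ->
   giso T (greedy_tree D)) /\
  (strictly_decreasing rho f ->
   (forall B : rooted_graph, is_tree B -> (1 < #|B|)%N -> rho B < rho bullet) ->
   giso T (M_tree D)).
Proof.
by split=> fm bm; [apply: (greedy_of_extremal rho_inv rho_rec T_tree T_deg T_ext)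
  | apply: (M_tree_of_extremal rho_inv rho_rec T_tree T_deg T_ext)].
Qed.
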